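(* Let $f\colon\mathbb N\to\mathbb U$ be a pretentious multiplicative function. Then the following properties are equivalent: (i) $f(n)=n^{it}$, $n\in\mathbb N$, for some $t\in\mathbb R$. (ii) At least one Furstenberg system of $f$ for Cesàro or logarithmic averages has trivial rational spectrum. (iii) All Furstenberg systems of $f$ for Cesàro or logarithmic averages have trivial rational spectrum. (iv) All Furstenberg systems of $f$ for Cesàro or logarithmic averages are identity systems. (v) $\lim_{N\to\infty}\mathbb E_{n\in[N]}|f(n+1)-f(n)|=0$.
   Context: $\mathbb N=\{1,2,\ldots\}$, $\mathbb P$ is the set of primes, $\mathbb U$ is the closed complex unit disc, $e(t)=e^{2\pi i t}$, $[N]=\{1,\ldots,N\}$. A function $f\colon\mathbb N\to\mathbb U$ is multiplicative if $f(mn)=f(m)f(n)$ whenever $(m,n)=1$. For multiplicative $f,g\colon\mathbb N\to\mathbb U$ let $\mathbb D^2(f,g)=\sum_{p\in\mathbb P}\frac1p\big(1-\mathrm{Re}(f(p)\overline{g(p)})\big)$ and write $f\sim g$ if $\mathbb D(f,g)<+\infty$. $f$ is pretentious if $f\sim n^{it}\cdot\chi$ for some $t\in\mathbb R$ and some primitive Dirichlet character $\chi$ (the constant $\chi=1$, with conductor $1$, is regarded as primitive). For a finite non-empty $A\subset\mathbb N$, $\mathbb E_{n\in A}a(n)=\frac1{|A|}\sum_{n\in A}a(n)$ (Cesàro average) and $\mathbb E^{\log}_{n\in A}a(n)=\big(\sum_{n\in A}\frac1n\big)^{-1}\sum_{n\in A}\frac{a(n)}n$ (logarithmic average); these also act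 on measures. Let $X=\mathbb U^{\mathbb Z}$ with the product topology and let $T\colon X\to X$ be the shift $(Tx)(k)=x(k+1)$. A sequence $a\colon\mathbb N\to\mathbb U$ is extended to $\mathbb Z$ arbitrarily (the extension does not matter) and viewed as a point of $X$. If $(N_k)$ is a strictly increasing sequence of positive integers and the weak-star limit $\mu=\lim_{k\to\infty}\mathbb E_{n\in[N_k]}\delta_{T^na}$ exists, then $(X,\mu,T)$ is called the Furstenberg system of $a$ along $(N_k)$ for Cesàro averages. With $\mathbb E^{\log}$ in place of $\mathbb E$ one gets the Furstenberg system of $a$ along $(N_k)$ for logarithmic averages. A Furstenberg system of $a$ is one obtained along some $(N_k)$. The spectrum $\mathrm{Spec}(X,\mu,T)$ is the set of $\alpha\in[0,1)$ for which there is a non-zero $g\in L^2(\mu)$ with $g\circ T=e(\alpha)\,g$. The system has trivial rational spectrum if $\mathrm{Spec}(X,\mu,T)\cap\mathbb Q=\{0\}$. It is an identity system if $Tx=x$ for $\mu$-a.e. $x\in X$. *)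

(* Defs.v *)
From HB Require Import structures.
From mathcomp Require Import all_boot all_order all_algebra complex.
From mathcomp Require Import all_classical all_reals all_analysis.

Set Implicit Arguments.
Unset Strict Implicit.
Unset Printing Implicit Defensive.
Import Order.TTheory GRing.Theory Num.Theory.
Import numFieldNormedType.Exports.

Local Open Scope classical_set_scope.
Local Open Scope ring_scope.
Local Open Scope complex_scope.

(* R[i] has an R[i]-valued norm in MathComp; Normc.normc is its R-valued
   version.  A function on the positive integers is encoded as a function on
   nat with an irrelevant value at 0. *)

Record unit_disc (R : realType) := UnitDisc {
  disc_val : R[i];
  disc_valP : Normc.normc disc_val <= 1 }.

HB.instance Definition _ (R : realType) := [isSub for @disc_val R].
HB.instance Definition _ (R : realType) := [Choice of unit_disc R by <:].
(* R[i] carries its topology only when seen as a numFieldType *)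
HB.instance Definition _ (R : realType) := Topological.copy (unit_disc R)
  (@initial_topology (unit_disc R) (R[i] : numFieldType) (@disc_val R)).

Lemma unit_disc0_subproof (R : realType) : Normc.normc (0 : R[i]) <= 1.
Proof. by rewrite Normc.normc0 ler01. Qed.

HB.instance Definition _ (R : realType) :=
  isPointed.Build (unit_disc R) (UnitDisc (unit_disc0_subproof R)).

Definition cis (R : realType) (theta : R) : R[i] := cos theta +i* sin theta.

Definition e2pi (R : realType) (t : R) : R[i] := cis (2 * pi * t).

(* n ^ (i t) *)
Definition nat_ipow (R : realType) (t : R) (n : nat) : R[i] :=
  cis (t * ln n%:R).

Definition multiplicative_function (R : realType) (f : nat -> unit_disc R) :=
  forall m n : nat, (0 < m)%N -> (0 < n)%N -> coprime m n ->
    disc_val (f (m * n)%N) = disc_val (f m) * disc_val (f n).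

Definition pretentious_dist2 (R : realType) (f g : nat -> R[i]) : \bar R :=
  (\sum_(0 <= p <oo | prime p)
     (p%:R^-1 * (1 - complex.Re (f p * conjc (g p))))%:E)%E.

Definition pretentious_dist (R : realType) (f g : nat -> R[i]) : \bar R :=
  sqrte (pretentious_dist2 f g).

Definition pretentious_equiv (R : realType) (f g : nat -> R[i]) :=
  (pretentious_dist f g < +oo)%E.

Definition dirichlet_character (R : realType) (q : nat) (chi : nat -> R[i]) :=
  [/\ (0 < q)%N,
      forall n, chi (n + q)%N = chi n,
      forall m n, chi (m * n)%N = chi m * chi n
    & forall n, (chi n != 0) = coprime n q].

(* not induced by a character of a smaller modulus; for q = 1 this gives
   exactly the constant 1 *)
Definition primitive_character (R : realType) (q : nat) (chi : nat -> R[i]) :=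
  dirichlet_character q chi /\
  forall (d : nat) (psi : nat -> R[i]),
    (d %| q)%N -> (d < q)%N -> dirichlet_character d psi ->
    ~ (forall n, coprime n q -> chi n = psi n).

Definition pretentious_function (R : realType) (f : nat -> unit_disc R) :=
  exists (t : R) (q : nat) (chi : nat -> R[i]),
    primitive_character q chi /\
    pretentious_equiv (fun n => disc_val (f n)) (fun n => nat_ipow t n * chi n).

Inductive averaging := Cesaro | Logarithmic.

Definition weight (R : realType) (c : averaging) (n : nat) : {nonneg R} :=
  match c with
  | Cesaro => 1%:nng
  | Logarithmic => (n%:R^-1)%:nng
  end.

Definition total_weight (R : realType) (c : averaging) (N : nat) : R :=
  \sum_(1 <= n < N.+1) (weight R c n)%:num.

Lemma inv_total_weight_ge0 (R : realType) (c : averaging) (N : nat) :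
  0 <= (total_weight R c N)^-1.
Proof. by rewrite invr_ge0 sumr_ge0. Qed.

(* average over [N] = {1, ..., N} *)
Definition weighted_average (R : realType) (c : averaging) (a : nat -> R)
    (N : nat) : R :=
  (total_weight R c N)^-1 * \sum_(1 <= n < N.+1) (weight R c n)%:num * a n.

(* the same for measures; msum m N is m 0 + ... + m (N - 1) *)
Definition weighted_average_measure (R : realType) (c : averaging) d
    (X : measurableType d) (m : nat -> {measure set X -> \bar R}) (N : nat) :
    {measure set X -> \bar R} :=
  mscale (NngNum (inv_total_weight_ge0 R c N))
    (msum (fun k => mscale (weight R c k.+1) (m k.+1)) N).

Definition sequence_space (R : realType) : Type := {ptws int -> unit_disc R}.

HB.instance Definition _ (R : realType) :=
  Topological.copy (sequence_space R) {ptws int -> unit_disc R}.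
HB.instance Definition _ (R : realType) :=
  isPointed.Build (sequence_space R) (fun=> point).

Definition borel_sequence_space (R : realType) :=
  g_sigma_algebraType (@open (sequence_space R)).

Definition shift_map (R : realType) (x : borel_sequence_space R) :
    borel_sequence_space R :=
  fun k : int => x (k + 1).

(* Real-valued test functions suffice: the complex case follows by linearity. *)
Definition weak_star_cvg (R : realType)
    (m : nat -> {measure set borel_sequence_space R -> \bar R})
    (mu : {measure set borel_sequence_space R -> \bar R}) :=
  forall F : sequence_space R -> R, continuous F ->
    (fun k => Rintegral (m k) setT F) @ \oo --> Rintegral mu setT F.

Definition extends_sequence (R : realType) (x : borel_sequence_space R)
    (a : nat -> unit_disc R) :=
  forall n : nat, (0 < n)%N -> x n%:Z = a n.

Definition furstenberg_system_along (R : realType) (c : averaging)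
    (a : nat -> unit_disc R) (N_ : nat -> nat)
    (mu : probability (borel_sequence_space R) R) :=
  exists2 x, extends_sequence x a &
    weak_star_cvg
      (fun k => weighted_average_measure c
         (fun n => dirac (iter n (@shift_map R) x)) (N_ k))
      mu.

Definition furstenberg_system (R : realType) (c : averaging)
    (a : nat -> unit_disc R) (mu : probability (borel_sequence_space R) R) :=
  exists N_ : nat -> nat,
    [/\ forall k, (0 < N_ k)%N,
        {homo N_ : j k / (j < k)%N}
      & furstenberg_system_along c a N_ mu].

Section measure_preserving_systems.
Context (R : realType) d (X : measurableType d).
Variables (T : X -> X) (mu : probability X R).

Definition complex_L2 (g : X -> R[i]) :=
  [/\ measurable_fun setT (fun x => complex.Re (g x)),
      measurable_fun setT (fun x => complex.Im (g x))
    & (\int[mu]_x (Normc.normc (g x) ^+ 2)%:E < +oo)%E].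

Definition system_spectrum : set R :=
  [set alpha | 0 <= alpha < 1 /\
    exists g : X -> R[i],
      [/\ complex_L2 g,
          ~ {ae mu, forall x, g x = 0}
        & {ae mu, forall x, g (T x) = e2pi alpha * g x}]].

Definition trivial_rational_spectrum :=
  system_spectrum `&` range (@ratr R) = [set 0].

Definition identity_system := {ae mu, forall x, T x = x}.

End measure_preserving_systems.

(* Main.v *)
From HB Require Import structures.
Require Import Defs.
From mathcomp Require Import all_boot all_order all_algebra complex.
From mathcomp Require Import all_classical all_reals all_analysis.
From mathcomp Require Import ring lra zify measurable_realfun.
From mathcomp Require cyclic.

Set Implicit Arguments.
Unset Strict Implicit.
Unset Printing Implicit Defensive.
Import Order.TTheory GRing.Theory Num.Theory.
Import numFieldNormedType.Exports.
Import Normc.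

Local Open Scope classical_set_scope.
Local Open Scope ring_scope.

(** Only one implication has arithmetic content: a single Furstenberg system
  with trivial rational spectrum already forces f n = n ^ (i t).  The others
  are soft.  Consecutive values of n ^ (i t) differ by O(1 / n), so they agree
  on average; when consecutive values agree on average, |x 1 - x 0| has
  integral 0 for the limit measure, and shift invariance makes almost every
  sequence constant ([identity_of_small_gaps]); in an identity system an
  eigenvalue can only be 1 ([identity_trivial_rational_spectrum]).  To draw
  a conclusion from a statement about all systems one needs one of them, which
  the compactness of the sequence space supplies
  ([furstenberg_system_exists]).

  From spectrum to arithmetic.  Let alpha be a rational which is not
  an eigenvalue of the system.  By von Neumann's argument the convex
  combinations of the rotated translates e(- k alpha) x k of the coordinate
  function x 0 have arbitrarily small L2 norm: a minimizing sequence is Cauchy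
  by the parallelogram law, and a nonzero limit would be an eigenfunction
  ([small_element_of_missing_eigenvalue]).  Along the orbit of f each of these
  combinations correlates with omega n * e(- n alpha), omega slowly varying,
  exactly as f itself does.  Hence f has no such correlation at all
  ([trivial_spectrum_no_correlation]), and this says that f, multiplied by a
  slowly varying omega, has asymptotically the same averages on all residue
  classes of a given modulus ([residues_equidistribute]).

  From arithmetic to n ^ (i t).  Let f pretend to be n ^ (i t) chi n, and let
  g n be f n times the conjugate of n ^ (i t) chi n, so that g pretends to be
  1.  Let Q be divisible exactly by the primes up to K.  On the residue class
  of 1 modulo Q only large primes matter, and there the Turan-Kubilius
  inequality shows that g n is on average close to a unimodular function of n
  that varies slowly, the exponential of i times the sum of Im (g p) / p over
  the primes K < p <= n ^ (1 / 4) ([class_concentration], [drift_mean_slow]).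
  Dividing f by n ^ (i t) and by this function gives a function that is close
  to 1 on the class of 1 modulo P Q, and close to f P / P ^ (i t) on the class
  of P modulo P Q, for every power P of a prime p <= K.  The two averages
  agree, so f P = P ^ (i t) ([pretentious_prime_power]), and multiplicativity
  finishes the proof ([pretentious_rigidity]). *)

(** * Complex numbers near the unit circle *)

Section complex_tools.
Context {R : realType}.
Implicit Types (z w : R[i]) (a b : R).
Local Open Scope complex_scope.

Lemma normc_ge0 z : 0 <= normc z.
Proof. by case: z => a b; rewrite sqrtr_ge0. Qed.

Lemma sqr_normcE z : normc z ^+ 2 = complex.Re z ^+ 2 + complex.Im z ^+ 2.
Proof. by case: z => a b; rewrite /= sqr_sqrtr // addr_ge0 ?sqr_ge0. Qed.

Lemma le_normcB z w : normc (z - w) <= normc z + normc w.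
Proof. by rewrite -[X in _ <= _ + X]normcN; apply: le_normcD. Qed.

Lemma normcBC z w : normc (z - w) = normc (w - z).
Proof. by rewrite -normcN opprB. Qed.

Lemma normc_sum (I : Type) (r : seq I) (P : pred I) (F : I -> R[i]) :
  normc (\sum_(i <- r | P i) F i) <= \sum_(i <- r | P i) normc (F i).
Proof.
elim/big_ind2: _ => //; first by rewrite normc0.
by move=> x1 x2 y1 y2 h1 h2; apply: (le_trans (le_normcD _ _)); apply: lerD.
Qed.

Lemma normr_Re_le z : `|complex.Re z| <= normc z.
Proof.
rewrite -(@ler_pXn2r _ 2) ?nnegrE ?normc_ge0 // sqr_normcE.
by rewrite real_normK ?num_real // lerDl sqr_ge0.
Qed.

Lemma normr_Im_le z : `|complex.Im z| <= normc z.
Proof.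
rewrite -(@ler_pXn2r _ 2) ?nnegrE ?normc_ge0 // sqr_normcE.
by rewrite real_normK ?num_real // lerDr sqr_ge0.
Qed.

Lemma normc_le_ReIm z : normc z <= `|complex.Re z| + `|complex.Im z|.
Proof.
rewrite -(@ler_pXn2r _ 2) ?nnegrE ?normc_ge0 ?addr_ge0 // sqr_normcE.
rewrite sqrrD !real_normK ?num_real //.
by rewrite lerD2r lerDl mulrn_wge0 // mulr_ge0.
Qed.

Lemma normc_real a : normc (a%:C) = `|a|.
Proof. by rewrite /= expr0n /= addr0 sqrtr_sqr. Qed.

Lemma normc_prod_le1 (I : Type) (r : seq I) (P : pred I) (F : I -> R[i]) :
  (forall i, P i -> normc (F i) <= 1) -> normc (\prod_(i <- r | P i) F i) <= 1.
Proof.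
move=> h; elim/big_rec: _ => [|i x Pi hx]; first by rewrite normc1.
by rewrite normcM mulr_ile1 ?normc_ge0 ?h.
Qed.

Lemma prodB_le (I : Type) (r : seq I) (P : pred I) (F G : I -> R[i]) :
  (forall i, P i -> normc (F i) <= 1) -> (forall i, P i -> normc (G i) <= 1) ->
  normc (\prod_(i <- r | P i) F i - \prod_(i <- r | P i) G i)
    <= \sum_(i <- r | P i) normc (F i - G i).
Proof.
move=> hF hG; elim: r => [|i r IH]; first by rewrite !big_nil subrr normc0.
rewrite !big_cons; case: ifP => // Pi.
set p := \prod_(j <- r | P j) F j in IH *.
set q := \prod_(j <- r | P j) G j in IH *.
have -> : F i * p - G i * q = (F i - G i) * p + G i * (p - q) by ring.
apply: (le_trans (le_normcD _ _)); rewrite !normcM lerD //.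
  by rewrite ler_piMr ?normc_ge0 // normc_prod_le1.
by apply: le_trans IH; rewrite ler_piMl ?normc_ge0 // hG.
Qed.

Lemma normc_cis a : normc (cis a) = 1.
Proof. by rewrite /cis /= cos2Dsin2 sqrtr1. Qed.

Lemma cis0 : cis (0 : R) = 1.
Proof. by rewrite /cis cos0 sin0. Qed.

Lemma cisD a b : cis (a + b) = cis a * cis b.
Proof. by rewrite /cis cosD sinD; apply/eqP; rewrite eq_complex /= eqxx addrC eqxx. Qed.

Lemma cisN a : cis (- a) = (cis a)^*%C.
Proof. by rewrite /cis cosN sinN. Qed.

Lemma cisMN a : cis a * cis (- a) = 1.
Proof. by rewrite -cisD subrr cis0. Qed.

Lemma cis_sum (I : Type) (r : seq I) (P : pred I) (F : I -> R) :
  cis (\sum_(i <- r | P i) F i) = \prod_(i <- r | P i) cis (F i).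
Proof. by apply: (big_morph _ cisD); exact: cis0. Qed.

Lemma cis2pin (n : nat) : cis (2 * pi * n%:R : R) = 1.
Proof.
elim: n => [|n IH]; first by rewrite mulr0 cis0.
rewrite -[n.+1%:R]natr1 mulrDr cisD IH mul1r mulr1 /cis mulr_natl cos2pi sin2pi.
by [].
Qed.

Lemma sqr_normc_cisB1 a : normc (cis a - 1) ^+ 2 = 2 * (1 - cos a).
Proof.
rewrite sqr_normcE /= subr0.
have := cos2Dsin2 a; set x := cos a; set y := sin a; nra.
Qed.

Lemma normr_le_amgm (t a : R) : 0 < t -> `|a| <= t / 2 + a ^+ 2 / (2 * t).
Proof.
move=> t0; rewrite -subr_ge0.
rewrite (_ : _ - `|a| = (`|a| - t) ^+ 2 / (2 * t)).
  by rewrite divr_ge0 ?sqr_ge0 // mulr_ge0 // ltW.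
by rewrite -(real_normK (num_real a)); field; rewrite gt_eqF.
Qed.

(** The mean value theorem on the segment between 0 and a, whatever the sign
  of a. *)
Lemma mean_value_from0 (f df : R -> R) a :
  (forall x, is_derive x (1 : R) f (df x)) -> exists2 c, `|c| <= `|a| & f a - f 0 = df c * a.
Proof.
move=> hd.
have cf : continuous f by move=> x; apply/differentiable_continuous/derivable1_diffP; have [] := hd x.
case: (leP 0 a) => a0.
  have [c] := MVT_segment a0 (fun x _ => hd x) (@continuous_subspaceT _ _ _ _ cf).
  rewrite in_itv /= subr0 => /andP[c0 ca] ->; exists c => //.
  by rewrite !ger0_norm.
have [c] := MVT_segment (ltW a0) (fun x _ => hd x) (@continuous_subspaceT _ _ _ _ cf).
rewrite in_itv /= sub0r => /andP[c0 ca] e; exists c => //.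
  by rewrite ler0_norm // ltr0_norm // lerN2.
by rewrite -opprB e mulrN opprK.
Qed.

Lemma normr_sin_le a : `|sin a| <= `|a|.
Proof.
have [c _] := mean_value_from0 a (fun x => is_derive_sin x).
rewrite sin0 subr0 => ->; rewrite normrM ler_piMl //; exact: cos_max.
Qed.

Lemma onem_cos_le a : 1 - cos a <= a ^+ 2 / 2.
Proof.
have -> : a = a / 2 + a / 2 by lra.
rewrite cosD -!expr2.
have := normr_sin_le (a / 2); rewrite -(@ler_pXn2r _ 2) ?nnegrE //.
rewrite !real_normK ?num_real //.
have := cos2Dsin2 (a / 2); set x := cos _; set y := sin _; nra.
Qed.

Lemma normc_cisB1 a : normc (cis a - 1) <= `|a|.
Proof.
rewrite -(@ler_pXn2r _ 2) ?nnegrE ?normc_ge0 // sqr_normc_cisB1.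
by rewrite real_normK ?num_real //; have := onem_cos_le a; lra.
Qed.

Lemma normc_cisB a b : normc (cis a - cis b) <= `|a - b|.
Proof.
have -> : cis a - cis b = cis b * (cis (a - b) - 1).
  by rewrite mulrBr -cisD subrKC mulr1.
by rewrite normcM normc_cis mul1r normc_cisB1.
Qed.

Lemma normr_sinB_le a : `|sin a - a| <= `|a| ^+ 3 / 2.
Proof.
have [c hc] := @mean_value_from0 (sin - id) (fun x => cos x - 1) a (fun x => is_deriveB _ _).
rewrite /= !fctE sin0 !subr0 => ->.
have e1 : `|cos c - 1| = 1 - cos c by rewrite distrC ger0_norm ?subr_ge0 ?cos_le1.
rewrite normrM e1.
have := onem_cos_le c.
have : c ^+ 2 <= `|a| ^+ 2.
  by rewrite -(real_normK (num_real c)) ler_pXn2r ?nnegrE.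
have := normr_ge0 a.
set x := `|a|; set y := cos c; set z := c ^+ 2 => h0 h1 h2.
have -> : x ^+ 3 / 2 = (x ^+ 2 / 2) * x by rewrite exprS; ring.
by rewrite ler_wpM2r //; lra.
Qed.

(** Near 1 the imaginary part of a point z of the disc is of order
  sqrt (1 - Re z).  Replacing z by the unimodular number of argument Im z thus
  costs only a multiple of 1 - Re z, the quantity which pretentiousness makes
  summable; replacing z by 1 would cost its square root. *)
Lemma disc_cis_Im z : normc z <= 1 ->
  normc (z - cis (complex.Im z)) <= 3 * (1 - complex.Re z).
Proof.
move=> z1.
have hz : complex.Re z ^+ 2 + complex.Im z ^+ 2 <= 1.
  by rewrite -sqr_normcE expr_le1 ?normc_ge0.
apply: le_trans (normc_le_ReIm _) _; rewrite !raddfB /=.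
move: hz; set x := complex.Re z; set y := complex.Im z => hz.
have hy2 : y ^+ 2 <= 2 * (1 - x) by have := sqr_ge0 (1 - x); nra.
have hc := onem_cos_le y; have hc1 := cos_le1 y.
have hs := normr_sinB_le y.
have h1 : `|x - cos y| <= 1 - x + (1 - cos y).
  have x1 : x <= 1 by nra.
  by rewrite ler_norml; apply/andP; split; lra.
have h2 : `|y - sin y| <= y ^+ 2 / 2.
  rewrite distrC; apply: le_trans hs _.
  have y1 : `|y| <= 1 by rewrite -(@expr_le1 _ 2) // real_normK ?num_real //; have := sqr_ge0 x; nra.
  by rewrite exprS -[in leRHS](real_normK (num_real y)); have := sqr_ge0 `|y|; have := normr_ge0 y; nra.
by lra.
Qed.

Lemma sqr_Im_le z : normc z <= 1 -> complex.Im z ^+ 2 <= 2 * (1 - complex.Re z).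
Proof.
move=> z1.
have hz : complex.Re z ^+ 2 + complex.Im z ^+ 2 <= 1.
  by rewrite -sqr_normcE expr_le1 ?normc_ge0.
by move: hz; set x := complex.Re z; set y := complex.Im z => hz; have := sqr_ge0 (1 - x); nra.
Qed.

End complex_tools.

(** * Weighted averages *)

Section averages.
Context {R : realType}.
Local Open Scope complex_scope.
Implicit Types (c : averaging) (u v : nat -> R).
Local Notation wt c n := ((weight R c n)%:num).

Lemma weight_nonincreasing c n : (0 < n)%N -> wt c n.+1 <= wt c n.
Proof. by case: c => //= n0; rewrite lef_pV2 ?posrE ?ltr0n // ler_nat. Qed.

Lemma weight1 c : wt c 1 = 1.
Proof. by case: c => //=; rewrite invr1. Qed.

Lemma weight_le1 c n : (0 < n)%N -> wt c n <= 1.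
Proof. by case: c => //= n0; rewrite invf_le1 ?ltr0n // ler1n. Qed.

Lemma total_weightS c N : total_weight R c N.+1 = total_weight R c N + wt c N.+1.
Proof. by rewrite /total_weight big_nat_recr. Qed.

Lemma total_weight_Cesaro N : total_weight R Cesaro N = N%:R.
Proof. by rewrite /total_weight big_const_nat subn1 /= iter_addr_0 -mulr_natr mul1r. Qed.

Lemma total_weight_ge0 c N : 0 <= total_weight R c N.
Proof. by rewrite sumr_ge0. Qed.

Lemma total_weight_ge1 c N : (0 < N)%N -> 1 <= total_weight R c N.
Proof.
case: N => // N _; elim: N => [|N IH]; first by rewrite /total_weight big_nat1 weight1.
by rewrite total_weightS (le_trans IH) // lerDl.
Qed.

Lemma total_weight_dvg c (M : R) : \forall N \near \oo, M <= total_weight R c N.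
Proof.
have : total_weight R c @ \oo --> +oo.
  case: c.
    have -> : total_weight R Cesaro = (fun n => n%:R).
      by apply/funext => N; rewrite total_weight_Cesaro.
    exact: cvgr_idn.
  have -> : total_weight R Logarithmic = series harmonic.
    apply/funext => N; rewrite /total_weight /series /=.
    by rewrite big_add1.
  have h := @dvg_harmonic R.
  have nd : nondecreasing_seq (series (@harmonic R)).
    by apply: nondecreasing_series => n _ _; exact: harmonic_ge0.
  exact: nondecreasing_dvgn_lt nd h.
by move=> /cvgryPge /(_ M).
Qed.

(** Because the weights decrease, the weighted sum dominates the last weight
  times the unweighted sum.  This is how Cesaro estimates pass to logarithmic
  averages. *)
Lemma abel_summation_ge0 c u N :
  (forall n, (n <= N)%N -> 0 <= \sum_(1 <= m < n.+1) u m) ->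
  0 <= \sum_(1 <= m < N.+1) wt c m * u m.
Proof.
move=> h.
suff : wt c N * (\sum_(1 <= m < N.+1) u m) <= \sum_(1 <= m < N.+1) wt c m * u m.
  by apply: le_trans; rewrite mulr_ge0 // h.
elim: N h => [|N IH] h; first by rewrite !big_geq // mulr0.
rewrite [in leRHS]big_nat_recr //= [in leLHS]big_nat_recr //= mulrDr lerD2r.
case: N IH h => [|N] IH h; first by rewrite !big_geq // mulr0.
apply: le_trans (IH _); last by move=> n nN; apply: h; apply: leqW.
by rewrite ler_wpM2r ?h // weight_nonincreasing.
Qed.

(** The Cesaro bound holds only for large N.  Adding to the constant e a mass C
  at n = 1, of fixed size, makes the partial sums comparable for every N, so
  that Abel summation applies; the total weight being unbounded, C is absorbed
  in the gap between e and e'. *)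
Lemma weighted_sum_le c v (e e' : R) : e < e' ->
  (\forall N \near \oo, \sum_(1 <= n < N.+1) v n <= e * N%:R) ->
  \forall N \near \oo, \sum_(1 <= n < N.+1) wt c n * v n <= e' * total_weight R c N.
Proof.
move=> ee' [N0 _ hN0].
pose C := \sum_(1 <= n < N0.+1) (`|v n| + `|e|).
pose t n : R := e + C *+ (n == 1%N).
have C0 : 0 <= C by rewrite sumr_ge0 // => i _; rewrite addr_ge0.
have st n : (0 < n)%N -> \sum_(1 <= m < n.+1) t m = e * n%:R + C.
  case: n => // n _; rewrite big_split /= sumr_const_nat subn1 /= mulr_natr.
  congr (_ + _); rewrite big_ltn //= big_nat_cond big1 ?addr0 ?mulr1n //.
  by move=> i /andP[/andP[i1 _] _]; rewrite gtn_eqF.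
have wtt N : \sum_(1 <= n < N.+2) wt c n * t n = e * total_weight R c N.+1 + C.
  under eq_bigr do rewrite mulrDr.
  rewrite big_split /= /total_weight mulr_sumr; congr (_ + _).
    by apply: eq_bigr => i _; rewrite mulrC.
  rewrite big_ltn //= weight1 mul1r mulr1n big_nat_cond big1 ?addr0 //.
  by move=> i /andP[/andP[i1 _] _]; rewrite gtn_eqF //= mulr0.
have hh N : \sum_(1 <= n < N.+2) wt c n * v n <= e * total_weight R c N.+1 + C.
  rewrite -wtt -subr_ge0 -sumrB.
  under eq_bigr do rewrite -mulrBr.
  apply: abel_summation_ge0 => -[_|n _]; first by rewrite big_geq.
  rewrite sumrB subr_ge0 st //.
  have [nN0|nN0] := leqP N0 n.+1.
    by apply: (le_trans (hN0 n.+1 nN0)); rewrite lerDl.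
  have h1 : \sum_(1 <= m < n.+2) v m - e * n.+1%:R <= C.
    rewrite /C [leRHS](big_cat_nat (n := n.+2)) //=; last by lia.
    apply: (@le_trans _ _ (\sum_(1 <= m < n.+2) (`|v m| + `|e|))); last first.
      by rewrite lerDl sumr_ge0 // => i _; rewrite addr_ge0.
    rewrite big_split /= lerD ?ler_sum //; first by move=> *; rewrite ler_norm.
    rewrite sumr_const_nat subn1 -mulNr mulr_natr ler_wMn2r //.
    by rewrite -normrN ler_norm.
  by lra.
near=> N.
have : (0 < N)%N by near: N; exact: nbhs_infty_gt.
have hC : C / (e' - e) <= total_weight R c N by near: N; exact: total_weight_dvg.
move=> N0'; move: hC; rewrite ler_pdivrMr ?subr_gt0 // => hC.
rewrite -(prednK N0'); apply: le_trans (hh _) _; rewrite (prednK N0'); lra.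
Unshelve. all: by end_near.
Qed.

Lemma near_subseq (N_ : nat -> nat) (P : nat -> Prop) :
  {homo N_ : j k / (j < k)%N} ->
  (\forall N \near \oo, P N) -> \forall k \near \oo, P (N_ k).
Proof.
move=> hN [N0 _ h]; exists N0 => // k /= kN0; apply: h => /=.
apply: (leq_trans kN0); elim: k {kN0} => // k IH.
exact: (leq_ltn_trans IH (hN _ _ (ltnSn k))).
Qed.

Lemma Cesaro_small (v : nat -> R) (e e' : R) : 0 <= e -> e < e' ->
  (\forall n \near \oo, v n <= e) ->
  \forall N \near \oo, \sum_(1 <= n < N.+1) v n <= e' * N%:R.
Proof.
move=> e0 ee' [N0 _ hN0].
pose C := \sum_(1 <= n < N0.+1) `|v n|.
near=> N.
have NN0 : (N0 <= N)%N by near: N; exact: nbhs_infty_ge.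
rewrite (big_cat_nat (n := N0.+1)) //=.
have h1 : \sum_(1 <= n < N0.+1) v n <= C by rewrite ler_sum // => i _; exact: ler_norm.
have h2 : \sum_(N0.+1 <= n < N.+1) v n <= e * N%:R.
  apply: (@le_trans _ _ (\sum_(N0.+1 <= n < N.+1) e)).
    by rewrite ler_sum_nat // => i /andP[/ltnW iN _]; exact: hN0.
  by rewrite sumr_const_nat mulr_natr ler_wpMn2l // subSS leq_subr.
have : C / (e' - e) <= N%:R by near: N; exact: nbhs_infty_ger.
by rewrite ler_pdivrMr ?subr_gt0 //; lra.
Unshelve. all: by end_near.
Qed.

Definition wsum c (v : nat -> R[i]) N : R[i] :=
  \sum_(1 <= n < N.+1) (wt c n)%:C * v n.

(** Stated for sums rather than quotients, which avoids dividing by the total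
  weight. *)
Definition wnull c (N_ : nat -> nat) (v : nat -> R[i]) :=
  forall e : R, 0 < e ->
    \forall k \near \oo, normc (wsum c v (N_ k)) <= e * total_weight R c (N_ k).

Lemma wsumD c (v w : nat -> R[i]) N : wsum c (fun n => v n + w n) N = wsum c v N + wsum c w N.
Proof. by rewrite /wsum -big_split /=; apply: eq_bigr => i _; rewrite mulrDr. Qed.

Lemma wsumZ c (a : R[i]) (v : nat -> R[i]) N : wsum c (fun n => a * v n) N = a * wsum c v N.
Proof. by rewrite /wsum mulr_sumr; apply: eq_bigr => i _; rewrite mulrCA. Qed.

Lemma normc_wsum_le c (v : nat -> R[i]) N :
  normc (wsum c v N) <= \sum_(1 <= n < N.+1) wt c n * normc (v n).
Proof.
apply: (le_trans (normc_sum _ _ _)); apply: ler_sum => i _.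
by rewrite normcM normc_real ger0_norm.
Qed.

Lemma wnullD c N_ (v w : nat -> R[i]) : wnull c N_ v -> wnull c N_ w -> wnull c N_ (fun n => v n + w n).
Proof.
move=> hv hw e e0; near=> k; rewrite wsumD; apply: (le_trans (le_normcD _ _)).
have h1 : normc (wsum c v (N_ k)) <= e / 2 * total_weight R c (N_ k).
  by near: k; apply: hv; rewrite divr_gt0.
have h2 : normc (wsum c w (N_ k)) <= e / 2 * total_weight R c (N_ k).
  by near: k; apply: hw; rewrite divr_gt0.
by lra.
Unshelve. all: by end_near.
Qed.

Lemma wnullZ c N_ (a : R[i]) (v : nat -> R[i]) : wnull c N_ v -> wnull c N_ (fun n => a * v n).
Proof.
move=> hv e e0; near=> k; rewrite wsumZ normcM.
have h1 : normc (wsum c v (N_ k)) <= e / (normc a + 1) * total_weight R c (N_ k).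
  by near: k; apply: hv; rewrite divr_gt0 // ltr_wpDl ?normc_ge0.
have a1 : 0 < normc a + 1 by rewrite ltr_wpDl ?normc_ge0.
have W0 := total_weight_ge0 c (N_ k).
apply: (@le_trans _ _ ((normc a + 1) * (e / (normc a + 1) * total_weight R c (N_ k)))).
  apply: ler_pM => //; rewrite ?normc_ge0 //; lra.
by rewrite mulrA mulrCA divff ?gt_eqF // mulr1.
Unshelve. all: by end_near.
Qed.

Lemma eq_wnull c N_ (v w : nat -> R[i]) : (forall n, (0 < n)%N -> v n = w n) -> wnull c N_ v -> wnull c N_ w.
Proof.
move=> vw hv e e0; apply: filterS (hv e e0) => k; congr (normc _ <= _).
by apply: eq_big_nat => i /andP[i0 _]; rewrite vw.
Qed.

Lemma wnullB c N_ (v w : nat -> R[i]) : wnull c N_ v -> wnull c N_ w -> wnull c N_ (fun n => v n - w n).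
Proof.
move=> hv hw; apply: (@eq_wnull _ _ (fun n => v n + (-1) * w n)).
  by move=> n _; rewrite mulN1r.
by apply: wnullD => //; exact: wnullZ.
Qed.

Lemma wnull0 c N_ : wnull c N_ (fun=> 0).
Proof.
move=> e e0; apply: nearW => k; rewrite /wsum big1 => [|i _]; last by rewrite mulr0.
by rewrite normc0 mulr_ge0 ?total_weight_ge0 ?ltW.
Qed.

Lemma wnull_sum c N_ (I : Type) (r : seq I) (v : I -> nat -> R[i]) :
  (forall i, wnull c N_ (v i)) -> wnull c N_ (fun n => \sum_(i <- r) v i n).
Proof.
move=> h; elim: r => [|i r IH].
  by apply: (eq_wnull _ (wnull0 c N_)) => n _; rewrite big_nil.
by apply: (eq_wnull _ (wnullD (h i) IH)) => n _; rewrite big_cons.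
Qed.

Lemma wnull_Cesaro c N_ (v : nat -> R[i]) : {homo N_ : j k / (j < k)%N} ->
  (forall e : R, 0 < e ->
    \forall N \near \oo, \sum_(1 <= n < N.+1) normc (v n) <= e * N%:R) ->
  wnull c N_ v.
Proof.
move=> hN h e e0.
have e2 : e / 2 < e by rewrite ltr_pdivrMr // ltr_pMr // ltr1n.
have := weighted_sum_le c e2 (h _ (divr_gt0 e0 (ltr0n _ 2))).
move=> /(near_subseq hN); apply: filterS => k; apply: le_trans.
exact: normc_wsum_le.
Qed.

Lemma wnull_cvg0 c N_ (v : nat -> R[i]) : {homo N_ : j k / (j < k)%N} ->
  (forall e : R, 0 < e -> \forall n \near \oo, normc (v n) <= e) ->
  wnull c N_ v.
Proof.
move=> hN h; apply: wnull_Cesaro => // e e0.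
by apply: (@Cesaro_small _ (e / 2)); [lra|lra|apply: h; lra].
Qed.

(** The weighted sum of v n.+1 - v n telescopes up to the total variation of
  the weights, which is at most 1 because they are monotone, whereas the total
  weight is unbounded. *)
Lemma wnull_shift c N_ (v : nat -> R[i]) : {homo N_ : j k / (j < k)%N} ->
  (forall n, normc (v n) <= 1) -> wnull c N_ (fun n => v n.+1 - v n).
Proof.
move=> hN hv e e0.
have key N : wsum c (fun n => v n.+1 - v n) N.+1 =
   (wt c N.+1)%:C * v N.+2 - v 1%N + \sum_(1 <= n < N.+1) (wt c n - wt c n.+1)%:C * v n.+1.
  elim: N => [|N IH].
    by rewrite /wsum big_nat1 weight1 big_geq // addr0 !mul1r.
  rewrite /wsum big_nat_recr //= -/(wsum _ _ _) IH [in RHS]big_nat_recr //= rmorphB /=.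
  ring.
have bnd N : normc (wsum c (fun n => v n.+1 - v n) N.+1) <= 3.
  rewrite key; apply: (le_trans (le_normcD _ _)).
  have h1 : normc ((wt c N.+1)%:C * v N.+2 - v 1%N) <= 2.
    apply: (le_trans (le_normcB _ _)); rewrite -[2]/(1 + 1) lerD //.
    by rewrite normcM normc_real ger0_norm // mulr_ile1 ?normc_ge0 // weight_le1.
  suff h2 : normc (\sum_(1 <= n < N.+1) (wt c n - wt c n.+1)%:C * v n.+1) <= 1 by lra.
  apply: (le_trans (normc_sum _ _ _)).
  apply: (@le_trans _ _ (\sum_(1 <= n < N.+1) (wt c n - wt c n.+1))).
    rewrite !big_nat ler_sum // => i /andP[i0 _].
    have wi : 0 <= wt c i - wt c i.+1 by rewrite subr_ge0 weight_nonincreasing.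
    by rewrite normcM normc_real ger0_norm // ler_piMr.
  under eq_bigr do rewrite -opprB.
  by rewrite sumrN telescope_sumr // opprB weight1 lerBlDr lerDl.
near=> k.
have N0 : (0 < N_ k)%N.
  by near: k; apply: (near_subseq (P := fun N => 0 < N)%N hN); exact: nbhs_infty_gt.
rewrite -(prednK N0); apply: (le_trans (bnd _)).
have : 3 / e <= total_weight R c (N_ k).
  by near: k; apply: (near_subseq (P := fun N => _ <= total_weight R c N) hN);
    exact: total_weight_dvg.
by rewrite (prednK N0) ler_pdivrMr // mulrC.
Unshelve. all: by end_near.
Qed.

End averages.

(** * Counting in residue classes and the Turan-Kubilius inequality *)

Section counting.

Lemma count_modn (D r N : nat) : (0 < D)%N ->
  exists c, (\sum_(1 <= n < N.+1) (n == r %[mod D]) = (N + c) %/ D - c %/ D)%N.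
Proof.
move=> D0; exists (D - r %% D)%N; set c := (D - r %% D)%N.
have hc n : (n == r %[mod D]) = (D %| n + c)%N.
  have rc : (r %% D + c = D)%N by rewrite /c subnKC // ltnW // ltn_pmod.
  by rewrite -(eqn_modDr c) -(modnDml r) rc modnn.
elim: N => [|N IH]; first by rewrite big_geq // add0n subnn.
rewrite big_nat_recr //= IH hc addSn divnS //.
by rewrite -addnBA ?leq_div2r ?leq_addl // addnC.
Qed.

(** A bound m ^ k <= N is a bound on m; y is the integer part of the k-th root
  of N. *)
Lemma root_floor (k N : nat) : (0 < k)%N ->
  exists2 y, (y ^ k <= N)%N & forall m, (m ^ k <= N)%N = (m <= y)%N.
Proof.
move=> k0.
have ex : exists m, (m ^ k <= N)%N by exists 0%N; rewrite exp0n.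
have ub m : (m ^ k <= N)%N -> (m <= N)%N.
  apply: leq_trans; case: m => // m; rewrite -{1}(expn1 m.+1) leq_pexp2l //.
case: (ex_maxnP ex ub) => y hy hmax; exists y => // m.
apply/idP/idP => [/hmax //|my]; apply: leq_trans hy.
by rewrite leq_exp2r.
Qed.

Context {R : realType}.

Lemma count_modn_real (D r N : nat) : (0 < D)%N ->
  `|\sum_(1 <= n < N.+1) (n == r %[mod D])%:R - N%:R / D%:R| <= 1 :> R.
Proof.
move=> D0; rewrite -natr_sum; have [c ->] := count_modn r N D0.
have D0' : 0 < D%:R :> R by rewrite ltr0n.
rewrite natrB; last exact: leq_div2r (leq_addl _ _).
have h m : (m%:R / D%:R - 1 <= (m %/ D)%:R :> R) && ((m %/ D)%:R <= m%:R / D%:R :> R).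
  rewrite lerBlDr !ler_pdivrMr // ler_pdivlMr // mulrDl mul1r -!natrM -natrD !ler_nat.
  by rewrite leq_divM andbT {1}(divn_eq m D) leq_add2l ltnW // ltn_pmod.
have := h (N + c)%N; have := h c; rewrite natrD mulrDl.
move=> /andP[h1 h2] /andP[h3 h4]; rewrite ler_norml; apply/andP; split; lra.
Qed.

End counting.

Section residue_class.
Context {R : realType}.
Variables (Q : nat) (Q0 : (0 < Q)%N).

Lemma count_class_dvd (d N : nat) : (0 < d)%N -> coprime Q d ->
  `|\sum_(1 <= n < N.+1 | n == 1 %[mod Q]) (d %| n)%:R - N%:R / Q%:R / d%:R| <= 1 :> R.
Proof.
move=> d0 co.
have -> : \sum_(1 <= n < N.+1 | n == 1 %[mod Q]) (d %| n)%:R =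
    \sum_(1 <= n < N.+1) (n == chinese Q d 1 0 %[mod Q * d])%:R :> R.
  rewrite big_mkcond; apply: eq_bigr => n _.
  rewrite chinese_remainder // chinese_modl // chinese_modr //.
  by case: ifP => // _; rewrite mod0n.
by rewrite -mulrA -invfM -natrM; apply: count_modn_real; rewrite muln_gt0 Q0.
Qed.

Lemma count_class (N : nat) :
  `|\sum_(1 <= n < N.+1 | n == 1 %[mod Q]) 1 - N%:R / Q%:R| <= 1 :> R.
Proof.
have := @count_class_dvd 1 N isT (coprimen1 _); rewrite divr1.
by under eq_bigr do rewrite dvd1n.
Qed.

Lemma count_class_dvd_le (d N : nat) : (0 < d)%N -> coprime Q d ->
  \sum_(1 <= n < N.+1 | n == 1 %[mod Q]) (d %| n)%:R <= N%:R / Q%:R / d%:R + 1 :> R.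
Proof. by move=> d0 /(@count_class_dvd d N d0); rewrite ler_distl => /andP[_]. Qed.

Lemma count_class_le (N : nat) :
  \sum_(1 <= n < N.+1 | n == 1 %[mod Q]) 1 <= N%:R / Q%:R + 1 :> R.
Proof. by have := @count_class N; rewrite ler_distl => /andP[_]. Qed.

(** Expand the square and sum over n first.  In the class of 1 modulo Q the
  divisibilities by two distinct primes are independent up to O(1), so the
  off-diagonal terms contribute at most 4 each, and the diagonal terms give
  the variance. *)
Lemma turan_kubilius (P : seq nat) (a : nat -> R) (N : nat) : uniq P ->
  (forall p, p \in P -> prime p && coprime Q p) -> (forall p, `|a p| <= 1) ->
  \sum_(1 <= n < N.+1 | n == 1 %[mod Q])
     (\sum_(p <- P) a p * ((p %| n)%:R - p%:R^-1)) ^+ 2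
  <= N%:R / Q%:R * (\sum_(p <- P) a p ^+ 2 / p%:R) + 4 * (size P)%:R ^+ 2.
Proof.
move=> uP hP ha.
pose X : R := N%:R / Q%:R.
pose M p p' := \sum_(1 <= n < N.+1 | n == 1 %[mod Q]) ((p %| n)%:R - p%:R^-1) * ((p' %| n)%:R - p'%:R^-1) : R.
have X0 : 0 <= X by rewrite divr_ge0.
have -> : \sum_(1 <= n < N.+1 | n == 1 %[mod Q]) (\sum_(p <- P) a p * ((p %| n)%:R - p%:R^-1)) ^+ 2
   = \sum_(p <- P) \sum_(p' <- P) a p * a p' * M p p'.
  under eq_bigr do rewrite expr2 mulr_suml.
  rewrite exchange_big /=; apply: eq_bigr => p _.
  under eq_bigr do rewrite mulr_sumr.
  rewrite exchange_big /=; apply: eq_bigr => p' _.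
  by rewrite /M mulr_sumr; apply: eq_bigr => n _; ring.
have ME p p' : M p p' = \sum_(1 <= n < N.+1 | n == 1 %[mod Q]) ((p %| n)%N && (p' %| n)%N)%:R
   - p'%:R^-1 * \sum_(1 <= n < N.+1 | n == 1 %[mod Q]) (p %| n)%:R
   - p%:R^-1 * \sum_(1 <= n < N.+1 | n == 1 %[mod Q]) (p' %| n)%:R
   + p%:R^-1 * p'%:R^-1 * \sum_(1 <= n < N.+1 | n == 1 %[mod Q]) 1.
  rewrite !mulr_sumr -!sumrB -big_split /=; apply: eq_bigr => n _.
  by rewrite -mulnb natrM; ring.
have inv1 p : p \in P -> 0 < (p%:R^-1 : R) <= 2^-1.
  move=> /hP /andP[/prime_gt1 p1 _]; rewrite invr_gt0 ltr0n (ltnW p1) /=.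
  by rewrite lef_pV2 ?posrE ?ltr0n ?(ltnW p1) // ler_nat.
have diag p : p \in P -> a p * a p * M p p <= X * (a p ^+ 2 / p%:R) + 4.
  move=> pP; have /andP[pp cp] := hP p pP.
  have hM : M p p <= X / p%:R + 1.
    rewrite ME; under eq_bigr do rewrite andbb.
    have := count_class_dvd_le N (prime_gt0 pp) cp; rewrite -/X.
    have := count_class_le N; rewrite -/X.
    have /andP[] := inv1 p pP.
    set u := p%:R^-1; set s := \sum_(_ <= _ < _ | _) _; set s1 := \sum_(_ <= _ < _ | _) _.
    move=> u0 u1 h1 h2; nra.
  have a2 : 0 <= a p * a p <= 1.
    by rewrite -expr2 sqr_ge0 -(real_normK (num_real (a p))) expr_le1 ?ha.
  have := divr_ge0 X0 (ler0n R p); rewrite expr2; move: hM; set t := X / p%:R.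
  have -> : X * (a p * a p / p%:R) = a p * a p * t by rewrite /t; ring.
  move: a2 => /andP[]; set w := a p * a p; set m := M p p => w0 w1 hM t0.
  have : w * m <= w * (t + 1) by rewrite ler_wpM2l.
  by rewrite mulrDr; lra.
have off p p' : p \in P -> p' \in P -> p != p' -> a p * a p' * M p p' <= 4.
  move=> pP p'P pp'; have /andP[prp cp] := hP p pP; have /andP[prp' cp'] := hP p' p'P.
  have cpp : coprime p p' by rewrite prime_coprime // dvdn_prime2.
  have hM : `|M p p'| <= 4.
    rewrite ME; under eq_bigr do rewrite -Gauss_dvd //.
    have := @count_class_dvd (p * p') N; rewrite muln_gt0 !prime_gt0 // coprimeMr cp cp' => /(_ isT isT).
    have := count_class_dvd N (prime_gt0 prp) cp; have := count_class_dvd N (prime_gt0 prp') cp'.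
    have := count_class N; rewrite -/X natrM invfM.
    have /andP[] := inv1 p pP; have /andP[] := inv1 p' p'P.
    set u := p%:R^-1; set v := p'%:R^-1.
    set s := \sum_(_ <= _ < _ | _) _; set s1 := \sum_(_ <= _ < _ | _) _.
    set s2 := \sum_(_ <= _ < _ | _) _; set s3 := \sum_(_ <= _ < _ | _) _.
    move=> v0 v1 u0 u1 h0 h1 h2 h3.
    have -> : s2 - v * s1 - u * s + u * v * s3 = (s2 - X * (u * v)) -
      v * (s1 - X * u) - u * (s - X * v) + u * v * (s3 - X) by ring.
    have nu : `|u| <= 1 by rewrite ger0_norm ?ltW //; lra.
    have nv : `|v| <= 1 by rewrite ger0_norm ?ltW //; lra.
    have : `|v * (s1 - X * u)| <= 1 by rewrite normrM mulr_ile1.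
    have : `|u * (s - X * v)| <= 1 by rewrite normrM mulr_ile1.
    have : `|u * v * (s3 - X)| <= 1 by rewrite !normrM !mulr_ile1 // mulr_ge0.
    move: h3; rewrite !ler_norml => /andP[? ?] /andP[? ?] /andP[? ?] /andP[? ?].
    by apply/andP; split; lra.
  apply: (le_trans (ler_norm _)); rewrite !normrM.
  rewrite -[leRHS]mul1r ler_pM ?mulr_ge0 //.
  by rewrite mulr_ile1.
apply: (@le_trans _ _ (\sum_(p <- P) (X * (a p ^+ 2 / p%:R) + 4 * (size P)%:R))).
  rewrite big_seq [leRHS]big_seq ler_sum // => p pP.
  apply: (@le_trans _ _ (\sum_(p' <- P) ((if p' == p then X * (a p ^+ 2 / p%:R) else 0) + 4))).
    rewrite big_seq [leRHS]big_seq ler_sum // => p' p'P.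
    by case: eqVneq => [->|pp']; [exact: diag|rewrite add0r off // eq_sym].
  rewrite big_split /= -big_mkcond /= -big_filter filter_pred1_uniq // big_seq1 lerD2l.
  by rewrite big_const_seq count_predT iter_addr_0 mulr_natr.
rewrite big_split /= -mulr_sumr lerD2l.
by rewrite big_const_seq count_predT iter_addr_0 expr2 mulrA [leRHS]mulr_natr.
Qed.

End residue_class.

Section prime_sums.

Lemma prod_primes_logn n : (0 < n)%N -> n = (\prod_(p <- primes n) p ^ logn p n)%N.
Proof. by move=> n0; rewrite {1}(prod_prime_decomp n0) prime_decompE big_map. Qed.

(** The product of these primes divides n, hence is at most N, while its fourth
  power exceeds N to the number of the primes. *)
Lemma count_large_primes n N : (0 < n)%N -> (n <= N)%N ->
  (\sum_(p <- primes n) (N < p ^ 4) <= 4)%N.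
Proof.
move=> n0 nN.
have -> : (\sum_(p <- primes n) (N < p ^ 4) = count (fun p => N < p ^ 4) (primes n))%N.
  by rewrite -sum1_count [RHS]big_mkcond; apply: eq_bigr => p _; case: ifP.
set P := fun p : nat => (N < p ^ 4)%N.
have h1 : (\prod_(p <- primes n | P p) p <= n)%N.
  rewrite {2}(prod_primes_logn n0) [X in (X <= _)%N]big_mkcond big_seq [X in (_ <= X)%N]big_seq.
  apply: leq_prod => p pn; have p0 : (0 < p)%N by move: pn; rewrite mem_primes => /andP[/prime_gt0].
  case: ifP => _; last by rewrite expn_gt0 p0.
  by rewrite -{1}(expn1 p) leq_pexp2l // logn_gt0.
have h2 : ((N.+1) ^ count P (primes n) <= (\prod_(p <- primes n | P p) p) ^ 4)%N.
  rewrite (big_morph (fun x => x ^ 4)%N (id1 := 1%N) (op1 := muln)) //; last first.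
    by move=> x y; rewrite expnMn.
  by rewrite -iter_muln_1 -big_const_seq; apply: leq_prod.
rewrite leqNgt; apply/negP => c5.
have : (N.+1 ^ 4 <= N ^ 4)%N.
  apply: leq_trans (leq_trans h2 _); last by rewrite leq_exp2r // (leq_trans h1).
  by rewrite leq_pexp2l // ltnW.
by rewrite leq_exp2r // ltnn.
Qed.

Context {R : realType}.
Variables (Q K : nat) (Q0 : (0 < Q)%N).
Hypothesis hQ : forall p, prime p -> (p %| Q)%N = (p <= K)%N.

Lemma coprime_class_prime p : prime p -> (K < p)%N -> coprime Q p.
Proof. by move=> pp Kp; rewrite coprime_sym prime_coprime // hQ // -ltnNge. Qed.

(** If Q is divisible by all the primes up to K, an integer congruent to 1
  modulo Q has only prime factors beyond K: this is what makes the tails of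
  the pretentious distance usable. *)
Lemma prime_class_gt n p : n = 1 %[mod Q] -> p \in primes n -> (K < p)%N.
Proof.
move=> n1; rewrite mem_primes => /and3P[pp n0 pn].
rewrite ltnNge -hQ //; apply/negP => pQ.
have : (p %| 1)%N.
  by rewrite /dvdn -(modn_dvdm 1 pQ) -n1 modn_dvdm.
by rewrite dvdn1 => /eqP p1; rewrite p1 in pp.
Qed.

Lemma sum_primes_class (F : nat -> R) n N : (0 < n <= N)%N -> n = 1 %[mod Q] ->
  \sum_(p <- primes n) F p = \sum_(K.+1 <= p < N.+1 | prime p) (p %| n)%N%:R * F p.
Proof.
move=> /andP[n0 nN] n1.
transitivity (\sum_(K.+1 <= p < N.+1 | prime p && (p %| n)%N) F p); last first.
  rewrite big_mkcondr; apply: eq_bigr => p _.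
  by case: ifP => _; rewrite ?mul1r ?mul0r.
rewrite -[RHS]big_filter; apply: perm_big; apply: uniq_perm.
- exact: primes_uniq.
- by rewrite filter_uniq // iota_uniq.
move=> p; rewrite mem_filter mem_index_iota mem_primes.
apply/idP/idP => [/and3P[pp _ pn]|/andP[/andP[-> ->]]]; last by rewrite n0.
rewrite pp pn /= (@prime_class_gt n) ?mem_primes ?pp ?n0 //=.
by rewrite ltnS (leq_trans _ nN) // dvdn_leq.
Qed.

Lemma sum_class_primes (F : nat -> nat -> R) N :
  \sum_(1 <= n < N.+1 | n == 1 %[mod Q]) \sum_(p <- primes n) F n p =
  \sum_(K.+1 <= p < N.+1 | prime p)
     \sum_(1 <= n < N.+1 | n == 1 %[mod Q]) (p %| n)%N%:R * F n p.
Proof.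
rewrite exchange_big /= big_nat_cond [RHS]big_nat_cond; apply: eq_bigr => n.
move=> /andP[/andP[n0 nN] /eqP n1].
by apply: sum_primes_class => //; rewrite n0.
Qed.

(** An integer of the class is divisible by p with density 1 / p; the error
  O(1) for each prime yields the second sum. *)
Lemma sum_class_primes_le (F : nat -> R) N : (forall p, prime p -> 0 <= F p) ->
  \sum_(1 <= n < N.+1 | n == 1 %[mod Q]) \sum_(p <- primes n) F p <=
  N%:R / Q%:R * (\sum_(K.+1 <= p < N.+1 | prime p) F p / p%:R)
   + \sum_(K.+1 <= p < N.+1 | prime p) F p.
Proof.
move=> F0; rewrite sum_class_primes mulr_sumr -big_split /= big_nat_cond [leRHS]big_nat_cond.
apply: ler_sum => p /andP[/andP[Kp pN] pp].
rewrite -mulr_suml.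
have := @count_class_dvd_le R Q Q0 p N (prime_gt0 pp) (coprime_class_prime pp Kp).
move=> /(ler_wpM2r (F0 p pp)) h; apply: (le_trans h).
by rewrite mulrDl mul1r lerD2r mulrAC mulrA.
Qed.

(** Comparison with the telescoping sum of 1 / (p - 1) - 1 / p. *)
Lemma sum_inv_sqr_le N : (0 < K)%N ->
  \sum_(K.+1 <= p < N.+1 | prime p) (p%:R ^+ 2)^-1 <= K%:R^-1 :> R.
Proof.
move=> K0.
apply: (@le_trans _ _ (\sum_(K.+1 <= p < N.+1) (p%:R ^+ 2)^-1)).
  by rewrite big_mkcond ler_sum // => p _; case: ifP => // _; rewrite invr_ge0 exprn_ge0.
have [NK|NK] := leqP N K; first by rewrite big_geq ?invr_ge0.
suff : \sum_(K.+1 <= p < N.+1) (p%:R ^+ 2)^-1 <= K%:R^-1 - N%:R^-1 :> R.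
  by move=> /le_trans; apply; rewrite lerBlDr lerDl invr_ge0.
elim: N NK => // N IH; rewrite ltnS leq_eqVlt => /orP[/eqP <-|KN].
  rewrite big_nat1; have := ltr0n R K; rewrite K0 -[K.+1%:R]natr1; set k := K%:R => k0.
  rewrite -[leRHS](_ : (k * (k + 1))^-1 = _); last by field; rewrite !gt_eqF //; lra.
  by rewrite lef_pV2 ?posrE; nra.
rewrite big_nat_recr //=; last by lia.
apply: (le_trans (lerD (IH KN) (lexx _))).
have N0 : 0 < N%:R :> R by rewrite ltr0n (leq_trans _ KN).
rewrite -addrA lerD2l -[N.+1%:R]natr1; move: N0; set k := N%:R => k0.
rewrite -lerBrDl opprK addrC -[leRHS](_ : (k * (k + 1))^-1 = _); last by field; rewrite !gt_eqF //; lra.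
by rewrite lef_pV2 ?posrE; nra.
Qed.

Lemma sum_class_square_le N y : (0 < K)%N -> (forall m, (m ^ 2 <= N)%N = (m <= y)%N) ->
  \sum_(1 <= n < N.+1 | n == 1 %[mod Q]) \sum_(p <- primes n) (p ^ 2 %| n)%N%:R <=
  N%:R / Q%:R / K%:R + y%:R :> R.
Proof.
move=> K0 hy; rewrite sum_class_primes.
apply: (@le_trans _ _ (\sum_(K.+1 <= p < N.+1 | prime p)
    (N%:R / Q%:R * (p%:R ^+ 2)^-1 + (p <= y)%N%:R))).
  rewrite big_nat_cond [leRHS]big_nat_cond; apply: ler_sum => p /andP[/andP[Kp pN] pp].
  have p20 : (0 < p ^ 2)%N by rewrite expn_gt0 prime_gt0.
  case: (leqP p y) => [py|yp].
    have co : coprime Q (p ^ 2) by rewrite coprimeXr // coprime_class_prime.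
    have := @count_class_dvd_le R Q Q0 (p ^ 2) N p20 co.
    rewrite natrX; apply: le_trans; apply: ler_sum => n _.
    by rewrite ler_piMl // lern1 leq_b1.
  rewrite addr0 big_nat_cond big1 ?mulr_ge0 ?invr_ge0 ?exprn_ge0 //.
  move=> n /andP[/andP[n0 nN] _].
  rewrite (_ : (p ^ 2 %| n)%N = false) ?mulr0 //.
  apply/negP => /(dvdn_leq n0) pn; move: yp; rewrite ltnNge -hy.
  by rewrite (leq_trans pn).
rewrite big_split /= -mulr_sumr lerD //.
  by rewrite ler_wpM2l ?divr_ge0 // sum_inv_sqr_le.
have yN : (y <= N)%N.
  have : (y ^ 2 <= N)%N by rewrite hy.
  by apply: leq_trans; case: (y) => // z; rewrite -{1}(expn1 z.+1) leq_pexp2l.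
have -> : y%:R = \sum_(1 <= p < N.+1) (p <= y)%N%:R :> R.
  rewrite (big_cat_nat (n := y.+1)) //= [X in _ + X]big_nat_cond.
  rewrite [X in _ + X]big1 ?addr0 => [|p /andP[/andP[yp _] _]]; last by rewrite leqNgt yp.
  rewrite big_nat_cond (eq_bigr (fun=> 1)) => [|p /andP[/andP[_ py] _]]; last by rewrite -ltnS py.
  by rewrite -big_nat_cond sumr_const_nat subn1.
have [NK|KN] := ltnP N K; first by rewrite [leLHS]big_geq ?ltnS ?(ltnW NK) // sumr_ge0.
rewrite [leRHS](big_cat_nat (n := K.+1)) //=.
rewrite -[leLHS]add0r lerD ?sumr_ge0 // big_mkcond ler_sum // => p _.
by case: ifP.
Qed.

End prime_sums.

(** * Concentration of a function that pretends to be 1 *)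

Section concentration.
Context {R : realType}.
Variable g : nat -> R[i].
Hypothesis g1 : g 1 = 1.
Hypothesis gM : forall m n, (0 < m)%N -> (0 < n)%N -> coprime m n -> g (m * n)%N = g m * g n.
Hypothesis gle1 : forall n, normc (g n) <= 1.

(** g p is seen as cis (drift p) up to its defect.  The sum drift_sum n is then
  the additive function approximating the argument of g n, and drift_mean K N
  is its expected value on the integers up to N without prime factor up to K.
  Primes beyond the fourth root of N are left out of the mean: they are too
  many for the Turan-Kubilius inequality, but an integer has only a bounded
  number of them. *)
Definition drift (p : nat) : R := complex.Im (g p).
Definition defect (p : nat) : R := 1 - complex.Re (g p).
Definition drift_sum (n : nat) : R := \sum_(p <- primes n) drift p.
Definition drift_mean (K N : nat) : R :=
  \sum_(K.+1 <= p < N.+1 | prime p && (p ^ 4 <= N)%N) drift p / p%:R.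

Lemma multiplicative_prod (s : seq nat) (e : nat -> nat) : uniq s -> all prime s ->
  g (\prod_(p <- s) p ^ e p)%N = \prod_(p <- s) g (p ^ e p)%N.
Proof.
elim: s => [|p s IH] /=; first by rewrite !big_nil.
move=> /andP[ps us] /andP[pp sp]; rewrite !big_cons -IH //.
apply: gM; first by rewrite expn_gt0 prime_gt0.
  by rewrite big_seq prodn_cond_gt0 // => q /(allP sp) qp; rewrite expn_gt0 prime_gt0.
rewrite big_seq; elim/big_ind : _ => [|x y|q qs]; first by rewrite coprimen1.
  by rewrite coprimeMr => -> ->.
rewrite coprimeXl // coprimeXr // prime_coprime // dvdn_prime2 ?(allP sp q qs) //.
by apply: contraNneq ps => ->.
Qed.

Lemma multiplicative_primes n : (0 < n)%N -> g n = \prod_(p <- primes n) g (p ^ logn p n)%N.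
Proof.
move=> n0; rewrite {1}(prod_primes_logn n0) multiplicative_prod ?primes_uniq //.
exact: all_prime_primes.
Qed.

Lemma defect_ge0 p : 0 <= defect p.
Proof.
rewrite subr_ge0; apply: le_trans (gle1 p); apply: le_trans (normr_Re_le _).
exact: ler_norm.
Qed.

Lemma sqr_drift_le p : drift p ^+ 2 <= 2 * defect p.
Proof. exact: sqr_Im_le. Qed.

Lemma drift_le1 p : `|drift p| <= 1.
Proof. exact: le_trans (normr_Im_le _) _. Qed.

(** Compare the product of g (p ^ logn p n) with the product of cis (drift p)
  factor by factor: a prime dividing n once costs its defect, and the others
  are paid by the indicator of p ^ 2 dividing n. *)
Lemma multiplicative_near_cis n : (0 < n)%N ->
  normc (g n - cis (drift_sum n)) <=
  \sum_(p <- primes n) (3 * defect p + 2 * (p ^ 2 %| n)%N%:R).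
Proof.
move=> n0; rewrite multiplicative_primes // /drift_sum cis_sum.
apply: le_trans (prodB_le _ _ _) _ => [p _|p _|] //; first by rewrite normc_cis.
rewrite big_seq [leRHS]big_seq; apply: ler_sum => p pn.
have d0 := defect_ge0 p.
case: (leqP 2 (logn p n)) => k2.
  have -> : (p ^ 2 %| n)%N.
    by rewrite pfactor_dvdn //; move: pn; rewrite mem_primes => /andP[].
  apply: (@le_trans _ _ (1 + 1)); last by rewrite mulr1; lra.
  by apply: (le_trans (le_normcB _ _)); rewrite normc_cis lerD2r.
have -> : logn p n = 1%N.
  by apply/eqP; rewrite eqn_leq -ltnS k2 logn_gt0.
rewrite expn1; apply: (le_trans (disc_cis_Im (gle1 p))).
by rewrite lerDl mulr_ge0.
Qed.

Variables (Q K N : nat) (Q0 : (0 < Q)%N) (K0 : (0 < K)%N).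
Hypothesis hQ : forall p, prime p -> (p %| Q)%N = (p <= K)%N.
Variable tau : R.
Hypothesis htau : \sum_(K.+1 <= p < N.+1 | prime p) defect p / p%:R <= tau.
Hypothesis hKtau : K%:R^-1 <= tau.
Let X : R := N%:R / Q%:R.
Let B : R := \sum_(K.+1 <= p < N.+1 | prime p) defect p.

Let X0 : 0 <= X. Proof. by rewrite divr_ge0. Qed.

Lemma class_near_cis y : (forall m, (m ^ 2 <= N)%N = (m <= y)%N) ->
  \sum_(1 <= n < N.+1 | n == 1 %[mod Q]) normc (g n - cis (drift_sum n)) <=
  5 * tau * X + 3 * B + 2 * y%:R.
Proof.
move=> hy.
apply: (@le_trans _ _ (\sum_(1 <= n < N.+1 | n == 1 %[mod Q])
   \sum_(p <- primes n) (3 * defect p + 2 * (p ^ 2 %| n)%N%:R))).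
  rewrite big_nat_cond [leRHS]big_nat_cond ler_sum // => n /andP[/andP[n0 _] _].
  exact: multiplicative_near_cis.
under eq_bigr do rewrite big_split /= -!mulr_sumr.
rewrite big_split /= -!mulr_sumr.
have h1 := sum_class_primes_le Q0 hQ N (fun p _ => defect_ge0 p).
have h2 := @sum_class_square_le R Q K Q0 hQ N y K0 hy.
have h3 : X * \sum_(K.+1 <= p < N.+1 | prime p) defect p / p%:R <= X * tau.
  exact: ler_wpM2l.
have h4 : X / K%:R <= X * tau by exact: ler_wpM2l.
move: h1 h2; rewrite -/X -/B; lra.
Qed.

Variable eta : R.
Hypothesis eta0 : 0 < eta.

(** Cauchy-Schwarz in the form |x| <= eta / 2 + x ^ 2 / (2 eta), followed by the
  Turan-Kubilius inequality. *)
Lemma class_small_primes y : (forall m, (m ^ 4 <= N)%N = (m <= y)%N) ->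
  \sum_(1 <= n < N.+1 | n == 1 %[mod Q])
    `|\sum_(K.+1 <= p < N.+1 | prime p && (p ^ 4 <= N)%N)
        drift p * ((p %| n)%N%:R - p%:R^-1)| <=
  eta / 2 * (X + 1) + (2 * tau * X + 4 * y%:R ^+ 2) / (2 * eta).
Proof.
move=> hy.
pose P := [seq p <- index_iota K.+1 N.+1 | prime p && (p ^ 4 <= N)%N].
have e1 n : \sum_(K.+1 <= p < N.+1 | prime p && (p ^ 4 <= N)%N)
        drift p * ((p %| n)%N%:R - p%:R^-1) = \sum_(p <- P) drift p * ((p %| n)%N%:R - p%:R^-1).
  by rewrite /P big_filter.
under eq_bigr do rewrite e1.
apply: (@le_trans _ _ (\sum_(1 <= n < N.+1 | n == 1 %[mod Q])
   (eta / 2 * 1 + (2 * eta)^-1 * (\sum_(p <- P) drift p * ((p %| n)%N%:R - p%:R^-1)) ^+ 2))).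
  by rewrite ler_sum // => n _; rewrite mulr1 [X in _ + X]mulrC normr_le_amgm.
rewrite big_split /= -!mulr_sumr lerD //.
  by rewrite ler_wpM2l ?count_class_le // divr_ge0 ?ltW.
rewrite mulrC ler_wpM2r //; first by rewrite invr_ge0 mulr_ge0 ?ltW.
have uP : uniq P by rewrite filter_uniq // iota_uniq.
have hP p : p \in P -> prime p && coprime Q p.
  rewrite mem_filter mem_index_iota => /andP[/andP[pp _] /andP[Kp _]].
  by rewrite pp (coprime_class_prime hQ pp).
apply: le_trans (turan_kubilius Q0 N uP hP drift_le1) _.
have h1 : \sum_(p <- P) drift p ^+ 2 / p%:R <= 2 * tau.
  apply: (@le_trans _ _ (\sum_(p <- P) 2 * (defect p / p%:R))).
    by apply: ler_sum => p _; rewrite mulrA ler_wpM2r ?invr_ge0 ?sqr_drift_le.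
  rewrite -mulr_sumr ler_wpM2l //; apply: le_trans htau.
  rewrite /P big_filter big_mkcondr ler_sum // => p _; case: ifP => // _.
  by rewrite divr_ge0 ?defect_ge0.
have h2 : (size P <= y)%N.
  have -> : y = size (index_iota 1 y.+1) by rewrite size_iota subn1.
  apply: uniq_leq_size => // p; rewrite mem_filter !mem_index_iota -[(p < y.+1)%N]/(p <= y)%N -hy.
  by move=> /andP[/andP[/prime_gt0 -> ->]].
have h3 : (size P)%:R ^+ 2 <= y%:R ^+ 2 :> R by rewrite ler_pXn2r ?nnegrE // ler_nat.
by have := ler_wpM2l X0 h1; rewrite -/X; lra.
Qed.

(** Here too |drift p| <= eta / 2 + defect p / eta; the constants eta / 2 add up
  to at most 2 eta because n has at most 4 such primes, and the defects are
  small on average. *)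
Lemma class_large_primes :
  \sum_(1 <= n < N.+1 | n == 1 %[mod Q])
     \sum_(p <- primes n) (N < p ^ 4)%N%:R * `|drift p| <=
  2 * eta * (X + 1) + (tau * X + B) / eta.
Proof.
apply: (@le_trans _ _ (\sum_(1 <= n < N.+1 | n == 1 %[mod Q])
  (2 * eta * 1 + eta^-1 * \sum_(p <- primes n) defect p))).
  rewrite big_nat_cond [leRHS]big_nat_cond ler_sum // => n /andP[/andP[n0 nN] _].
  apply: (@le_trans _ _ (\sum_(p <- primes n) (eta / 2 * (N < p ^ 4)%N%:R + eta^-1 * defect p))).
    apply: ler_sum => p _; case: ltnP => _ /=; last first.
      by rewrite mul0r mulr0 add0r mulr_ge0 ?defect_ge0 // invr_ge0 ltW.
    rewrite mul1r mulr1; apply: le_trans (normr_le_amgm _ eta0) _; rewrite lerD2l.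
    rewrite invfM mulrC -mulrA mulrC -mulrA ler_wpM2l ?invr_ge0 ?(ltW eta0) //.
    by have := sqr_drift_le p; lra.
  rewrite big_split /= -!mulr_sumr lerD2r -natr_sum.
  have := count_large_primes n0 nN; rewrite -(ler_nat R) => h.
  by have := ler_wpM2l (ltW eta0) h; lra.
rewrite big_split /= -!mulr_sumr lerD //.
  by rewrite ler_wpM2l ?count_class_le // mulr_ge0 // ltW.
rewrite mulrC ler_wpM2r ?invr_ge0 ?(ltW eta0) //.
apply: le_trans (sum_class_primes_le Q0 hQ N (fun p _ => defect_ge0 p)) _.
by rewrite lerD2r mulrC ler_wpM2r.
Qed.

Lemma class_drift_sum y : (forall m, (m ^ 4 <= N)%N = (m <= y)%N) ->
  \sum_(1 <= n < N.+1 | n == 1 %[mod Q])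
     normc (cis (drift_sum n) - cis (drift_mean K N)) <=
  eta / 2 * (X + 1) + (2 * tau * X + 4 * y%:R ^+ 2) / (2 * eta) +
  (2 * eta * (X + 1) + (tau * X + B) / eta).
Proof.
move=> hy; apply: le_trans (lerD (class_small_primes hy) class_large_primes).
rewrite -big_split /= big_nat_cond [leRHS]big_nat_cond ler_sum //.
move=> n /andP[/andP[n0 nN] /eqP n1].
apply: (le_trans (normc_cisB _ _)).
have nN' : (0 < n <= N)%N by rewrite n0.
rewrite /drift_sum (sum_primes_class hQ _ nN' n1) (sum_primes_class hQ _ nN' n1) /drift_mean.
have -> : \sum_(K.+1 <= p < N.+1 | prime p) (p %| n)%N%:R * drift p =
  \sum_(K.+1 <= p < N.+1 | prime p && (p ^ 4 <= N)%N) (p %| n)%N%:R * drift p +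
  \sum_(K.+1 <= p < N.+1 | prime p) (p %| n)%N%:R * ((N < p ^ 4)%N%:R * drift p).
  rewrite big_mkcondr -big_split /=; apply: eq_bigr => p _.
  by rewrite ltnNge; case: leqP => _ /=; ring.
rewrite addrAC; apply: (le_trans (ler_normD _ _)); rewrite lerD //.
  by rewrite -sumrB le_eqVlt; apply/orP; left; apply/eqP; congr `|_|; apply: eq_bigr => p _; ring.
apply: (le_trans (ler_norm_sum _ _ _)); apply: ler_sum => p _.
by rewrite !normrM !normr_nat.
Qed.

End concentration.

Lemma ler_sum_nat_sub (R : realType) (F : nat -> R) (P P' : pred nat) m m' n :
  (forall i, 0 <= F i) -> (forall i, (m <= i < n)%N -> P i -> (m' <= i)%N && P' i) ->
  \sum_(m <= i < n | P i) F i <= \sum_(m' <= i < n | P' i) F i.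
Proof.
move=> F0 h; rewrite !big_geq_mkord big_mkcond [leRHS]big_mkcond ler_sum // => i _.
case: ifP => [/andP[Pi mi]|_]; last by case: ifP.
by have := h i; rewrite mi ltn_ord Pi => /(_ isT isT) /andP[-> ->].
Qed.

Section concentration_asymptotics.
Context {R : realType}.
Variable g : nat -> R[i].
Hypothesis g1 : g 1 = 1.
Hypothesis gM : forall m n, (0 < m)%N -> (0 < n)%N -> coprime m n -> g (m * n)%N = g m * g n.
Hypothesis gle1 : forall n, normc (g n) <= 1.
Hypothesis tail : forall e : R, 0 < e -> exists K, forall K' N, (K <= K')%N ->
  \sum_(K'.+1 <= p < N.+1 | prime p) defect g p / p%:R <= e.

(** The sum of defect p / p converges; split it at a large L, and use p <= N
  beyond L. *)
Lemma sum_defect_small (K : nat) (e : R) : 0 < e ->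
  \forall N \near \oo, \sum_(K.+1 <= p < N.+1 | prime p) defect g p <= e * N%:R.
Proof.
move=> e0; have [L hL] := tail (divr_gt0 e0 (ltr0n _ 2)).
pose C := \sum_(1 <= p < L.+1 | prime p) defect g p.
near=> N.
have LN : (L <= N)%N by near: N; exact: nbhs_infty_ge.
have KN : (K <= N)%N by near: N; exact: nbhs_infty_ge.
apply: (@le_trans _ _ (\sum_(1 <= p < N.+1 | prime p) defect g p)).
  rewrite [leRHS](big_cat_nat (n := K.+1)) //= lerDr.
  by apply: sumr_ge0 => p _; exact: defect_ge0.
rewrite (big_cat_nat (n := L.+1)) //= -/C.
have h : \sum_(L.+1 <= p < N.+1 | prime p) defect g p <= e / 2 * N%:R.
  apply: le_trans (ler_wpM2r (ler0n _ N) (hL L N (leqnn L))).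
  rewrite mulr_suml big_nat_cond [leRHS]big_nat_cond ler_sum // => p /andP[/andP[Lp pN] _].
  rewrite -mulrA ler_peMr ?defect_ge0 // mulrC ler_pdivlMr ?ltr0n ?(leq_trans _ Lp) //.
  by rewrite mul1r ler_nat.
have : C / (e / 2) <= N%:R by near: N; exact: nbhs_infty_ger.
rewrite ler_pdivrMr; lra.
Unshelve. all: by end_near.
Qed.

Lemma root_small (e : R) : 0 < e ->
  \forall N \near \oo, forall y, (y ^ 2 <= N)%N -> y%:R <= e * N%:R.
Proof.
move=> e0; near=> N => y yN.
have yN' : y%:R ^+ 2 <= N%:R :> R by rewrite -natrX ler_nat.
have : (e ^+ 2)^-1 <= N%:R by near: N; exact: nbhs_infty_ger.
rewrite -div1r ler_pdivrMr ?exprn_gt0 // => h.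
rewrite -(@ler_pXn2r _ 2) ?nnegrE ?mulr_ge0 ?(ltW e0) //.
apply: (le_trans yN'); rewrite exprMn expr2.
by have := ler0n R N; nra.
Unshelve. all: by end_near.
Qed.

(** The integers m with n < m ^ 4 <= n' lie in an interval [y + 1, D (y + 1)],
  where y is the integer part of the fourth root of n. *)
Lemma sum_inv_root_window (D n n' : nat) : (0 < D)%N -> (n <= n' <= D * n)%N ->
  \sum_(1 <= m < n'.+1 | (n < m ^ 4 <= n')%N) m%:R^-1 <= D%:R :> R.
Proof.
move=> D0 /andP[nn' n'D].
have [y hy hyn] := @root_floor 4 n isT.
apply: (@le_trans _ _ (\sum_(1 <= m < (D * y.+1).+1) y.+1%:R^-1)).
  rewrite big_mkcond /=.
  apply: (@le_trans _ _ (\sum_(1 <= m < n'.+1) (if (m <= D * y.+1)%N then y.+1%:R^-1 else 0))).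
    apply: ler_sum => m _; case: ifP => [/andP[nm mn']|_]; last by case: ifP.
    rewrite ifT.
      have ym : (y < m)%N by rewrite ltnNge -hyn -ltnNge.
      by rewrite lef_pV2 ?posrE ?ltr0n ?(leq_trans _ ym) // ler_nat.
    have ny : (n < y.+1 ^ 4)%N by rewrite ltnNge hyn ltnn.
    rewrite -(@leq_exp2r _ _ 4) // (leq_trans mn') // (leq_trans n'D) //.
    rewrite expnMn leq_mul ?(ltnW ny) // -{1}(expn1 D).
    by case: (D) D0 => // d _; rewrite leq_pexp2l.
  have [h|h] := leqP n' (D * y.+1).
    rewrite [leRHS](big_cat_nat (n := n'.+1)) //= -[leLHS]addr0 lerD ?sumr_ge0 //.
    by apply: ler_sum => m _; case: ifP.
  rewrite (big_cat_nat (n := (D * y.+1).+1)) //=; last exact: ltnW.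
  rewrite [X in _ + X]big_nat_cond [X in _ + X]big1 ?addr0.
    by apply: ler_sum => m _; case: ifP.
  by move=> m /andP[/andP[hm _] _]; rewrite leqNgt hm.
rewrite sumr_const_nat subn1 -[_.+1.-1]/(D * y.+1)%N -[leLHS]mulr_natr natrM.
by rewrite mulrCA mulVf ?mulr1 ?pnatr_eq0.
Qed.

(** Between n and n' the mean changes only by the primes between their fourth
  roots.  These have bounded ratio, so the sum of 1 / p over them is bounded;
  as |drift p| <= eta / 2 + defect p / eta, the change is small. *)
Lemma drift_mean_slow (K D : nat) (e : R) : (0 < D)%N -> 0 < e ->
  \forall n \near \oo, forall n', (n <= n' <= D * n)%N ->
    `|drift_mean g K n' - drift_mean g K n| <= e.
Proof.
move=> D0 e0; set eta := e / D%:R.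
have eta0 : 0 < eta by rewrite divr_gt0 // ltr0n.
have [L hL] := tail (mulr_gt0 (divr_gt0 e0 (ltr0n _ 2)) eta0).
near=> n => n' /[dup] hn /andP[nn' n'D].
have Ln : (L ^ 4 <= n)%N by near: n; exact: nbhs_infty_ge.
have -> : drift_mean g K n' - drift_mean g K n =
   \sum_(K.+1 <= p < n'.+1 | prime p && (n < p ^ 4 <= n')%N) drift g p / p%:R.
  have -> : drift_mean g K n = \sum_(K.+1 <= p < n'.+1 | prime p && (p ^ 4 <= n)%N) drift g p / p%:R.
    rewrite /drift_mean.
    rewrite (big_nat_widen _ _ n'.+1) ?ltnS //; apply: eq_bigl => p.
    case: (leqP (p ^ 4) n) => pn; rewrite ?andbF ?andbT //=.
    case: (prime p) => //=; rewrite ltnS (leq_trans _ pn) //.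
    by case: p {pn} => // p; rewrite -{1}(expn1 p.+1) leq_pexp2l.
  rewrite /drift_mean !big_mkcondr -sumrB /=; apply: eq_bigr => p _.
  case: (leqP (p ^ 4) n) => pn /=; last by rewrite subr0.
  by rewrite (leq_trans pn nn') subrr.
apply: (le_trans (ler_norm_sum _ _ _)).
apply: (@le_trans _ _ (\sum_(K.+1 <= p < n'.+1 | prime p && (n < p ^ 4 <= n')%N)
   (eta / 2 * p%:R^-1 + eta^-1 * (defect g p / p%:R)))).
  apply: ler_sum => p _; rewrite normrM normfV normr_nat.
  rewrite mulrA -mulrDl ler_wpM2r ?invr_ge0 //.
  have h2 := sqr_drift_le gle1 p.
  suff : 2 * eta * `|drift g p| <= 2 * eta * (eta / 2 + eta^-1 * defect g p).
    by rewrite ler_pM2l // mulr_gt0.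
  rewrite mulrDr.
  have -> : 2 * eta * (eta^-1 * defect g p) = 2 * defect g p by field; rewrite gt_eqF.
  have -> : 2 * eta * (eta / 2) = eta ^+ 2 by field.
  have := sqr_ge0 (eta - `|drift g p|); have := real_normK (num_real (drift g p)); nra.
rewrite big_split /= -!mulr_sumr.
have h1 : \sum_(K.+1 <= p < n'.+1 | prime p && (n < p ^ 4 <= n')%N) p%:R^-1 <= D%:R :> R.
  apply: le_trans (sum_inv_root_window D0 hn).
  apply: ler_sum_nat_sub => [i|i /andP[Ki _] /andP[_ ->]]; first by rewrite invr_ge0.
  by rewrite andbT (leq_trans _ Ki).
have h2 : \sum_(K.+1 <= p < n'.+1 | prime p && (n < p ^ 4 <= n')%N) (defect g p / p%:R) <= e / 2 * eta.
  apply: le_trans (hL L n' (leqnn L)).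
  apply: ler_sum_nat_sub => [i|i _ /andP[-> /andP[ni _]]].
    by rewrite divr_ge0 // defect_ge0.
  by rewrite andbT -(@ltn_exp2r _ _ 4) // (leq_ltn_trans Ln).
have -> : e = eta / 2 * D%:R + eta^-1 * (e / 2 * eta).
  by rewrite /eta; field; rewrite ?gt_eqF ?ltr0n //.
apply: lerD; first by apply: ler_wpM2l h1; rewrite divr_ge0 // ltW.
by apply: ler_wpM2l h2; rewrite invr_ge0 ltW.
Unshelve. all: by end_near.
Qed.

(** Chain of approximations for n in the class: g n by cis (drift_sum n), then
  by cis (drift_mean g K N), then by cis (drift_mean g K n).  The last step is
  slow variation when n > N / D, and the smaller n are few. *)
Lemma class_concentration (e : R) : 0 < e -> exists K0, forall K Q, (K0 <= K)%N ->
  (0 < Q)%N -> (forall p, prime p -> (p %| Q)%N = (p <= K)%N) ->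
  \forall N \near \oo, \sum_(1 <= n < N.+1 | n == 1 %[mod Q])
    normc (g n - cis (drift_mean g K n)) <= e * (N%:R / Q%:R).
Proof.
move=> e0.
(* All errors below are bounded by multiples of eta N / Q, whose coefficients
   add up to less than 15. *)
pose eta := Num.min 1 (e / 15).
have eta0 : 0 < eta by rewrite lt_min ltr01 divr_gt0.
have eta1 : eta <= 1 by rewrite ge_min lexx.
have etae : 15 * eta <= e by rewrite mulrC -ler_pdivlMr // ge_min lexx orbT.
have eta20 : 0 < eta ^+ 2 by rewrite exprn_gt0.
have [K1 hK1] := tail eta20.
have [D hD] : exists D, (eta ^+ 2)^-1 <= D.+1%:R.
  by exists (Num.bound (eta ^+ 2)^-1); rewrite ltW // (lt_le_trans (archi_boundP _)) ?ler_nat // invr_ge0 ltW.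
exists (maxn K1 D.+1) => K Q; rewrite geq_max => /andP[K1K DK] Q0 hQ.
have K0 : (0 < K)%N by exact: leq_trans DK.
have hKtau : K%:R^-1 <= eta ^+ 2.
  rewrite -[leRHS]invrK lef_pV2 ?posrE ?invr_gt0 ?ltr0n //.
  by apply: (le_trans hD); rewrite ler_nat.
have hDeta : D.+1%:R^-1 <= eta.
  apply: (@le_trans _ _ (eta ^+ 2)); last by rewrite expr2 ler_piMr ?(ltW eta0).
  by rewrite -[leRHS]invrK lef_pV2 ?posrE ?invr_gt0 ?ltr0n.
pose d := eta / 20 * eta / Q%:R.
have Q0' : 0 < Q%:R :> R by rewrite ltr0n.
have d0 : 0 < d by rewrite divr_gt0 // mulr_gt0 // divr_gt0.
have [n0 _ hslow] := drift_mean_slow K (ltn0Sn D) eta0.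
near=> N.
have [y2 hy2 y2P] := @root_floor 2 N isT.
have [y4 hy4 y4P] := @root_floor 4 N isT.
have N1 : d^-1 <= N%:R by near: N; exact: nbhs_infty_ger.
have hy2' : y2%:R <= d * N%:R.
  by move: y2 hy2 {y2P}; near: N; exact: root_small.
have hy4' : (y4 ^ 2)%:R <= d * N%:R.
  have : ((y4 ^ 2) ^ 2 <= N)%N by rewrite -expnM.
  by move: (y4 ^ 2)%N {hy4 y4P}; near: N; exact: root_small.
have hB : \sum_(K.+1 <= p < N.+1 | prime p) defect g p <= d * N%:R.
  by near: N; exact: sum_defect_small.
have hn0 : (D.+1 * n0 <= N)%N by near: N; exact: nbhs_infty_ge.
have T1 := class_near_cis g1 gM gle1 Q0 K0 hQ (hK1 K N K1K) hKtau y2P.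
have T2 := class_drift_sum gle1 Q0 hQ (hK1 K N K1K) eta0 y4P.
move: T1 T2 hB.
set B := \sum_(K.+1 <= p < N.+1 | prime p) defect g p.
set X := N%:R / Q%:R => T1 T2 hB.
have dX : d * N%:R = eta / 20 * eta * X by rewrite /d /X; ring.
have X1 : 1 <= eta / 20 * eta * X.
  by have := ler_wpM2l (ltW d0) N1; rewrite mulfV ?gt_eqF // dX.
have X0 : 0 <= X by rewrite divr_ge0.
have T3 : \sum_(1 <= n < N.+1 | n == 1 %[mod Q])
     normc (cis (drift_mean g K N) - cis (drift_mean g K n)) <=
     eta * (X + 1) + 2 * (eta * X + 1).
  apply: (@le_trans _ _ (\sum_(1 <= n < N.+1 | n == 1 %[mod Q])
     (eta * 1 + 2 * (D.+1 * n < N)%N%:R))).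
    rewrite big_nat_cond [leRHS]big_nat_cond ler_sum // => n /andP[/andP[n1 nN] _].
    case: (ltnP (D.+1 * n) N) => h.
      rewrite !mulr1; apply: (le_trans (le_normcB _ _)); rewrite !normc_cis; lra.
    rewrite mulr0 addr0 mulr1; apply: (le_trans (normc_cisB _ _)).
    apply: hslow; last by rewrite h andbT.
    by rewrite /= -(leq_pmul2l (ltn0Sn D)) (leq_trans hn0).
  rewrite big_split /= -!mulr_sumr lerD //.
    by rewrite ler_wpM2l ?(ltW eta0) // count_class_le.
  rewrite ler_wpM2l //.
  apply: (@le_trans _ _ (\sum_(1 <= n < (N %/ D.+1).+1 | n == 1 %[mod Q]) 1)).
    rewrite [leRHS](big_nat_widen _ _ N.+1) ?ltnS ?leq_div //.
    rewrite big_mkcond [leRHS]big_mkcond; apply: ler_sum => n _.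
    case: ifP => //= _; rewrite ltnS leq_divRL // mulnC.
    by case: ltngtP.
  apply: (le_trans (count_class_le Q0 _)); rewrite lerD2r.
  rewrite /X mulrA ler_wpM2r ?invr_ge0 //.
  apply: le_trans (ler_wpM2r (ler0n R N) hDeta).
  by rewrite mulrC ler_pdivlMr ?ltr0n // -natrM ler_nat leq_divM.
apply: (@le_trans _ _ (\sum_(1 <= n < N.+1 | n == 1 %[mod Q])
  (normc (g n - cis (drift_sum g n)) +
   normc (cis (drift_sum g n) - cis (drift_mean g K N)) +
   normc (cis (drift_mean g K N) - cis (drift_mean g K n))))).
  apply: ler_sum => n _; rewrite -addrA.
  apply: le_trans (lerD (lexx _) (le_normcD _ _)).
  by apply: le_trans (le_normcD _ _); rewrite le_eqVlt; apply/orP; left; apply/eqP; congr normc; ring.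
rewrite !big_split /=.
apply: (le_trans (lerD (lerD T1 T2) T3)).
apply: le_trans (ler_wpM2r X0 etae).
move: hB hy2' hy4'; rewrite dX natrX => hB hy2' hy4'.
have e2 : eta ^+ 2 <= eta by rewrite expr2 ler_piMr ?(ltW eta0).
have e3 : eta ^+ 2 * X <= eta * X by rewrite ler_wpM2r.
have q1 : (2 * eta ^+ 2 * X + 4 * y4%:R ^+ 2) / (2 * eta) <= (1 + 1/10) * eta * X.
  rewrite ler_pdivrMr ?mulr_gt0 //; rewrite expr2; nra.
have q2 : (eta ^+ 2 * X + B) / eta <= (1 + 1/20) * eta * X.
  by rewrite ler_pdivrMr // expr2; nra.
have q3 : eta / 20 * eta * X <= eta / 20 * X by nra.
nra.
Unshelve. all: by end_near.
Qed.
End concentration_asymptotics.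

(** * Dirichlet characters and roots of unity *)

Lemma prime_dvd_factorial p K : prime p -> (p %| K`!)%N = (p <= K)%N.
Proof.
move=> pp; elim: K => [|K IH].
  by rewrite fact0 dvdn1 leqn0 !eqn_leq leqNgt prime_gt1 //= leqn0 gtn_eqF ?prime_gt0.
rewrite factS Euclid_dvdM // IH [RHS]leq_eqVlt ltnS.
case: (leqP p K) => pK; rewrite ?orbT // !orbF.
apply/idP/eqP => [/dvdn_leq|->//]; move=> /(_ isT); lia.
Qed.

Section characters.
Context {R : realType}.
Local Open Scope complex_scope.

Definition slowly_varying (omega : nat -> R[i]) :=
  (forall n, normc (omega n) <= 1) /\
  forall e : R, 0 < e -> \forall n \near \oo, normc (omega n.+1 - omega n) <= e.

Lemma dirichlet_character1 q (chi : nat -> R[i]) : dirichlet_character q chi -> chi 1%N = 1.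
Proof.
case=> q0 _ chiM chi0; have := chiM 1%N 1%N; rewrite muln1 => h.
have c1 : chi 1%N != 0 by rewrite chi0 coprime1n.
by apply: (mulfI c1); rewrite -h mulr1.
Qed.

Lemma dirichlet_character_mod q (chi : nat -> R[i]) m n : dirichlet_character q chi ->
  m = n %[mod q] -> chi m = chi n.
Proof.
case=> q0 chiP _ _.
have h k : chi k = chi (k %% q)%N.
  rewrite {1}(divn_eq k q); elim: (k %/ q)%N => [|j IH]; first by rewrite mul0n.
  by rewrite mulSn -addnA addnC chiP.
by move=> mn; rewrite (h m) (h n) mn.
Qed.

(** A nonzero value is a root of unity by Euler's theorem. *)
Lemma normc_dirichlet_character q (chi : nat -> R[i]) n : dirichlet_character q chi ->
  normc (chi n) <= 1.
Proof.
move=> /[dup] hchi [q0 _ chiM chi0].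
case: (boolP (coprime n q)) => nq; last first.
  by move: nq; rewrite -chi0 negbK => /eqP ->; rewrite normc0.
have chiX k : chi (n ^ k)%N = chi n ^+ k.
  elim: k => [|k IH]; first by rewrite expn0 expr0 (dirichlet_character1 hchi).
  by rewrite expnS exprS chiM IH.
have e : chi n ^+ totient q = 1.
  rewrite -chiX -(dirichlet_character1 hchi); apply: (dirichlet_character_mod hchi).
  exact: cyclic.Euler_exp_totient.
have normcX (z : R[i]) k : normc (z ^+ k) = normc z ^+ k.
  elim: k => [|k IH]; first by rewrite !expr0 normc1.
  by rewrite !exprS normcM IH.
have := normcX (chi n) (totient q); rewrite e normc1 => /esym/eqP.
by rewrite pexpr_eq1 ?normc_ge0 ?totient_gt0 // => /eqP ->.
Qed.

Lemma cis_neq1 (x : R) : 0 < x < 2 * pi -> cis x != 1.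
Proof.
move=> /andP[x0 x2]; apply/eqP => /(congr1 (@complex.Re R)) /=.
have -> : x = x / 2 + x / 2 by lra.
rewrite cosD -!expr2.
have s0 : 0 < sin (x / 2) by apply: sin_gt0_pi; apply/andP; split; lra.
have := cos2Dsin2 (x / 2); nra.
Qed.

Lemma cisX (x : R) k : cis x ^+ k = cis (x * k%:R).
Proof.
elim: k => [|k IH]; first by rewrite expr0 mulr0 cis0.
by rewrite exprS IH -cisD -[k.+1%:R]natr1; congr cis; ring.
Qed.

(** Orthogonality of the additive characters modulo Q. *)
Lemma sum_roots_of_unity (Q b n : nat) : (0 < Q)%N ->
  \sum_(0 <= a < Q) cis (2 * pi * (a%:R / Q%:R) * b%:R) * cis (- (2 * pi * (a%:R / Q%:R) * n%:R))
   = (Q * (n == b %[mod Q]))%:R :> R[i].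
Proof.
move=> Q0.
have Q0' : Q%:R != 0 :> R by rewrite pnatr_eq0 -lt0n.
pose z m : R[i] := cis (2 * pi * (m%:R / Q%:R)).
have zM m m' : z (m + m')%N = z m * z m' by rewrite /z -cisD natrD; congr cis; ring.
have zQ m : z (m * Q)%N = 1.
  by rewrite /z natrM mulfK // cis2pin.
have zmod m : z m = z (m %% Q)%N by rewrite {1}(divn_eq m Q) zM zQ mul1r.
have znz m : z m != 0.
  by apply/eqP => zm; have : normc (z m) = 1 := normc_cis _; rewrite zm normc0 => /esym/eqP;
    rewrite oner_eq0.
have zN m : cis (- (2 * pi * (m%:R / Q%:R))) = (z m)^-1.
  by apply: (mulfI (znz m)); rewrite cisMN divff.
under eq_bigr => a _.
  have -> : 2 * pi * (a%:R / Q%:R) * b%:R = 2 * pi * (b%:R / Q%:R) * a%:R :> R by ring.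
  have -> : - (2 * pi * (a%:R / Q%:R) * n%:R) = - (2 * pi * (n%:R / Q%:R)) * a%:R :> R by ring.
  rewrite -!cisX zN -exprMn -/(z b); over.
have z1 : (z b / z n == 1) = (n == b %[mod Q]).
  rewrite -subr_eq0 -(mulIr_eq0 _ (mulIf (znz n))) mulrBl divfK // mul1r subr_eq0.
  rewrite zmod [z n]zmod eq_sym.
  apply/eqP/eqP => [|-> //].
  have zinj r s : (r < s)%N -> (s < Q)%N -> z s != z r.
    move=> rs sQ; rewrite -(subnK (ltnW rs)) zM -subr_eq0 -[X in _ - X]mul1r -mulrBl mulf_neq0 //.
    rewrite subr_eq0; apply: cis_neq1.
    have pi0 := pi_gt0 R.
    have d0 : 0 < (s - r)%:R / Q%:R :> R by rewrite divr_gt0 ?ltr0n ?subn_gt0.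
    have d1 : (s - r)%:R / Q%:R < 1 :> R.
      by rewrite ltr_pdivrMr ?ltr0n // mul1r ltr_nat (leq_ltn_trans (leq_subr _ _)).
    by apply/andP; split; nra.
  have nQ : (n %% Q < Q)%N by rewrite ltn_pmod.
  have bQ : (b %% Q < Q)%N by rewrite ltn_pmod.
  case: (ltngtP (n %% Q) (b %% Q)) => // h e.
    by have := zinj _ _ h bQ; rewrite e eqxx.
  by have := zinj _ _ h nQ; rewrite e eqxx.
case: (boolP (n == b %[mod Q])) => h.
  have -> : z b / z n = 1 by apply/eqP; rewrite z1.
  by under eq_bigr do rewrite expr1n; rewrite sumr_const_nat subn0 muln1.
rewrite muln0; apply/eqP.
have y1 : z b / z n - 1 != 0 by rewrite subr_eq0 z1.
rewrite -(inj_eq (mulfI y1)) mulr0 big_mkord -subrX1.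
rewrite exprMn exprVn /z !cisX.
have eQ m : 2 * pi * (m%:R / Q%:R) * Q%:R = 2 * pi * m%:R :> R by rewrite -!mulrA mulVf // mulr1.
by rewrite !eQ !cis2pin invr1 mulr1 subrr.
Qed.

End characters.

(** * Sequences without rational correlations *)

Section rigidity.
Context {R : realType}.
Local Open Scope complex_scope.
Local Notation wt c n := ((weight R c n)%:num).

(** The twist by omega is essential: the sequence n ^ (i t) itself may have
  no limiting average, and f is compared below with slowly varying unimodular
  sequences rather than with constants. *)
Definition no_rational_correlation (c : averaging) (N_ : nat -> nat) (v : nat -> R[i]) :=
  forall omega, slowly_varying omega -> forall Q a, (0 < a < Q)%N ->
    wnull c N_ (fun n => omega n * cis (- (2 * pi * (a%:R / Q%:R) * n%:R)) * v n).

(** The difference of the indicators of two residue classes has mean 0, so its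
  finite Fourier expansion has only nontrivial frequencies. *)
Lemma residues_equidistribute c N_ v omega Q b b' :
  no_rational_correlation c N_ v -> slowly_varying omega -> (0 < Q)%N ->
  wnull c N_ (fun n => omega n * v n * ((n == b %[mod Q])%:R - (n == b' %[mod Q])%:R)).
Proof.
move=> hv ho Q0.
have Q0' : Q%:R != 0 :> R[i] by rewrite pnatr_eq0 -lt0n.
pose coef a : R[i] := Q%:R^-1 * (cis (2 * pi * (a%:R / Q%:R) * b%:R) - cis (2 * pi * (a%:R / Q%:R) * b'%:R)).
pose w a n : R[i] := omega n * cis (- (2 * pi * (a%:R / Q%:R) * n%:R)) * v n.
have h : wnull c N_ (fun n => \sum_(a <- index_iota 1 Q) (if (0 < a < Q)%N then coef a * w a n else 0)).
  apply: wnull_sum => a; case: (boolP (0 < a < Q)%N) => ha; last exact: wnull0.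
  by apply: wnullZ; exact: hv.
apply: eq_wnull h => n _.
have key B : \sum_(1 <= a < Q) Q%:R^-1 * cis (2 * pi * (a%:R / Q%:R) * B%:R)
     * cis (- (2 * pi * (a%:R / Q%:R) * n%:R)) = (n == B %[mod Q])%:R - Q%:R^-1 :> R[i].
  have := @sum_roots_of_unity R Q B n Q0.
  rewrite big_ltn // !mul0r mulr0 !mul0r oppr0 cis0 mulr1 natrM => /(congr1 (fun z => Q%:R^-1 * z)).
  rewrite mulKf // mulrDr mulr1 mulr_sumr => <-; rewrite addrC addKr.
  by apply: eq_bigr => a _; rewrite -[LHS]mulrA.
have -> : (n == b %[mod Q])%:R - (n == b' %[mod Q])%:R =
   ((n == b %[mod Q])%:R - Q%:R^-1) - ((n == b' %[mod Q])%:R - Q%:R^-1) :> R[i] by ring.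
rewrite -!key -sumrB mulr_sumr big_nat_cond [RHS]big_nat_cond; apply: eq_bigr => a.
by rewrite andbT => ->; rewrite /w /coef; ring.
Qed.

Lemma wnull_residue c N_ Q b : {homo N_ : j k / (j < k)%N} -> (0 < Q)%N ->
  wnull c N_ (fun n => (n == b %[mod Q])%:R - Q%:R^-1 : R[i]).
Proof.
move=> hN Q0 e e0.
pose v n : R := (n == b %[mod Q])%:R - Q%:R^-1.
have S N : `|\sum_(1 <= n < N.+1) v n| <= 1.
  rewrite /v sumrB sumr_const_nat subn1 -[_ *+ _]mulr_natl /=; exact: count_modn_real.
have near1 (s : R) : `|s| = 1 -> \forall k \near \oo,
    s * \sum_(1 <= n < (N_ k).+1) wt c n * v n <= e * total_weight R c (N_ k).
  move=> s1.
  have e2 : e / 2 < e by lra.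
  have : \forall N \near \oo, \sum_(1 <= n < N.+1) s * v n <= e / 2 * N%:R.
    near=> N; rewrite -mulr_sumr; apply: (le_trans (ler_norm _)).
    rewrite normrM s1 mul1r; apply: (le_trans (S N)).
    by rewrite mulrC -ler_pdivrMr ?divr_gt0 // mul1r; near: N; exact: nbhs_infty_ger.
  move=> /(weighted_sum_le c e2) /(near_subseq hN); apply: filterS => k.
  by under eq_bigr do rewrite mulrCA; rewrite -mulr_sumr.
have eqv N : wsum c (fun n => (n == b %[mod Q])%:R - Q%:R^-1 : R[i]) N
     = (\sum_(1 <= n < N.+1) wt c n * v n)%:C.
  rewrite /wsum rmorph_sum /=; apply: eq_bigr => n _.
  by rewrite rmorphM rmorphB fmorphV !rmorph_nat.
near=> k; rewrite eqv normc_real ler_norml; apply/andP; split.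
  rewrite lerNl -mulN1r; near: k; apply: near1; by rewrite normrN normr1.
by rewrite -[leLHS]mul1r; near: k; apply: near1; rewrite normr1.
Unshelve. all: by end_near.
Qed.

(** ln n.+1 - ln n <= 1 / n. *)
Lemma ln_slow (t : R) : slowly_varying (fun n => cis (- (t * ln n%:R))).
Proof.
split=> [n|e e0]; first by rewrite normc_cis.
near=> n.
apply: (le_trans (normc_cisB _ _)).
have nn0 : (0 < n)%N by near: n; exact: nbhs_infty_gt.
have n0 : 0 < n%:R :> R by rewrite ltr0n.
rewrite -opprD normrN -mulrBr normrM.
rewrite -ln_div ?posrE ?ltr0n //.
have -> : n.+1%:R / n%:R = 1 + n%:R^-1 :> R by rewrite -natr1 mulrDl mulfV ?gt_eqF // mul1r.
have h1 : `|ln (1 + n%:R^-1)| <= n%:R^-1 :> R.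
  have i0 : 0 < n%:R^-1 :> R by rewrite invr_gt0.
  rewrite ger0_norm ?ln_ge0 ?lerDl ?(ltW i0) //.
  by rewrite le_ln1Dx // (lt_trans _ i0) // ltrN10.
apply: (le_trans (ler_wpM2l (normr_ge0 t) h1)).
rewrite ler_pdivrMr //; rewrite mulrC -ler_pdivrMr //.
by near: n; exact: nbhs_infty_ger.
Unshelve. all: by end_near.
Qed.

Lemma slowly_varyingM (v w : nat -> R[i]) :
  slowly_varying v -> slowly_varying w -> slowly_varying (fun n => v n * w n).
Proof.
move=> [v1 hv] [w1 hw]; split=> [n|e e0].
  by rewrite normcM mulr_ile1 ?normc_ge0.
near=> n.
have -> : v n.+1 * w n.+1 - v n * w n = (v n.+1 - v n) * w n.+1 + v n * (w n.+1 - w n) by ring.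
apply: (le_trans (le_normcD _ _)); rewrite !normcM.
have h1 : normc (v n.+1 - v n) <= e / 2 by near: n; apply: hv; rewrite divr_gt0.
have h2 : normc (w n.+1 - w n) <= e / 2 by near: n; apply: hw; rewrite divr_gt0.
have := ler_pM (normc_ge0 _) (normc_ge0 _) h1 (w1 n.+1).
have := ler_pM (normc_ge0 _) (normc_ge0 _) (v1 n) h2.
lra.
Unshelve. all: by end_near.
Qed.

End rigidity.

(** * A pretentious function without rational correlations *)

Lemma sum_multiples (V : nmodType) (F : nat -> V) (C : pred nat) P N : (0 < P)%N ->
  \sum_(1 <= n < N.+1 | (P %| n)%N && C (n %/ P)%N) F n =
  \sum_(1 <= m < (N %/ P).+1 | C m) F (P * m)%N.
Proof.
move=> P0; elim: N => [|N IH]; first by rewrite div0n !big_geq.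
rewrite big_mkcond big_nat_recr //= -big_mkcond IH divnS //.
case: (boolP (P %| N.+1)%N) => /= PN; last by rewrite addr0.
rewrite add1n [RHS]big_mkcond big_nat_recr //= -big_mkcond.
have e : (N %/ P).+1 = (N.+1 %/ P)%N by rewrite divnS // PN.
by rewrite e mulnC divnK.
Qed.

Section rigidity_theorem.
Context {R : realType}.
Local Open Scope complex_scope.
Local Notation wt c n := ((weight R c n)%:num).

Lemma nat_ipowM (t : R) m n : (0 < m)%N -> (0 < n)%N ->
  nat_ipow t (m * n)%N = nat_ipow t m * nat_ipow t n.
Proof. by move=> m0 n0; rewrite /nat_ipow natrM lnM ?posrE ?ltr0n // mulrDr cisD. Qed.

Lemma nat_ipow1 (t : R) : nat_ipow t 1 = 1.
Proof. by rewrite /nat_ipow ln1 mulr0 cis0. Qed.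

Variables (f : nat -> R[i]) (t : R) (q : nat) (chi : nat -> R[i]).
Hypothesis fle1 : forall n, normc (f n) <= 1.
Hypothesis fM : forall m n, (0 < m)%N -> (0 < n)%N -> coprime m n -> f (m * n)%N = f m * f n.
Hypothesis hchi : dirichlet_character q chi.
Let g n := f n * (nat_ipow t n * chi n)^*%C.
Hypothesis tail : forall e : R, 0 < e -> exists K, forall K' N, (K <= K')%N ->
  \sum_(K'.+1 <= p < N.+1 | prime p) defect g p / p%:R <= e.

Let q0 : (0 < q)%N. Proof. by case: hchi. Qed.

Let normcJ z : normc (z^*%C) = normc z :> R.
Proof. by case: z => a b; rewrite /= sqrrN. Qed.

Let gle1 n : normc (g n) <= 1.
Proof.
rewrite /g normcM mulr_ile1 ?normc_ge0 // normcJ normcM mulr_ile1 ?normc_ge0 ?normc_cis //.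
exact: normc_dirichlet_character hchi.
Qed.

Let gM m n : (0 < m)%N -> (0 < n)%N -> coprime m n -> g (m * n)%N = g m * g n.
Proof.
move=> m0 n0 mn; rewrite /g fM // nat_ipowM //.
by case: hchi => _ _ -> _; rewrite !rmorphM /=; ring.
Qed.

(** f 1 is 0 or 1.  Were it 0, f would vanish and every prime would have defect
  1.  As every n > 1 in the class of 1 modulo K`! has a prime factor beyond K,
  the convergence of the sum of defect p / p would leave too few integers in
  that class. *)
Lemma pretentious_at1 : f 1%N = 1.
Proof.
have : f 1%N * (f 1%N - 1) = 0 by rewrite mulrBr mulr1 -fM ?muln1 ?subrr.
move=> /eqP; rewrite mulf_eq0 subr_eq0 => /orP[/eqP f10|/eqP //]; exfalso.
have f0 n : (0 < n)%N -> f n = 0 by move=> n0; rewrite -(muln1 n) fM ?coprimen1 // f10 mulr0.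
have d1 p : (0 < p)%N -> defect g p = 1 by move=> p0; rewrite /defect /g f0 // mul0r subr0.
have e4 : 0 < 4^-1 :> R by rewrite invr_gt0.
have [K hK] := tail e4.
have Q0 : (0 < K`!)%N by exact: fact_gt0.
have Q0' : 0 < K`!%:R :> R by rewrite ltr0n.
have e8 : 0 < (8 * K`!%:R)^-1 :> R by rewrite invr_gt0 mulr_gt0.
have hQ p := @prime_dvd_factorial p K.
have [N [h1 h2]] := filter_ex (filterI (sum_defect_small gle1 tail K e8)
  (nbhs_infty_ger (8 * K`!%:R : R))).
have N0 : (0 < N)%N.
  by rewrite -(ltr0n R); apply: lt_le_trans h2; rewrite mulr_gt0.
have := sum_class_primes_le Q0 hQ N (fun p _ => defect_ge0 gle1 p).
have := hK K N (leqnn K).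
set X := N%:R / K`!%:R; set S := \sum_(_ <= _ < _ | _) _ / _; set B := \sum_(K.+1 <= p < N.+1 | prime p) defect g p => hS.
have X8 : 8 <= X by rewrite ler_pdivlMr.
have B8 : B <= X / 8 by move: h1; rewrite -/B invfM /X; lra.
have := @count_class R _ Q0 N; rewrite -/X ler_distl => /andP[c1 _].
have : \sum_(1 <= n < N.+1 | n == 1 %[mod K`!]) 1 <= 1 + \sum_(1 <= n < N.+1 | n == 1 %[mod K`!]) \sum_(p <- primes n) defect g p.
  rewrite big_mkcond [X in _ <= _ + X]big_mkcond big_ltn // [X in _ <= _ + X]big_ltn // eqxx.
  rewrite addrA lerD ?lerDl ?sumr_ge0 // => [p _|]; first exact: defect_ge0.
  rewrite big_nat_cond [leRHS]big_nat_cond; apply: ler_sum => n /andP[/andP[n2 _] _].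
  case: ifP => // _.
  have pn : pdiv n \in primes n.
    by rewrite mem_primes pdiv_prime // pdiv_dvd (ltnW n2).
  rewrite (big_rem (pdiv n)) //= d1 ?pdiv_gt0 // lerDl sumr_ge0 // => p _.
  exact: defect_ge0.
have : X * S <= X / 4 by rewrite ler_wpM2l //; lra.
lra.
Qed.

Let f1 := pretentious_at1.

Let g1 : g 1%N = 1.
Proof. by rewrite /g f1 nat_ipow1 (dirichlet_character1 hchi) !mul1r conjc1. Qed.

Variables (c : averaging) (N_ : nat -> nat).
Hypothesis hN : {homo N_ : j k / (j < k)%N}.
Hypothesis hcor : no_rational_correlation c N_ f.

Let normcM_unit (z w : R[i]) : normc w = 1 -> normc (z * w) = normc z.
Proof. by move=> w1; rewrite normcM w1 mulr1. Qed.

(** With omega n the conjugate of n ^ (i t) cis (drift_mean n), the function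
  u = f omega is close on average to 1 on the class of 1 modulo P Q
  ([class_concentration]).  An integer of the class of P modulo P Q is P m with
  m in the class of 1 modulo Q, prime to P, so u is close there to
  z = f P / P ^ (i t), slow variation allowing to replace P m by m in
  the drift mean.  Equidistribution of f omega in residue classes gives
  z = 1. *)
Lemma pretentious_prime_power p j : prime p -> f (p ^ j)%N = nat_ipow t (p ^ j)%N.
Proof.
move=> pp.
set P := (p ^ j)%N.
have P0 : (0 < P)%N by rewrite expn_gt0 prime_gt0.
(* z is f P / P ^ (i t). *)
pose z := f P * cis (- (t * ln P%:R)).
suff z1 : z = 1.
  rewrite -[LHS]mulr1 -(cisMN (- (t * ln P%:R))) opprK mulrA -/z z1 mul1r //.
have small (e : R) : 0 < e -> normc (1 - z) <= 6 * e.
  move=> e0.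
  have [K0 hK0] := class_concentration g1 gM gle1 tail e0.
  (* The modulus K`! must be a multiple of q, to make chi trivial on the class
     of 1, and of p, to make the class of 1 consist of integers prime to P. *)
  set K := maxn K0 (maxn p q).
  have K0K : (K0 <= K)%N by rewrite leq_max leqnn.
  have pK : (p <= K)%N by rewrite !leq_max leqnn orbT.
  have qK : (q <= K)%N by rewrite !leq_max leqnn !orbT.
  pose Q := K`!; have Q0 : (0 < Q)%N by exact: fact_gt0.
  pose Q' := (P * Q)%N; have Q'0 : (0 < Q')%N by rewrite muln_gt0 P0.
  have hQ p' : prime p' -> (p' %| Q)%N = (p' <= K)%N by exact: prime_dvd_factorial.
  have hQ' p' : prime p' -> (p' %| Q')%N = (p' <= K)%N.
    move=> pp'; rewrite Euclid_dvdM // hQ // /P; case: (leqP p' K) => h; rewrite ?orbT // orbF.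
    rewrite Euclid_dvdX // dvdn_prime2 //; apply/negP => /andP[/eqP pe _].
    by move: h; rewrite pe ltnNge pK.
  have qQ : (q %| Q)%N by rewrite dvdn_fact // q0.
  have qQ' : (q %| Q')%N by rewrite dvdn_mull.
  pose mu n := drift_mean g K n.
  pose omega n := cis (- (t * ln n%:R)) * cis (- mu n).
  have slow_omega : slowly_varying omega.
    apply: slowly_varyingM; first exact: ln_slow.
    split=> [n|d d0]; first by rewrite normc_cis.
    near=> n; apply: (le_trans (normc_cisB _ _)).
    rewrite -opprD normrN.
    have : forall n', (n <= n' <= 2 * n)%N -> `|mu n' - mu n| <= d.
      by near: n; exact: drift_mean_slow.
    apply; rewrite leqnSn mul2n -addnn -addn1 leq_add2l.
    by near: n; exact: nbhs_infty_gt.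
  pose u n := f n * omega n.
  have uE m : m = 1 %[mod Q] -> f m * cis (- (t * ln m%:R)) = g m.
    move=> m1; rewrite /g.
    have conjcM (a b : R[i]) : (a * b)^*%C = a^*%C * b^*%C by exact: rmorphM.
    rewrite conjcM -[(nat_ipow t m)^*%C]cisN mulrA.
    have -> : chi m = 1.
      rewrite -(dirichlet_character1 hchi); apply: (dirichlet_character_mod hchi).
      by rewrite -(modn_dvdm m qQ) m1 modn_dvdm.
    by rewrite conjc1 mulr1.
  have eQ : 0 < e / Q'%:R by rewrite divr_gt0 // ltr0n.
  pose v1 n := (n == 1 %[mod Q'])%:R * normc (u n - 1).
  pose v2 n := (n == P %[mod Q'])%:R * normc (u n - z).
  have hv1 : \forall N \near \oo, \sum_(1 <= n < N.+1) v1 n <= (e / Q'%:R) * N%:R.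
    apply: filterS (hK0 K Q' K0K Q'0 hQ') => N.
    rewrite mulrAC -mulrA; apply: le_trans.
    rewrite [leRHS]big_mkcond; apply: ler_sum => n _; rewrite /v1.
    case: ifP => [/eqP n1|_]; last by rewrite mul0r.
    rewrite mul1r -(normcM_unit (u n - 1) (normc_cis (mu n))) mulrBl mul1r.
    rewrite /u /omega mulrA uE -?mulrA -?cisD ?addNr ?cis0 ?mulr1 //.
    by rewrite -(modn_dvdm n (dvdn_mull P (dvdnn Q))) n1 modn_dvdm // dvdn_mull.
  have hv2 : \forall N \near \oo, \sum_(1 <= n < N.+1) v2 n <= (2 * e / Q'%:R) * N%:R.
    have Q0' : 0 < Q%:R :> R by rewrite ltr0n.
    have P0' : 0 < P%:R :> R by rewrite ltr0n.
    have eQ1 : 0 < e / Q%:R by rewrite divr_gt0.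
    have eq2 : e / Q%:R / 2 < e / Q%:R by lra.
    have eq0 : 0 <= e / Q%:R / 2 by rewrite !divr_ge0 // ltW.
    have slowP : \forall m \near \oo, normc (cis (mu m) - cis (mu (P * m)%N)) <= e / Q%:R / 2.
      near=> m; apply: (le_trans (normc_cisB _ _)); rewrite distrC.
      have : forall n', (m <= n' <= P * m)%N -> `|mu n' - mu m| <= e / Q%:R / 2.
        by near: m; apply: drift_mean_slow => //; rewrite !divr_gt0.
      by apply; rewrite leqnn andbT leq_pmull.
    have [N1 _ hN1] := Cesaro_small eq0 eq2 slowP.
    have [N2 _ hN2] := hK0 K Q K0K Q0 hQ.
    have zf m : m = 1 %[mod Q] -> (0 < m)%N ->
        normc (u (P * m)%N - z) <= normc (g m - cis (mu m)) + normc (cis (mu m) - cis (mu (P * m)%N)).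
      move=> m1 m0.
      have cPm : coprime P m.
        rewrite /P coprimeXl // prime_coprime //.
        apply/negP => pm; have : (p \in primes m) by rewrite mem_primes pp m0.
        by move=> /(prime_class_gt hQ m1); rewrite ltnNge pK.
      have -> : u (P * m)%N - z = z * cis (- mu (P * m)%N) * (g m - cis (mu (P * m)%N)).
        set x := mu (P * m)%N.
        have -> : z * cis (- x) * (g m - cis x) = z * cis (- x) * g m - z * (cis x * cis (- x)) by ring.
        rewrite cisMN mulr1; congr (_ - _).
        rewrite /u /omega fM // natrM lnM ?posrE ?ltr0n // mulrDr opprD cisD -uE // /z.
        ring.
      have z1 : normc (z * cis (- mu (P * m)%N)) <= 1.
        by rewrite normcM_unit ?normc_cis // normcM_unit ?normc_cis.
      rewrite normcM; apply: (@le_trans _ _ (1 * normc (g m - cis (mu (P * m)%N)))).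
        by rewrite ler_wpM2r ?normc_ge0.
      rewrite mul1r; apply: le_trans (le_normcD _ _).
      by rewrite le_eqVlt; apply/orP; left; apply/eqP; congr normc; ring.
    near=> N.
    have NN1 : (N1 <= N %/ P)%N by rewrite leq_divRL //; near: N; exact: nbhs_infty_ge.
    have NN2 : (N2 <= N %/ P)%N by rewrite leq_divRL //; near: N; exact: nbhs_infty_ge.
    have -> : \sum_(1 <= n < N.+1) v2 n =
       \sum_(1 <= m < (N %/ P).+1 | m == 1 %[mod Q]) normc (u (P * m)%N - z).
      rewrite -(sum_multiples (fun n => normc (u n - z)) (fun m => m == 1 %[mod Q]) N P0).
      rewrite [RHS]big_mkcond; apply: eq_bigr => n _.
      rewrite /v2; case: (boolP (P %| n)%N) => [/dvdnP[m ->]|nP].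
        rewrite mulnC mulKn // -[in X in _ == X %[mod _]](muln1 P) -!muln_modr eqn_pmul2l //.
        by rewrite /=; case: (m == 1 %[mod Q]); rewrite ?mul1r ?mul0r.
      rewrite (_ : (n == P %[mod Q']) = false) ?mul0r //.
      apply: contraNF nP => /eqP nP; rewrite /dvdn -(modn_dvdm n (dvdn_mulr Q (dvdnn P))) nP.
      by rewrite modn_dvdm ?modnn // dvdn_mulr.
    apply: (@le_trans _ _ (\sum_(1 <= m < (N %/ P).+1 | m == 1 %[mod Q])
      (normc (g m - cis (mu m)) + normc (cis (mu m) - cis (mu (P * m)%N))))).
      rewrite big_nat_cond [leRHS]big_nat_cond.
      by apply: ler_sum => m /andP[/andP[m0 _] /eqP m1]; exact: zf.
    rewrite big_split /=.
    have := hN1 _ NN1; have := hN2 _ NN2 => /=.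
    set S1 := \sum_(_ <= _ < _ | _) _; set S2 := \sum_(_ <= _ < _) _ => h1 h2.
    apply: (@le_trans _ _ (S1 + S2)).
      rewrite lerD2l /S2 big_mkcond; apply: ler_sum => m _.
      by case: ifP => // _; rewrite normc_ge0.
    apply: (@le_trans _ _ (2 * (e / Q%:R) * (N %/ P)%:R)); first by lra.
    have -> : 2 * e / Q'%:R * N%:R = 2 * (e / Q%:R) * (N%:R / P%:R).
      by rewrite /Q' natrM; field; rewrite !gt_eqF.
    rewrite ler_wpM2l ?mulr_ge0 ?divr_ge0 ?(ltW e0) // ler_pdivlMr //.
    by rewrite -natrM ler_nat leq_divM.
  have e12 : e / Q'%:R < 2 * (e / Q'%:R) by lra.
  have e23 : 2 * e / Q'%:R < 3 * (e / Q'%:R) by lra.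
  have W1 := near_subseq hN (weighted_sum_le c e12 hv1).
  have W2 := near_subseq hN (weighted_sum_le c e23 hv2).
  have e4 : 0 < e / Q'%:R / 4 by rewrite divr_gt0.
  have R1 := wnull_residue (R := R) c 1 hN Q'0.
  have R2 := wnullZ (- z) (wnull_residue c P hN Q'0).
  have R3 := residues_equidistribute 1 P hcor slow_omega Q'0.
  have Rall := wnullB (wnullD R1 R2) R3.
  have Rall4 := Rall _ (divr_gt0 eQ (ltr0n _ 4)).
  have [k [[[w1 w2] w3] k0]] : exists k, ((\sum_(1 <= n < (N_ k).+1) wt c n * v1 n <=
        2 * (e / Q'%:R) * total_weight R c (N_ k) /\
     \sum_(1 <= n < (N_ k).+1) wt c n * v2 n <= 3 * (e / Q'%:R) * total_weight R c (N_ k))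
     /\ normc (wsum c (fun n => (n == 1 %[mod Q'])%:R - Q'%:R^-1 +
           - z * ((n == P %[mod Q'])%:R - Q'%:R^-1) -
           omega n * f n * ((n == 1 %[mod Q'])%:R - (n == P %[mod Q'])%:R)) (N_ k)) <=
         e / Q'%:R / 4 * total_weight R c (N_ k)) /\ (0 < N_ k)%N.
    have h0 := near_subseq hN (nbhs_infty_gt 0).
    exact: (filter_ex (filterI (filterI (filterI W1 W2) Rall4) h0)).
  set W := total_weight R c (N_ k) in w1 w2 w3 *.
  have Wge1 : 1 <= W by apply: total_weight_ge1.
  have id : (1 - z) * (W / Q'%:R)%:C =
     - wsum c (fun n => (n == 1 %[mod Q'])%:R - Q'%:R^-1 +
           - z * ((n == P %[mod Q'])%:R - Q'%:R^-1) -
           omega n * f n * ((n == 1 %[mod Q'])%:R - (n == P %[mod Q'])%:R)) (N_ k)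
     + wsum c (fun n => - ((n == 1 %[mod Q'])%:R * (u n - 1)) +
        (n == P %[mod Q'])%:R * (u n - z)) (N_ k).
    have -> : (1 - z) * (W / Q'%:R)%:C = wsum c (fun=> (1 - z) * Q'%:R^-1) (N_ k).
      rewrite /W /total_weight /wsum rmorphM fmorphV rmorph_nat rmorph_sum /=.
      rewrite mulr_suml mulr_sumr; apply: eq_bigr => n _; ring.
    rewrite -[- wsum _ _ _]mulN1r -wsumZ -wsumD; apply: eq_bigr => n _; congr (_ * _).
    by rewrite /u; ring.
  have nid : normc (1 - z) * (W / Q'%:R) <= (e / Q'%:R / 4 + 5 * (e / Q'%:R)) * W.
    have WQ : 0 <= W / Q'%:R by rewrite divr_ge0 // (le_trans ler01).
    rewrite -[X in _ * X](ger0_norm WQ) -normc_real -normcM id.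
    apply: (le_trans (le_normcD _ _)); rewrite normcN mulrDl lerD //.
    apply: (le_trans (normc_wsum_le _ _ _)).
    apply: (@le_trans _ _ (\sum_(1 <= n < (N_ k).+1) (wt c n * v1 n + wt c n * v2 n))).
      apply: ler_sum => n _; rewrite -mulrDr ler_wpM2l //.
      apply: (le_trans (le_normcD _ _)); rewrite normcN !normcM /v1 /v2.
      have nn (b : bool) : normc (b%:R : R[i]) = b%:R.
        by case: b; rewrite ?normc1 ?normc0.
      by rewrite !nn.
    by rewrite big_split /=; lra.
  have WQ : 0 < W / Q'%:R by rewrite divr_gt0 ?ltr0n // (lt_le_trans ltr01).
  rewrite -(ler_pM2r WQ); apply: (le_trans nid).
  have -> : 6 * e * (W / Q'%:R) = 6 * (e / Q'%:R) * W by ring.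
  by rewrite ler_wpM2r ?(le_trans ler01) //; lra.
have : normc (1 - z) <= 0.
  rewrite leNgt; apply/negP => h.
  by have := small _ (divr_gt0 h (ltr0n _ 7)); lra.
rewrite le_eqVlt ltNge normc_ge0 orbF => /eqP/eq0_normc/eqP.
by rewrite subr_eq0 => /eqP.
Unshelve. all: by end_near.
Qed.

Lemma pretentious_rigidity n : (0 < n)%N -> f n = nat_ipow t n.
Proof.
move=> n0.
rewrite (multiplicative_primes f1 fM n0).
rewrite (multiplicative_primes (nat_ipow1 t) (fun m n m0 n0 _ => nat_ipowM t m0 n0) n0).
rewrite big_seq [RHS]big_seq; apply: eq_bigr => p.
by rewrite mem_primes => /andP[pp _]; exact: pretentious_prime_power.
Qed.

End rigidity_theorem.

(** * Topology of the sequence space *)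

Section topology.
Context {R : realType}.
Local Open Scope complex_scope.
Let Cfield : numFieldType := R[i].

Lemma continuous_disc_val : continuous (@disc_val R : unit_disc R -> Cfield).
Proof. exact: (@initial_continuous (unit_disc R) Cfield). Qed.

Lemma continuous_Re : continuous (@complex.Re R : Cfield -> R).
Proof.
move=> z; have FF : Filter (nbhs (z : Cfield)) by exact: nbhs_filter.
apply: (proj2 (@cvgrPdist_lt R R Cfield (nbhs (z : Cfield)) FF (@complex.Re R) (complex.Re z))) => e e0.
have ec : (0 : R[i]) < e%:C by rewrite ltcR.
have hb : nbhs (z : Cfield) (ball (z : Cfield) e%:C) by exact: nbhsx_ballx.
apply: filterS hb => w; rewrite -ball_normE /= normc_def ltcR => /(le_lt_trans _); apply.
rewrite (_ : Num.sqrt _ = normc ((z : R[i]) - w)); last by case: ((z : R[i]) - w).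
by have := normr_Re_le ((z : R[i]) - w); rewrite raddfB.
Qed.

Lemma continuous_Im : continuous (@complex.Im R : Cfield -> R).
Proof.
move=> z; have FF : Filter (nbhs (z : Cfield)) by exact: nbhs_filter.
apply: (proj2 (@cvgrPdist_lt R R Cfield (nbhs (z : Cfield)) FF (@complex.Im R) (complex.Im z))) => e e0.
have ec : (0 : R[i]) < e%:C by rewrite ltcR.
have hb : nbhs (z : Cfield) (ball (z : Cfield) e%:C) by exact: nbhsx_ballx.
apply: filterS hb => w; rewrite -ball_normE /= normc_def ltcR => /(le_lt_trans _); apply.
rewrite (_ : Num.sqrt _ = normc ((z : R[i]) - w)); last by case: ((z : R[i]) - w).
by have := normr_Im_le ((z : R[i]) - w); rewrite raddfB.
Qed.

Lemma continuous_complex (T : topologicalType) (u v : T -> R) :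
  continuous u -> continuous v ->
  continuous ((fun x => u x +i* v x) : T -> Cfield).
Proof.
move=> cu cv x; apply/cvgrPdist_lt => e e0.
have [er eE] : 0 < complex.Re e /\ e = (complex.Re e)%:C.
  move: e0; rewrite ltcE /= => /andP[/eqP ei er]; split=> //.
  by case: e ei er => a b /= -> _.
have e2 : 0 < complex.Re e / 2 by rewrite divr_gt0.
near=> y.
rewrite eE normc_def ltcR.
rewrite (_ : Num.sqrt _ = normc ((u x +i* v x) - (u y +i* v y))) //.
apply: le_lt_trans (normc_le_ReIm _) _.
have h1 : `|u x - u y| < complex.Re e / 2.
  by near: y; apply: (@cvgr_dist_lt _ _ _ _ _ u (u x) (cu x) _ e2).
have h2 : `|v x - v y| < complex.Re e / 2.
  by near: y; apply: (@cvgr_dist_lt _ _ _ _ _ v (v x) (cv x) _ e2).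
by rewrite !raddfB /=; lra.
Unshelve. all: by end_near.
Qed.

Lemma continuous_coordinate (k : int) :
  continuous (fun x : sequence_space R => disc_val (x k) : Cfield).
Proof.
move=> x; apply: (@continuous_comp (sequence_space R) (unit_disc R) Cfield (fun x => x k) (@disc_val R)).
  exact: (@proj_continuous int (fun _ => unit_disc R) k).
exact: continuous_disc_val.
Qed.

(** The universal property of the product topology. *)
Lemma continuous_sequence_space (T : topologicalType) (h : T -> sequence_space R) :
  (forall k, continuous (fun t => h t k : unit_disc R)) -> continuous h.
Proof.
move=> hk t; apply/cvg_sup => k.
exact: (@continuous_comp_initial _ T (unit_disc R) (fun x : int -> unit_disc R => x k) h (hk k) t).
Qed.

Lemma continuous_shift : continuous (@shift_map R : sequence_space R -> sequence_space R).
Proof.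
apply: continuous_sequence_space => k; exact: (@proj_continuous int (fun _ => unit_disc R) (k + 1)).
Qed.

(** The rays ]a, +oo[ generate the Borel sets of R. *)
Lemma continuous_measurable (F : sequence_space R -> R) : continuous F ->
  measurable_fun setT (F : borel_sequence_space R -> R).
Proof.
move=> cF; apply: (measurability _ (measurable_realfun.RGenOInfty.measurableE R)) => //.
move=> /= _ [_ [a ->] <-]; apply: measurableI => //; apply: sub_sigma_algebra.
by move/continuousP : cF; apply; exact: interval_open.
Qed.

End topology.

(** * The sequence space as a continuous image of the Cantor space *)

Section unit_interval.
Context {R : realType}.

(** The segment as a space of its own: a compact metric space is a continuous
  image of the Cantor space, and this is applied to the whole space. *)
Definition unit_segment : Type := set_type (`[(0 : R), 1]%classic).
HB.instance Definition _ := PseudoMetric.on unit_segment.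

Lemma unit_segment0 : (0 : R) \in (`[(0 : R), 1]%classic).
Proof. by rewrite inE /= in_itv /= lexx ler01. Qed.

HB.instance Definition _ := isPointed.Build unit_segment (@exist R (fun x => x \in _) (0 : R) unit_segment0).

Lemma clamp01 (x : R) : Num.max 0 (Num.min 1 x) \in (`[(0 : R), 1]%classic).
Proof. by rewrite inE /= in_itv /= le_max lexx /= ge_max ler01 ge_min lexx. Qed.

Lemma compact_unit_segment : compact [set: unit_segment].
Proof.
pose h (x : R) : unit_segment := @exist R (fun x => x \in _) _ (clamp01 x).
have ch : continuous h.
  apply: (@continuous_comp_initial _ R R (@set_val _ _) h) => x.
  apply: continuous_max; first exact: cst_continuous.
  by apply: continuous_min; [exact: cst_continuous|exact: id].
have -> : [set: unit_segment] = h @` `[(0 : R), 1]%classic.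
  rewrite eqEsubset; split=> // -[x hx] _; exists x; first by move: hx; rewrite inE.
  have /andP[x0 x1] : 0 <= x <= 1 by have := hx; rewrite inE /= in_itv.
  by apply: eq_sig_hprop => //=; rewrite min_r // max_r.
apply: continuous_compact; last exact: segment_compact.
exact: continuous_subspaceT.
Qed.

Lemma cantor_onto_unit_interval : exists phi : cantor_space -> R,
  [/\ continuous phi, forall z, 0 <= phi z <= 1 &
      forall x, 0 <= x <= 1 -> exists z, phi z = x].
Proof.
have hs : hausdorff_space unit_segment.
  move=> p q pq; apply: eq_sig_hprop => //.
  apply: Rhausdorff => A B pA qB.
  have cval := @initial_continuous unit_segment R set_val.
  have [y [yA yB]] := pq _ _ (cval p A pA) (cval q B qB).
  by exists (set_val y).
have [phi cphi] := @cantor_surj R unit_segment compact_unit_segment hs.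
exists (fun z => set_val (phi z)); split.
- move=> z; apply: (@continuous_comp cantor_space unit_segment R phi (@set_val _ _)).
    exact: cphi.
  exact: (@initial_continuous unit_segment R set_val).
- by move=> z; have := set_valP (phi z); rewrite /= in_itv.
move=> x x01.
have hx : x \in (`[(0 : R), 1]%classic) by rewrite inE /= in_itv.
have [z _ hz] := @surj _ _ _ _ phi (@exist R (fun x => x \in _) x hx : unit_segment) I.
by exists z; rewrite hz.
Qed.
End unit_interval.

Section surjection.
Context {R : realType}.
Local Open Scope complex_scope.
Let Cfield : numFieldType := R[i].

(** The square [0, 1] ^ 2 is mapped onto [-1, 1] ^ 2 by an affine map, then
  retracted radially onto the disc. *)
Definition disc_of_square (x y : R) : R[i] :=
  ((2 * x - 1) / Num.max 1 (normc ((2 * x - 1) +i* (2 * y - 1)))) +i*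
  ((2 * y - 1) / Num.max 1 (normc ((2 * x - 1) +i* (2 * y - 1)))).

Lemma disc_of_square_le1 x y : normc (disc_of_square x y) <= 1.
Proof.
rewrite /disc_of_square; set w := (2 * x - 1) +i* (2 * y - 1); set m := Num.max 1 (normc w).
have m0 : 0 < m by rewrite lt_max ltr01.
have -> : ((2 * x - 1) / m) +i* ((2 * y - 1) / m) = w * (m^-1)%:C.
  by rewrite /w; apply/eqP; rewrite eq_complex /= !mulr0 subr0 add0r !eqxx.
rewrite normcM normc_real gtr0_norm ?invr_gt0 // ler_pdivrMr // mul1r.
by rewrite le_max lexx orbT.
Qed.

Definition square_retraction (x y : R) : unit_disc R := UnitDisc (disc_of_square_le1 x y).

Lemma square_retraction_continuous (T : topologicalType) (u v : T -> R) :
  continuous u -> continuous v -> continuous (fun t => square_retraction (u t) (v t)).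
Proof.
move=> cu cv.
apply: (@continuous_comp_initial (unit_disc R) T Cfield (@disc_val R)).
have ca (a : T -> R) : continuous a -> continuous (fun t => 2 * a t - 1).
  by move=> c t; apply: cvgB; [apply: cvgM; [exact: cvg_cst|exact: c]|exact: cvg_cst].
have cm : continuous (fun t => Num.max 1 (normc ((2 * u t - 1) +i* (2 * v t - 1)))).
  move=> t; apply: (@continuous_max R T (fun=> 1) (fun t => normc ((2 * u t - 1) +i* (2 * v t - 1)))).
    exact: cvg_cst.
  apply: (@continuous_comp _ R R (fun t => (2 * u t - 1) ^+ 2 + (2 * v t - 1) ^+ 2) Num.sqrt).
    by apply: cvgD; rewrite /=; under eq_fun do rewrite expr2; apply: cvgM; apply: ca.
  exact: sqrt_continuous.
have cd (a : T -> R) : continuous a -> continuous (fun t => (2 * a t - 1) /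
    Num.max 1 (normc ((2 * u t - 1) +i* (2 * v t - 1)))).
  move=> c t; apply: cvgM; first exact: ca.
  by apply: cvgV; [rewrite gt_eqF // lt_max ltr01|exact: cm].
exact: (continuous_complex (cd u cu) (cd v cv)).
Qed.

Lemma square_retraction_surj (z : unit_disc R) :
  square_retraction ((complex.Re (disc_val z) + 1) / 2) ((complex.Im (disc_val z) + 1) / 2) = z.
Proof.
apply: val_inj => /=; case: z => -[a b] /= h.
have e (c : R) : 2 * ((c + 1) / 2) - 1 = c by field.
by rewrite /disc_of_square !e max_l // !divr1.
Qed.

(** The Cantor space is a countable product of copies of itself.  The copies
  are indexed by a coordinate of the sequence and a choice of real or
  imaginary part. *)
Definition cantor_slice (z : cantor_space) (kb : int * bool) : cantor_space :=
  fun j => z (pickle (kb, j)).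

Lemma cantor_slice_continuous kb : continuous (cantor_slice^~ kb).
Proof.
move=> z; apply/cvg_sup => j.
apply: (@continuous_comp_initial _ cantor_space bool (fun x : nat -> bool => x j)).
exact: (@proj_continuous nat (fun _ => bool) (pickle (kb, j))).
Qed.

(** The surjection has two uses: it gives the compactness of the sequence
  space, and it transports measures from the Cantor space, where a measure is
  determined by the masses of finite words. *)
Lemma cantor_onto_sequence_space : exists2 Phi : cantor_space -> sequence_space R,
  continuous Phi & forall x, exists z, Phi z = x.
Proof.
have [phi [cphi phi01 phisurj]] := @cantor_onto_unit_interval R.
exists (fun z k => square_retraction (phi (cantor_slice z (k, false))) (phi (cantor_slice z (k, true)))).
  apply: continuous_sequence_space => k; apply: square_retraction_continuous => z.
    by apply: continuous_comp; [exact: cantor_slice_continuous|exact: cphi].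
  by apply: continuous_comp; [exact: cantor_slice_continuous|exact: cphi].
move=> x.
have ex (kb : int * bool) : exists c, phi c =
    ((if kb.2 then complex.Im (disc_val (x kb.1)) else complex.Re (disc_val (x kb.1))) + 1) / 2.
  apply: phisurj.
  have h1 := le_trans (normr_Re_le _) (disc_valP (x kb.1)).
  have h2 := le_trans (normr_Im_le _) (disc_valP (x kb.1)).
  move: h1 h2; rewrite !ler_norml => /andP[? ?] /andP[? ?].
  by case: ifP => _; apply/andP; split; lra.
pose c kb := projT1 (cid (ex kb)).
have cP kb : phi (c kb) = _ := projT2 (cid (ex kb)).
pose z : cantor_space := fun n =>
  if @unpickle ((int * bool) * nat)%type n is Some (kb, j) then c kb j else false.
exists z; apply/funext => k.
have sl kb : cantor_slice z kb = c kb.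
  by apply/funext => j; rewrite /cantor_slice /z pickleK.
by rewrite !sl !cP /= square_retraction_surj.
Qed.

Lemma compact_sequence_space : compact [set: sequence_space R].
Proof.
have [Phi cPhi surjPhi] := cantor_onto_sequence_space.
have -> : [set: sequence_space R] = Phi @` [set: cantor_space].
  by rewrite eqEsubset; split=> // x _; have [z <-] := surjPhi x; exists z.
apply: continuous_compact; last exact: cantor_space_compact.
exact: continuous_subspaceT.
Qed.

Lemma continuous_bounded (F : sequence_space R -> R) : continuous F ->
  exists2 M : R, 0 < M & forall x, `|F x| <= M.
Proof.
move=> cF.
have cpt : compact (F @` [set: sequence_space R]).
  by apply: continuous_compact; [exact: continuous_subspaceT|exact: compact_sequence_space].
have [M [_ hM]] := compact_bounded cpt.
exists (`|M| + 1); first by rewrite ltr_wpDl.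
move=> x; apply: (hM (`|M| + 1)); last by exists x.
by rewrite (le_lt_trans (ler_norm M)) // ltrDl.
Qed.

End surjection.

(** * Frequencies of finite words *)

Section cantor.

(** Otherwise there are points agreeing with z on longer and longer prefixes and
  lying outside U, and they converge to z. *)
Lemma nbhs_cantor_cylinder (z : cantor_space) (U : set cantor_space) : nbhs z U ->
  exists n, forall z', mkseq z' n = mkseq z n -> U z'.
Proof.
move=> zU; apply/not_existsP => h.
have {}h n : exists z' : cantor_space, mkseq z' n = mkseq z n /\ ~ U z'.
  by have /existsNP[z' /not_implyP[? ?]] := h n; exists z'.
pose y n := projT1 (cid (h n)).
have yP n : mkseq (y n) n = mkseq z n /\ ~ U (y n) := projT2 (cid (h n)).
have cy : y @ \oo --> z.
  apply/pointwise_cvgP => i A zA; exists i.+1 => // n /= ni.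
  have [e _] := yP n.
  have -> : y n i = z i.
    by rewrite -(nth_mkseq false (y n) ni) e nth_mkseq.
  exact: nbhs_singleton.
have [n _ /(_ n (leqnn n)) /=] := cy _ zU.
by have [_] := yP n.
Qed.

Lemma nbhs_cylinder (z : cantor_space) n : nbhs z [set z' : cantor_space | mkseq z' n = mkseq z n].
Proof.
elim: n => [|n IH]; first by apply: filterS filterT => z' _.
have hn : nbhs z [set z' : cantor_space | z' n = z n].
  have := @proj_continuous nat (fun _ => bool) n z [set z n].
  by apply; rewrite nbhsE; exists [set z n] => //; split => //; exact: discrete_open.
apply: filterS (filterI IH hn) => z' [/= h1 h2].
by rewrite /mkseq -addn1 iotaD !map_cat -!/(mkseq _ _) h1 /= h2.
Qed.

Context {R : realType}.

Lemma cantor_uniformly_continuous (phi : cantor_space -> R) (e : R) : continuous phi -> 0 < e ->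
  exists n, forall z z', mkseq z n = mkseq z' n -> `|phi z - phi z'| <= e.
Proof.
move=> cphi e0.
have /compact_near_coveringP hc := cantor_space_compact.
have [] := hc nat \oo (fun n z => forall z', mkseq z n = mkseq z' n -> `|phi z - phi z'| <= e).
  move=> z0 _.
  have e2 : 0 < e / 2 by rewrite divr_gt0.
  have hU : nbhs z0 [set z | `|phi z0 - phi z| < e / 2].
    exact: (@cvgr_dist_lt _ _ _ _ _ phi (phi z0) (cphi z0) _ e2).
  have [n hn] := nbhs_cantor_cylinder hU.
  exists ([set z : cantor_space | mkseq z n = mkseq z0 n], [set m | (n <= m)%N]).
    by split=> /=; [exact: nbhs_cylinder|exists n].
  move=> [z m] [/= zn nm] z' zz'.
  have h1 := hn _ zn.
  have h2 : `|phi z0 - phi z'| < e / 2.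
    apply: hn; rewrite -zn.
    have := congr1 (take n) zz'.
    by rewrite /mkseq -!map_take !take_iota (minn_idPl nm).
  by rewrite -(subrK (phi z0) (phi z)) -addrA (le_trans (ler_normD _ _)) // distrC; move: h1 h2 => /=; lra.
move=> n _ hn; exists n => z z'; exact: (hn n (leqnn n) z I).
Qed.
End cantor.

Lemma nbhs_ptws_finite (R : realType) (P : {ptws seq bool -> R}) (m : nat) (e : R) : 0 < e ->
  nbhs P [set g : {ptws seq bool -> R} | forall w, (pickle w < m)%N -> `|P w - g w| < e].
Proof.
move=> e0; elim: m => [|m IH].
  by rewrite (_ : [set _ | _] = setT); [exact: filterT|rewrite eqEsubset; split].
case E : (@unpickle (seq bool) m) => [v|].
  have hv : nbhs P [set g : {ptws seq bool -> R} | `|P v - g v| < e].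
    have cv := @proj_continuous (seq bool) (fun _ => R) v P.
    exact: (@cvgr_dist_lt _ _ _ _ (nbhs_filter P) _ _ cv _ e0).
  apply: filterS (filterI IH hv) => g [hg1 hg2] w; rewrite ltnS leq_eqVlt.
  by move=> /orP[/eqP ew|]; [move: E; rewrite -ew pickleK => -[->]|exact: hg1].
apply: filterS IH => g hg w; rewrite ltnS leq_eqVlt => /orP[/eqP ew|]; last exact: hg.
by move: E; rewrite -ew pickleK.
Qed.

Section frequencies.
Context {R : realType}.
Variable c : nat -> cantor_space.

Definition in_cylinder (z : nat -> bool) (w : seq bool) : bool := mkseq z (size w) == w.

Lemma in_cylinder_split z w :
  (in_cylinder z w : nat) = (in_cylinder z (rcons w false) + in_cylinder z (rcons w true))%N.
Proof.
rewrite /in_cylinder !size_rcons !mkseqS !eqseq_rcons.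
by case: eqP => _ //=; case: (z _).
Qed.

Definition word_frequency (N : nat) : seq bool -> R :=
  fun w => N%:R^-1 * \sum_(1 <= n < N.+1) (in_cylinder (c n) w)%:R.

Lemma word_frequency_itv N w : 0 <= word_frequency N w <= 1.
Proof.
rewrite mulr_ge0 ?invr_ge0 ?sumr_ge0 //=.
case: N => [|N]; first by rewrite /word_frequency big_geq // mulr0.
rewrite ler_pdivrMl ?ltr0n // mulr1.
have -> : N.+1%:R = \sum_(1 <= n < N.+2) 1 :> R by rewrite sumr_const_nat subn1.
by apply: ler_sum => n _; rewrite lern1 leq_b1.
Qed.

Lemma word_frequency_split N w :
  word_frequency N w = word_frequency N (rcons w false) + word_frequency N (rcons w true).
Proof.
rewrite /word_frequency -mulrDr -big_split /=; congr (_ * _); apply: eq_bigr => n _.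
by rewrite in_cylinder_split natrD.
Qed.

Lemma word_frequency_nil N : (0 < N)%N -> word_frequency N [::] = 1.
Proof.
move=> N0; rewrite /word_frequency /in_cylinder /= sumr_const_nat subn1 /=.
by rewrite mulVf // pnatr_eq0 -lt0n.
Qed.

(** The frequencies are points of a product of copies of [0, 1], which is
  compact by Tychonoff's theorem; an accumulation point is the limit of
  a subsequence because there are only countably many words. *)
Lemma word_frequency_cvg : exists (N_ : nat -> nat) (P : seq bool -> R),
  [/\ forall k, (0 < N_ k)%N, {homo N_ : j k / (j < k)%N} &
      forall w, (fun k => word_frequency (N_ k) w) @ \oo --> P w].
Proof.
have cpt := @tychonoff (seq bool) (fun _ => R) (fun _ => `[0, 1]%classic) (fun _ => @segment_compact R 0 1).
have [P [_ hP]] := cpt (word_frequency @ \oo) _ (@filterE _ _ _ _ (fun N w => word_frequency_itv N w)).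
have pick (k N0 : nat) : exists N, (N0 < N)%N /\
    forall w, (pickle w < k)%N -> `|P w - word_frequency N w| < k.+1%:R^-1.
  have e0 : 0 < k.+1%:R^-1 :> R by rewrite invr_gt0.
  have nb := nbhs_ptws_finite (P : {ptws seq bool -> R}) k e0.
  have hN : (word_frequency @ \oo) (word_frequency @` [set N | (N0 < N)%N]).
    by exists N0.+1 => // N /= hN; exists N.
  have [g [[N /= N0N <-] hg]] := hP _ _ hN nb.
  by exists N.
pose next k N0 := projT1 (cid (pick k N0)).
have nextP k N0 := projT2 (cid (pick k N0)).
pose N_ := fix N_ k := if k is k'.+1 then next k (N_ k') else next 0%N 0%N.
have hN k : (N_ k < N_ k.+1)%N by have [] := nextP k.+1 (N_ k).
have N0 k : (0 < N_ k)%N.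
  elim: k => [|k IH]; first by have [] := nextP 0%N 0%N.
  exact: leq_trans IH (ltnW (hN k)).
exists N_, P; split=> //.
  by apply: homo_ltn => // y x z; exact: ltn_trans.
move=> w.
have key j : (pickle w < j)%N -> `|P w - word_frequency (N_ j) w| < j.+1%:R^-1.
  by case: j => // j jw; have [_] := nextP j.+1 (N_ j); apply.
apply/cvgrPdist_lt => e e0; near=> k.
have kw : (pickle w < k)%N by near: k; exact: nbhs_infty_gt.
have ke : k.+1%:R^-1 < e by near: k; exact: near_infty_natSinv_lt (PosNum e0).
exact: lt_trans (key k kw) ke.
Unshelve. all: by end_near.
Qed.

End frequencies.

(** * A measure on the Cantor space with given word masses *)

Section unit_lebesgue.
Context {R : realType}.

Definition unit_lebesgue : set _ -> \bar R :=
  mrestr lebesgue_measure (measurable_itv `[(0 : R), 1[).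

HB.instance Definition _ := Measure.on unit_lebesgue.

Lemma unit_lebesgue_setT : unit_lebesgue setT = 1%E.
Proof.
by rewrite /unit_lebesgue /mrestr setTI lebesgue_measure_itv /= lte_fin ltr01 oppr0 adde0.
Qed.

HB.instance Definition _ := Measure_isProbability.Build _ _ _ unit_lebesgue unit_lebesgue_setT.

Variable P : seq bool -> R.
Hypothesis P1 : P [::] = 1.
Hypothesis P0 : forall w, 0 <= P w.
Hypothesis Psplit : forall w, P w = P (rcons w false) + P (rcons w true).

(** The word w receives the interval of length P w that begins at the total mass
  of the words of the same length preceding w in lexicographic order.  The
  argument u is the prefix already read. *)
Fixpoint offset_rec (u w : seq bool) : R :=
  if w is b :: w' then (if b then P (rcons u false) else 0) + offset_rec (rcons u b) w' else 0.

Definition offset w := offset_rec [::] w.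

Lemma offset_rcons w b : offset (rcons w b) = offset w + (if b then P (rcons w false) else 0).
Proof.
rewrite /offset; have : forall u, offset_rec u (rcons w b) =
   offset_rec u w + (if b then P (rcons (u ++ w) false) else 0).
  elim: w => [|a w IH] u /=; first by rewrite addr0 add0r cats0.
  by rewrite IH addrA cat_rcons.
by move=> ->.
Qed.

Lemma offset_bounds w : 0 <= offset w /\ offset w + P w <= 1.
Proof.
elim/last_ind: w => [|w b [h0 h1]]; first by rewrite /offset /= P1 add0r.
have := Psplit w; have := P0 (rcons w false); have := P0 (rcons w true).
rewrite offset_rcons; case: b => a1 a2 a3; split; lra.
Qed.

(** The word of length n whose interval contains s, found by successive
  subdivision.  Reading off all the prefixes maps [0, 1[ to the Cantor space,
  and pushes Lebesgue measure to the measure with masses P. *)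
Fixpoint prefix_at (s : R) (n : nat) : seq bool :=
  if n is n'.+1 then
    let w := prefix_at s n' in rcons w (offset w + P (rcons w false) <= s)
  else [::].

Definition point_at (s : R) : cantor_space :=
  fun n => offset (prefix_at s n) + P (rcons (prefix_at s n) false) <= s.

Lemma size_prefix_at s n : size (prefix_at s n) = n.
Proof. by elim: n => //= n IH; rewrite size_rcons IH. Qed.

Lemma mkseq_point_at s n : mkseq (point_at s) n = prefix_at s n.
Proof. by elim: n => //= n IH; rewrite mkseqS IH. Qed.

Lemma prefix_at_itv s w : 0 <= s < 1 ->
  (prefix_at s (size w) == w) = (offset w <= s < offset w + P w).
Proof.
move=> s01; elim/last_ind: w => [|w b IH]; first by rewrite /= /offset /= P1 add0r s01.
rewrite size_rcons /= eqseq_rcons offset_rcons.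
have := Psplit w; have := P0 (rcons w false); have := P0 (rcons w true).
case: eqP IH => [->|_] /esym IH a1 a2 a3.
  move/andP: IH => [h1 h2].
  case: (leP (offset w + P (rcons w false)) s) => h; case: b => /=; apply/esym.
  - by apply/andP; split; lra.
  - by apply/negbTE/negP => /andP[]; lra.
  - by apply/negbTE/negP => /andP[]; lra.
  - by apply/andP; split; lra.
apply/esym/negbTE/negP => /andP[h1 h2].
move/negbT/negP: IH; apply; apply/andP; split.
  by move: h1; case: b {h2} => h1; lra.
by move: h2; case: b {h1} => h2; lra.
Qed.

Lemma measurable_prefix_at n w : measurable [set s : R | prefix_at s n = w].
Proof.
elim: n w => [|n IH] w /=.
  case: w => [|b w].
    by rewrite (_ : [set _ | _] = setT) // eqEsubset; split.
  by rewrite (_ : [set _ | _] = set0) // eqEsubset; split.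
case/lastP: w => [|w b].
  rewrite (_ : [set _ | _] = set0) // eqEsubset; split=> // s /= /(congr1 size).
  by rewrite size_rcons.
rewrite (_ : [set _ | _] = [set s | prefix_at s n = w] `&`
   [set s : R | (offset w + P (rcons w false) <= s) = b]).
  apply: measurableI => //; case: b.
    rewrite (_ : [set _ | _] = `[offset w + P (rcons w false), +oo[%classic) //.
    by rewrite eqEsubset; split=> s /=; rewrite in_itv /= andbT.
  rewrite (_ : [set _ | _] = `]-oo, offset w + P (rcons w false)[%classic) //.
  by rewrite eqEsubset; split=> s /=; rewrite in_itv /= ltNge; [move=> ->|move/negbTE].
rewrite eqEsubset; split=> s /=.
  by move=> /eqP; rewrite eqseq_rcons => /andP[/eqP e /eqP <-]; rewrite e.
by move=> [-> ->].
Qed.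

Lemma unit_lebesgue_prefix w : unit_lebesgue [set s : R | prefix_at s (size w) = w] = (P w)%:E.
Proof.
have [h0 h1] := offset_bounds w.
rewrite /unit_lebesgue /mrestr.
rewrite (_ : _ `&` _ = `[offset w, offset w + P w[%classic).
  rewrite lebesgue_measure_itv /= lte_fin ltrDl.
  have := P0 w; rewrite le_eqVlt => /orP[/eqP <-|Pw]; first by rewrite ltxx.
  by rewrite Pw EFinD addeAC EFinN subee // add0e.
rewrite eqEsubset; split=> s /=; rewrite !in_itv /=.
  by move=> [/eqP h s01]; rewrite -prefix_at_itv.
move=> h; have s01 : 0 <= s < 1 by move: h => /andP[? ?]; apply/andP; split; lra.
by split=> //; apply/eqP; rewrite prefix_at_itv.
Qed.

Lemma measurable_preimage_point_at (V : set cantor_space) : open V ->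
  measurable (point_at @^-1` V).
Proof.
move=> oV.
pose A n : set R := if @unpickle (seq bool) n is Some w then
   (if `[< forall z : cantor_space, mkseq z (size w) = w -> V z >]
    then [set s | prefix_at s (size w) = w] else set0) else set0.
rewrite (_ : _ @^-1` _ = \bigcup_n A n).
  apply: bigcupT_measurable => n; rewrite /A; case: unpickle => [w|//].
  by case: ifP => // _; exact: measurable_prefix_at.
rewrite eqEsubset; split=> s /=.
  move=> Vs; have [n hn] := nbhs_cantor_cylinder (open_nbhs_nbhs (conj oV Vs)).
  exists (pickle (prefix_at s n)) => //; rewrite /A pickleK size_prefix_at.
  rewrite ifT //; apply/asboolP => z hz; apply: hn.
  by rewrite hz mkseq_point_at.
move=> [n _]; rewrite /A; case: unpickle => [w|//]; case: ifP => // /asboolP h /= hs.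
by apply: h; rewrite mkseq_point_at.
Qed.

End unit_lebesgue.

(** * Expectations of bounded functions *)

Section bounded_measurable.
Context {R : realType} d (T : measurableType d).

Definition bounded_measurable (F : T -> R) :=
  measurable_fun setT F /\ exists M, forall x, `|F x| <= M.

Lemma bounded_measurable_cst (a : R) : bounded_measurable (fun=> a).
Proof. by split; [exact: measurable_cst|exists `|a|]. Qed.

Lemma bounded_measurableD F G : bounded_measurable F -> bounded_measurable G ->
  bounded_measurable (fun x => F x + G x).
Proof.
move=> [mF [M hM]] [mG [M' hM']]; split; first exact: measurable_funD.
exists (M + M') => x; exact: le_trans (ler_normD _ _) (lerD (hM x) (hM' x)).
Qed.

Lemma bounded_measurableM F G : bounded_measurable F -> bounded_measurable G ->
  bounded_measurable (fun x => F x * G x).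
Proof.
move=> [mF [M hM]] [mG [M' hM']]; split; first exact: measurable_funM.
by exists (M * M') => x; rewrite normrM ler_pM.
Qed.

Lemma bounded_measurableN F : bounded_measurable F -> bounded_measurable (fun x => - F x).
Proof.
move=> [mF [M hM]]; split; first exact: measurableT_comp.
by exists M => x; rewrite normrN.
Qed.

Lemma bounded_measurableB F G : bounded_measurable F -> bounded_measurable G ->
  bounded_measurable (fun x => F x - G x).
Proof. by move=> hF hG; apply: bounded_measurableD => //; exact: bounded_measurableN. Qed.

Lemma bounded_measurable_indic (A : set T) : measurable A -> bounded_measurable \1_A.
Proof.
move=> mA; split; first exact: measurable_indic.
by exists 1 => x; rewrite indicE normr_nat lern1 leq_b1.
Qed.

Lemma bounded_measurable_sum (I : Type) (r : seq I) (F : I -> T -> R) :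
  (forall i, bounded_measurable (F i)) -> bounded_measurable (fun x => \sum_(i <- r) F i x).
Proof.
move=> h; elim: r => [|i r IH].
  by under eq_fun do rewrite big_nil; exact: bounded_measurable_cst.
by under eq_fun do rewrite big_cons; exact: bounded_measurableD.
Qed.

Variable mu : probability T R.

Lemma bounded_measurable_integrable F : bounded_measurable F -> mu.-integrable setT (EFin \o F).
Proof.
move=> [mF [M hM]]; apply: measurable_bounded_integrable => //.
  by apply: (le_lt_trans (probability_le1 _ measurableT)); rewrite ltry.
by exists M; split; [exact: num_real|move=> N MN x _ /=; exact: le_trans (hM x) (ltW MN)].
Qed.

Local Notation Ex F := (Rintegral mu setT F).

Lemma expectD F G : bounded_measurable F -> bounded_measurable G ->
  Ex (fun x => F x + G x) = Ex F + Ex G.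
Proof. by move=> hF hG; rewrite RintegralD //; exact: bounded_measurable_integrable. Qed.

Lemma expectB F G : bounded_measurable F -> bounded_measurable G ->
  Ex (fun x => F x - G x) = Ex F - Ex G.
Proof. by move=> hF hG; rewrite RintegralB //; exact: bounded_measurable_integrable. Qed.

Lemma expectZ a F : bounded_measurable F -> Ex (fun x => a * F x) = a * Ex F.
Proof. by move=> hF; rewrite RintegralZl //; exact: bounded_measurable_integrable. Qed.

Lemma expect_cst (a : R) : Ex (fun=> a) = a.
Proof. by rewrite Rintegral_cst //= probability_setT mulr1. Qed.

Lemma expect_le F G : bounded_measurable F -> bounded_measurable G ->
  (forall x, F x <= G x) -> Ex F <= Ex G.
Proof. by move=> hF hG h; apply: le_Rintegral => //; exact: bounded_measurable_integrable. Qed.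

Lemma expect_sum (J : Type) (r : seq J) (F : J -> T -> R) :
  (forall i, bounded_measurable (F i)) ->
  Ex (fun x => \sum_(i <- r) F i x) = \sum_(i <- r) Ex (F i).
Proof.
move=> h; elim: r => [|i r IH].
  by under eq_Rintegral do rewrite big_nil; rewrite expect_cst big_nil.
under eq_Rintegral do rewrite big_cons.
by rewrite expectD // ?IH ?big_cons //; exact: bounded_measurable_sum.
Qed.

Lemma expect_indic (A : set T) : measurable A -> Ex \1_A = fine (mu A).
Proof. by move=> mA; rewrite /Rintegral integral_indic // setIT. Qed.

Lemma expect_dist_le F G (e : R) : bounded_measurable F -> bounded_measurable G ->
  (forall x, `|F x - G x| <= e) -> `|Ex F - Ex G| <= e.
Proof.
move=> hF hG h; rewrite -expectB // ler_norml.
have hB := bounded_measurableB hF hG.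
rewrite -{1}(expect_cst (- e)) -{2}(expect_cst e).
by apply/andP; split; apply: expect_le => //; try exact: bounded_measurable_cst;
  move=> x; have := h x; rewrite ler_norml => /andP[].
Qed.

Lemma bounded_measurable_norm F : bounded_measurable F -> bounded_measurable (fun x => `|F x|).
Proof.
move=> [mF [M hM]]; split; first exact: measurableT_comp.
by exists M => x; rewrite normr_id.
Qed.

Lemma expect_ge0_eq0 F : bounded_measurable F -> (forall x, 0 <= F x) -> Ex F = 0 ->
  {ae mu, forall x, F x = 0}.
Proof.
move=> hF F0 IF.
have mF : measurable_fun setT (EFin \o F) by apply/measurable_EFinP; case: hF.
have : (\int[mu]_x `|(EFin \o F) x| = 0)%E.
  rewrite (eq_integral (EFin \o F)) => [|x _]; last by rewrite /= ger0_norm.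
  have := integrable_fin_num measurableT (bounded_measurable_integrable hF).
  by move=> /fineK <-; move: IF; rewrite /Rintegral => ->.
move/(ae_eq_integral_abs mu measurableT mF); apply: filterS => x /= /(_ I).
by case.
Qed.

End bounded_measurable.

Section weighted_measure.
Context {R : realType}.

Lemma continuous_bounded_measurable (F : sequence_space R -> R) : continuous F ->
  bounded_measurable (F : borel_sequence_space R -> R).
Proof.
move=> cF; split; first exact: continuous_measurable.
by have [M _ hM] := continuous_bounded cF; exists M.
Qed.

Lemma Rintegral_weighted_average c (y : nat -> borel_sequence_space R) N (F : borel_sequence_space R -> R) :
  measurable_fun setT F ->
  Rintegral (weighted_average_measure c (fun n => dirac (y n)) N) setT F =
  weighted_average c (fun n => F (y n)) N.
Proof.
move=> mF.
have key (G : borel_sequence_space R -> R) : measurable_fun setT G -> (forall x, 0 <= G x) ->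
  (\int[weighted_average_measure c (fun n => dirac (y n)) N]_x (G x)%:E =
   (weighted_average c (fun n => G (y n)) N)%:E)%E.
  move=> mG G0; have mG' : measurable_fun setT (EFin \o G) by apply/measurable_EFinP.
  rewrite /weighted_average_measure ge0_integral_mscale //; last by move=> x _; rewrite lee_fin.
  rewrite ge0_integral_measure_sum //; last by move=> x _; rewrite lee_fin.
  rewrite /weighted_average EFinM; congr (_ * _)%E.
  rewrite big_add1 /= big_mkord -sumEFin; apply: eq_bigr => i _.
  rewrite ge0_integral_mscale //; last by move=> x _; rewrite lee_fin.
  by rewrite integral_dirac // diracT mul1e EFinM.
rewrite /Rintegral integralE funerpos funerneg.
have -> : (\int[weighted_average_measure c (fun n => dirac (y n)) N]_x (EFin \o (F^\+)%R) x =
  (weighted_average c (fun n => (F^\+)%R (y n)) N)%:E)%E.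
  by apply: key => //; exact: measurable_funrpos.
have -> : (\int[weighted_average_measure c (fun n => dirac (y n)) N]_x (EFin \o (F^\-)%R) x =
  (weighted_average c (fun n => (F^\-)%R (y n)) N)%:E)%E.
  by apply: key => //; exact: measurable_funrneg.
rewrite -EFinB /= /weighted_average -mulrBr -sumrB; congr (_ * _).
apply: eq_bigr => n _; rewrite -mulrBr; congr (_ * _); rewrite /funrpos /funrneg.
have [h|h] := leP (F (y n)) 0; first by rewrite max_l ?oppr_ge0 //; lra.
by rewrite max_r ?oppr_le0 ?(ltW h) // subr0.
Qed.

End weighted_measure.

(** * Existence of Furstenberg systems *)

Section existence.
Context {R : realType}.

Lemma weighted_average_dist_le c (a b : nat -> R) N (e : R) : (0 < N)%N ->
  (forall n, `|a n - b n| <= e) -> `|weighted_average c a N - weighted_average c b N| <= e.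
Proof.
move=> N0 h; have W0 : 0 < total_weight R c N by exact: lt_le_trans ltr01 (total_weight_ge1 c N0).
rewrite /weighted_average -mulrBr -sumrB normrM ger0_norm ?invr_ge0 ?(ltW W0) //.
rewrite ler_pdivrMl // mulrC /total_weight mulr_sumr.
apply: (le_trans (ler_norm_sum _ _ _)); apply: ler_sum => n _.
by rewrite -mulrBr normrM ger0_norm // [leRHS]mulrC ler_wpM2l.
Qed.

Lemma weighted_average_sum c (I : Type) (r : seq I) (a : I -> R) (b : I -> nat -> R) N :
  weighted_average c (fun n => \sum_(i <- r) a i * b i n) N =
  \sum_(i <- r) a i * weighted_average c (b i) N.
Proof.
rewrite /weighted_average.
under eq_bigr do rewrite mulr_sumr.
rewrite exchange_big mulr_sumr; apply: eq_bigr => i _.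
rewrite mulrCA; congr (_ * _); rewrite mulr_sumr; apply: eq_bigr => n _.
by rewrite mulrCA.
Qed.

Lemma cvg_sum_seq (I : Type) (r : seq I) (u : I -> nat -> R) (l : I -> R) :
  (forall i, u i @ \oo --> l i) ->
  (fun k => \sum_(i <- r) u i k) @ \oo --> \sum_(i <- r) l i.
Proof.
move=> h; elim: r => [|i r IH].
  by rewrite big_nil; under eq_fun do rewrite big_nil; exact: cvg_cst.
by rewrite big_cons; under eq_fun do rewrite big_cons; apply: cvgD.
Qed.

Definition pad (w : seq bool) : cantor_space := nth false w.

Lemma mkseq_pad w : mkseq (pad w) (size w) = w.
Proof. exact: mkseq_nth. Qed.

Variable f : nat -> unit_disc R.

Let x0 : borel_sequence_space R := fun k : int => if k is Posz n then f n else f 0%N.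

(** Lift the orbit of f to the Cantor space, extract limiting frequencies of
  words, and push forward the measure that they define.  A test function on
  the Cantor space is uniformly approximated by functions of a finite prefix,
  whose averages are combinations of word frequencies. *)
Theorem furstenberg_system_exists :
  exists mu : probability (borel_sequence_space R) R, furstenberg_system Cesaro f mu.
Proof.
have [Phi cPhi surjPhi] := @cantor_onto_sequence_space R.
pose c n := projT1 (cid (surjPhi (iter n (@shift_map R) x0))).
have cP n : Phi (c n) = iter n (@shift_map R) x0 := projT2 (cid (surjPhi (iter n (@shift_map R) x0))).
have [N_ [P [N0 hN hP]]] := word_frequency_cvg (R := R) c.
have P0 w : 0 <= P w.
  rewrite -(cvg_lim (@Rhausdorff R) (hP w)); apply: limr_ge; first by apply/cvg_ex; exists (P w).
  apply: nearW => k.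
  by have /andP[] := word_frequency_itv (R := R) c (N_ k) w.
have Psplit w : P w = P (rcons w false) + P (rcons w true).
  have e : (fun k => word_frequency c (N_ k) w : R) =
      (fun k => word_frequency c (N_ k) (rcons w false) + word_frequency c (N_ k) (rcons w true)).
    by apply/funext => k; exact: word_frequency_split.
  have h := hP w; rewrite e in h.
  exact: (cvg_unique (@Rhausdorff R) h (cvgD (hP (rcons w false)) (hP (rcons w true)))).
have P1 : P [::] = 1.
  have e : (fun k => word_frequency c (N_ k) [::] : R) = (fun=> 1).
    by apply/funext => k; exact: word_frequency_nil.
  have h := hP [::]; rewrite e in h.
  exact: (cvg_unique (@Rhausdorff R) h (cvg_cst _)).
pose Z (s : measurableTypeR R) : borel_sequence_space R := Phi (point_at P s).
have mZ : measurable_fun setT Z.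
  apply: (@measurability _ _ (measurableTypeR R) (borel_sequence_space R) setT Z (@open (sequence_space R)) erefl).
  move=> _ [U oU <-]; rewrite setTI; apply: (measurable_preimage_point_at P (V := Phi @^-1` U)).
  by move/continuousP : cPhi; apply.
pose Zm := isMeasurableFun.Build _ _ _ _ Z mZ.
pose ZRV : {mfun _ >-> _} := HB.pack Z Zm.
pose mu := distribution (@unit_lebesgue R) ZRV.
exists mu, N_; split => //; exists x0 => // F cF.
have mF := continuous_measurable cF.
have bF := continuous_bounded_measurable cF.
have -> : (fun k => Rintegral (weighted_average_measure Cesaro (fun n => dirac (iter n (@shift_map R) x0)) (N_ k)) setT F) =
   (fun k => weighted_average Cesaro (fun n => F (Phi (c n))) (N_ k)).
  by apply/funext => k; rewrite Rintegral_weighted_average //; congr (weighted_average _ _ _);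
     apply/funext => n; rewrite cP.
have -> : Rintegral mu setT F = Rintegral (@unit_lebesgue R) setT (fun s => F (Z s)).
  have bFZ : bounded_measurable (fun s : measurableTypeR R => F (Z s)).
    by case: bF => _ [M hM]; split; [exact: (measurableT_comp mF mZ)|exists M].
  rewrite /Rintegral integral_distribution //; first by apply/measurable_EFinP.
  exact: bounded_measurable_integrable.
have cphi : continuous (F \o Phi) by move=> z; apply: continuous_comp; [exact: cPhi|exact: cF].
apply/cvgrPdist_lt => e e0.
have e4 : 0 < e / 4 by rewrite divr_gt0.
have [n hn] := cantor_uniformly_continuous cphi e4.
pose a (w : n.-tuple bool) : R := F (Phi (pad w)).
pose G (z : cantor_space) : R := \sum_(w : n.-tuple bool) a w * (in_cylinder z w)%:R.
have hG z : `|F (Phi z) - G z| <= e / 4.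
  have sz : size (mkseq z n) == n by rewrite size_mkseq.
  have -> : G z = F (Phi (pad (mkseq z n))).
    rewrite /G (bigD1 (Tuple sz)) //= big1 => [|w wz].
      by rewrite addr0 /in_cylinder /= size_mkseq eqxx mulr1.
    rewrite /in_cylinder size_tuple (_ : _ == _ = false) ?mulr0 //.
    apply: contraNF wz => /eqP e1; apply/eqP/val_inj; exact: esym.
  apply: hn; have := mkseq_pad (mkseq z n); rewrite size_mkseq => ->//.
pose G' (s : measurableTypeR R) := \sum_(w : n.-tuple bool) a w * \1_([set s : measurableTypeR R | prefix_at P s n = w]) s.
have GG' s : G (point_at P s) = G' s.
  apply: eq_bigr => w _; rewrite /in_cylinder size_tuple mkseq_point_at indicE.
  by congr (_ * (nat_of_bool _)%:R); apply/eqP/idP; rewrite inE.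
have bG' w : bounded_measurable (fun s : measurableTypeR R => a w * \1_([set s : measurableTypeR R | prefix_at P s n = w]) s).
  apply: bounded_measurableM; first exact: bounded_measurable_cst.
  by apply: bounded_measurable_indic; exact: measurable_prefix_at.
have IG' : Rintegral (@unit_lebesgue R) setT G' = \sum_(w : n.-tuple bool) a w * P w.
  rewrite expect_sum //; apply: eq_bigr => w _.
  rewrite expectZ; last by apply: bounded_measurable_indic; exact: measurable_prefix_at.
  congr (_ * _); rewrite expect_indic; last exact: measurable_prefix_at.
  by have /(congr1 fine) := unit_lebesgue_prefix P1 P0 Psplit w; rewrite size_tuple.
have bFZ : bounded_measurable (fun s : measurableTypeR R => F (Z s)).
  by case: bF => _ [M hM]; split; [exact: (measurableT_comp mF mZ)|exists M].
have h1 : `|Rintegral (@unit_lebesgue R) setT (fun s => F (Z s)) - \sum_(w : n.-tuple bool) a w * P w| <= e / 4.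
  rewrite -IG'; apply: expect_dist_le => //; first exact: bounded_measurable_sum.
  by move=> s; rewrite -GG'; exact: hG.
have cS : (fun k => \sum_(w : n.-tuple bool) a w * word_frequency c (N_ k) w) @ \oo -->
    \sum_(w : n.-tuple bool) a w * P w.
  apply: cvg_sum_seq => w; apply: cvgM; [exact: cvg_cst|exact: hP].
near=> k.
have h2 : `|weighted_average Cesaro (fun m => F (Phi (c m))) (N_ k) -
    \sum_(w : n.-tuple bool) a w * word_frequency c (N_ k) w| <= e / 4.
  have -> : \sum_(w : n.-tuple bool) a w * word_frequency c (N_ k) w =
     weighted_average Cesaro (fun m => G (c m)) (N_ k).
    rewrite /G weighted_average_sum; apply: eq_bigr => w _; congr (_ * _).
    rewrite /word_frequency /weighted_average total_weight_Cesaro; congr (_ * _).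
    by apply: eq_bigr => m _; rewrite mul1r.
  by apply: weighted_average_dist_le => // m; exact: hG.
have h3 : `|\sum_(w : n.-tuple bool) a w * P w - \sum_(w : n.-tuple bool) a w * word_frequency c (N_ k) w| < e / 4.
  by near: k; exact: (cvgr_dist_lt _ _ cS).
move: h1 h2 h3; set i1 := Rintegral _ _ _; set i2 := weighted_average _ _ _.
set s1 := \sum_(w : _) _; set s2 := \sum_(w : _) _.
rewrite !ler_norml !ltr_norml => /andP[? ?] /andP[? ?] /andP[? ?].
by apply/andP; split; lra.
Unshelve. all: by end_near.
Qed.

End existence.

(** * Almost everywhere summability *)

Section summability.
Context {R : realType}.

Lemma geometric_half_sum n : \sum_(0 <= j < n) 2^-1 ^+ j <= 2 :> R.
Proof.
suff -> : \sum_(0 <= j < n) 2^-1 ^+ j = 2 - 2 * 2^-1 ^+ n :> R.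
  by rewrite lerBlDr lerDl mulr_ge0 // exprn_ge0 // invr_ge0.
elim: n => [|n IH]; first by rewrite big_geq // expr0; lra.
by rewrite big_nat_recr //= IH exprS; field.
Qed.

Lemma cvg_bounded_variation (u : nat -> R) (B : R) :
  (forall n, \sum_(0 <= j < n) `|u j.+1 - u j| <= B) -> cvgn u.
Proof.
move=> h; pose d j := u j.+1 - u j.
have cd : cvgn (series d).
  apply: normed_cvg; apply: nondecreasing_is_cvgn.
    by apply: nondecreasing_series => n _ _ /=.
  by exists B => _ [n _ <-]; exact: h.
have -> : u = (fun n => u 0%N + series d n).
  by apply/funext => n; rewrite /series /= telescope_sumr // subrKC.
by apply: is_cvgD => //; exact: is_cvg_cst.
Qed.

Context d (T : measurableType d) (mu : probability T R).

(** The sum of the U j has a finite integral, hence is finite almost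
  everywhere. *)
Lemma ae_summable (U : nat -> T -> R) (M : R) :
  (forall j, bounded_measurable (U j)) -> (forall j y, 0 <= U j y) ->
  (forall j, Rintegral mu setT (U j) <= M * 2^-1 ^+ j) ->
  {ae mu, forall y, exists B, forall n, \sum_(0 <= j < n) U j y <= B}.
Proof.
move=> bU U0 hM.
have mU j : measurable_fun setT (EFin \o U j) by apply/measurable_EFinP; case: (bU j).
pose S y := (\sum_(j <oo) (U j y)%:E)%E.
have M0 : 0 <= M.
  have I0 : 0 <= Rintegral mu setT (U 0%N) by apply: Rintegral_ge0.
  by have := le_trans I0 (hM 0%N); rewrite expr0 mulr1.
have iS : (\int[mu]_y S y <= (2 * M)%:E)%E.
  rewrite /S integral_nneseries //; last by move=> j y _; rewrite lee_fin.
  apply: lime_le; first by apply: is_cvg_nneseries => j _ _; apply: integral_ge0 => y _; rewrite lee_fin.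
  apply: nearW => n.
  have e j : (\int[mu]_y (U j y)%:E = (Rintegral mu setT (U j))%:E)%E.
    by rewrite /Rintegral fineK //; exact: (integrable_fin_num measurableT (bounded_measurable_integrable mu (bU j))).
  under eq_bigr do rewrite e.
  rewrite sumEFin lee_fin; apply: (@le_trans _ _ (\sum_(0 <= j < n) M * 2^-1 ^+ j)).
    exact: ler_sum.
  by rewrite -mulr_sumr mulrC ler_wpM2r // geometric_half_sum.
have mS : measurable_fun setT S.
  have h := @ge0_emeasurable_sum _ T R setT (fun j y => (U j y)%:E) predT.
  apply: (eq_measurable_fun (fun y => (\sum_(i <oo | i \in predT) (U i y)%:E)%E)) => [y _|].
    by apply: eq_eseriesl => j.
  by apply: h => [j y _ _|j _]; [rewrite lee_fin|exact: mU].
have S0 y : (0 <= S y)%E by apply: nneseries_ge0 => j _ _; rewrite lee_fin.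
have intS : mu.-integrable setT S.
  apply/integrableP; split=> //.
  rewrite (eq_integral S) => [|y _]; last by rewrite gee0_abs.
  by apply: (le_lt_trans iS); rewrite ltry.
have := integrable_ae measurableT intS; apply: filterS => y /(_ I) fS.
exists (fine (S y)) => n; rewrite -lee_fin fineK // -sumEFin.
by apply: nneseries_lim_ge => j _ _; rewrite lee_fin.
Qed.

End summability.

(** * Furstenberg systems: invariance and identity systems *)

Section continuous_real.
Context {R : realType} (T : topologicalType).
Implicit Types u v : T -> R.

Lemma continuous_addr u v : continuous u -> continuous v -> continuous (fun y => u y + v y).
Proof. by move=> cu cv y; exact: (cvgD (cu y) (cv y)). Qed.

Lemma continuous_subr u v : continuous u -> continuous v -> continuous (fun y => u y - v y).
Proof. by move=> cu cv y; exact: (cvgB (cu y) (cv y)). Qed.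

Lemma continuous_mulr u v : continuous u -> continuous v -> continuous (fun y => u y * v y).
Proof. by move=> cu cv y; exact: (cvgM (cu y) (cv y)). Qed.

End continuous_real.

Section shift_systems.
Context {R : realType}.
Local Open Scope complex_scope.
Local Notation X := (borel_sequence_space R).
Local Notation T := (@shift_map R).
Local Notation wt c n := ((weight R c n)%:num).

Lemma iter_shift n (x : X) (k : int) : iter n T x k = x (k + n%:Z).
Proof.
elim: n k => [|n IH] k; first by rewrite addr0.
by rewrite iterS /shift_map IH -addrA -PoszD add1n.
Qed.

(** The integral against the weighted sum of point masses is the weighted
  average along the orbit. *)
Lemma furstenberg_averages c (a : nat -> unit_disc R) (mu : probability X R) :
  furstenberg_system c a mu -> exists N_ x,
    [/\ {homo N_ : j k / (j < k)%N}, extends_sequence x a &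
     forall F : sequence_space R -> R, continuous F ->
       (fun k => weighted_average c (fun n => F (iter n T x)) (N_ k)) @ \oo
         --> Rintegral mu setT F].
Proof.
move=> [N_ [N0 hN [x xa hx]]]; exists N_, x; split=> // F cF.
have h := hx F cF; rewrite (_ : (fun k => weighted_average _ _ _) =
  (fun k => Rintegral (weighted_average_measure c (fun n => dirac (iter n T x)) (N_ k)) setT F)) //.
apply/funext => k; rewrite Rintegral_weighted_average //; exact: continuous_measurable.
Qed.

Lemma continuous_comp_shift (F : sequence_space R -> R) : continuous F -> continuous (F \o T).
Proof. by move=> cF y; apply: continuous_comp; [exact: continuous_shift|exact: cF]. Qed.

Section averages_along.
Variables (c : averaging) (mu : probability X R) (N_ : nat -> nat) (x : X).
Hypothesis hN : {homo N_ : j k / (j < k)%N}.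
Hypothesis hx : forall F : sequence_space R -> R, continuous F ->
  (fun k => weighted_average c (fun n => F (iter n T x)) (N_ k)) @ \oo --> Rintegral mu setT F.

Lemma wsum_real (u : nat -> R) N :
  wsum c (fun n => (u n)%:C) N = (total_weight R c N * weighted_average c u N)%:C.
Proof.
rewrite /weighted_average; case: N => [|N].
  by rewrite /wsum /total_weight !big_geq // mulr0 mulr0.
rewrite mulrA divff ?mul1r; last by rewrite gt_eqF // (lt_le_trans ltr01) // total_weight_ge1.
by rewrite /wsum rmorph_sum /=; apply: eq_bigr => n _; rewrite rmorphM.
Qed.

Lemma wnull_real (u : nat -> R) : wnull c N_ (fun n => (u n)%:C) <->
  (fun k => weighted_average c u (N_ k)) @ \oo --> (0 : R).
Proof.
have NN : \forall k \near \oo, (0 < N_ k)%N := near_subseq hN (nbhs_infty_gt 0).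
split=> [h|h e e0].
  apply/cvgr0Pnorm_le => e e0; near=> k.
  have k0 : (0 < N_ k)%N by near: k.
  have W0 : 0 < total_weight R c (N_ k) by exact: lt_le_trans ltr01 (total_weight_ge1 c k0).
  have : normc (wsum c (fun n => (u n)%:C) (N_ k)) <= e * total_weight R c (N_ k) by near: k; exact: h.
  by rewrite wsum_real normc_real normrM gtr0_norm // mulrC ler_pM2r.
near=> k.
have k0 : (0 < N_ k)%N by near: k.
have W0 : 0 < total_weight R c (N_ k) by exact: lt_le_trans ltr01 (total_weight_ge1 c k0).
rewrite wsum_real normc_real normrM gtr0_norm // mulrC ler_pM2r //.
by near: k; move: h => /cvgr0Pnorm_le; apply.
Unshelve. all: by end_near.
Qed.

(** Invariance for test functions, the form in which it is used, is inherited
  from the averages. *)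
Lemma shift_invariant (F : sequence_space R -> R) : continuous F ->
  Rintegral mu setT (F \o T) = Rintegral mu setT F.
Proof.
move=> cF; have [M M0 hM] := continuous_bounded cF.
pose v n : R[i] := (F (iter n T x) / M)%:C.
have v1 n : normc (v n) <= 1.
  by rewrite normc_real normrM normfV (gtr0_norm M0) ler_pdivrMr // mul1r.
have := wnullZ (M%:C) (wnull_shift c hN v1).
have e n : M%:C * (v n.+1 - v n) = (F (T (iter n T x)) - F (iter n T x))%:C.
  by rewrite /v -rmorphB -rmorphM /= -mulrBl mulrC mulfVK ?gt_eqF.
move=> /(eq_wnull (fun n _ => e n)) /wnull_real h.
have h2 : (fun k => weighted_average c (fun n => (F \o T) (iter n T x)) (N_ k) -
     weighted_average c (fun n => F (iter n T x)) (N_ k)) @ \oo -->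
     Rintegral mu setT (F \o T) - Rintegral mu setT F.
  by apply: cvgB; apply: hx => //; exact: continuous_comp_shift.
have e2 : (fun k => weighted_average c (fun n => (F \o T) (iter n T x)) (N_ k) -
     weighted_average c (fun n => F (iter n T x)) (N_ k)) =
     (fun k => weighted_average c (fun n => F (T (iter n T x)) - F (iter n T x)) (N_ k)).
  apply/funext => k; rewrite /weighted_average -mulrBr -sumrB; congr (_ * _).
  by apply: eq_bigr => n _; rewrite mulrBr.
apply/eqP; rewrite -subr_eq0; apply/eqP.
rewrite -e2 in h; exact: (cvg_unique (@Rhausdorff R) h2 h).
Qed.

Lemma shift_invariant_iter (F : sequence_space R -> R) n : continuous F ->
  Rintegral mu setT (fun y => F (iter n T y)) = Rintegral mu setT F.
Proof.
move=> cF; elim: n F cF => [|n IH] F cF //.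
by rewrite -(shift_invariant cF) -(IH (F \o T)) //; exact: continuous_comp_shift.
Qed.

Lemma continuous_Re_coordinate (k : int) :
  continuous (fun y : sequence_space R => complex.Re (disc_val (y k))).
Proof.
move=> y; apply: (@continuous_comp (sequence_space R) (R[i] : numFieldType) R (fun y => disc_val (y k))).
  exact: continuous_coordinate.
exact: continuous_Re.
Qed.

Lemma continuous_Im_coordinate (k : int) :
  continuous (fun y : sequence_space R => complex.Im (disc_val (y k))).
Proof.
move=> y; apply: (@continuous_comp (sequence_space R) (R[i] : numFieldType) R (fun y => disc_val (y k))).
  exact: continuous_coordinate.
exact: continuous_Im.
Qed.

Lemma continuous_sqnorm (C : sequence_space R -> R[i]) :
  continuous (fun y => complex.Re (C y)) -> continuous (fun y => complex.Im (C y)) ->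
  continuous (fun y => complex.Re (C y) ^+ 2 + complex.Im (C y) ^+ 2).
Proof.
move=> cRe' cIm'; under eq_fun do rewrite !expr2.
exact: continuous_addr (continuous_mulr cRe' cRe') (continuous_mulr cIm' cIm').
Qed.

Lemma normcE (z : R[i]) : normc z = Num.sqrt (complex.Re z ^+ 2 + complex.Im z ^+ 2).
Proof. by case: z. Qed.

Lemma continuous_coordinate_gap (k : int) :
  continuous (fun y : sequence_space R => normc (disc_val (y (k + 1)) - disc_val (y k))).
Proof.
pose C (y : sequence_space R) := disc_val (y (k + 1)) - disc_val (y k).
have cC : continuous (fun y => complex.Re (C y) ^+ 2 + complex.Im (C y) ^+ 2).
  apply: continuous_sqnorm; rewrite /C; under eq_fun do rewrite raddfB /=.
    by apply: continuous_subr; exact: continuous_Re_coordinate.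
  by apply: continuous_subr; exact: continuous_Im_coordinate.
under eq_fun do rewrite normcE.
move=> y; apply: (@continuous_comp _ R R (fun y => complex.Re (C y) ^+ 2 + complex.Im (C y) ^+ 2) Num.sqrt).
  exact: cC.
exact: sqrt_continuous.
Qed.

(** The distance of the coordinates 0 and 1 is a test function whose averages
  tend to 0.  Invariance carries the conclusion to the coordinates k and k + 1
  for every integer k, negative ones included. *)
Lemma identity_of_small_gaps :
  (fun k => weighted_average c (fun n => normc (disc_val (x n.+1) - disc_val (x n))) (N_ k)) @ \oo --> (0 : R) ->
  identity_system T mu.
Proof.
move=> h0.
pose gap k (y : sequence_space R) := normc (disc_val (y (k + 1)) - disc_val (y k)).
have cg k : continuous (gap k) by exact: continuous_coordinate_gap.
have I0 : Rintegral mu setT (gap 0) = 0.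
  apply: (cvg_unique (@Rhausdorff R) (hx (cg 0))).
  rewrite (_ : (fun k => weighted_average c (fun n => gap 0 (iter n T x)) (N_ k)) =
    (fun k => weighted_average c (fun n => normc (disc_val (x n.+1) - disc_val (x n))) (N_ k))) //.
  apply/funext => k; congr (weighted_average _ _ _); apply/funext => n; rewrite /gap !iter_shift; congr (normc (disc_val (x _) - disc_val (x _))); lia.
have Ik k : Rintegral mu setT (gap k) = 0.
  case: k => n.
    rewrite -I0 -(shift_invariant_iter n (cg 0)); congr (Rintegral _ _ _).
    apply/funext => y; rewrite /gap !iter_shift.
    by congr (normc (disc_val (y _) - disc_val (y _))); lia.
  rewrite -I0 -(shift_invariant_iter n.+1 (cg (Negz n))); congr (Rintegral _ _ _).
  apply/funext => y; rewrite /gap !iter_shift.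
  by congr (normc (disc_val (y _) - disc_val (y _))); rewrite NegzE; lia.
have ae1 k : {ae mu, forall y : X, gap k y = 0}.
  by apply: expect_ge0_eq0 => //; [exact: continuous_bounded_measurable|move=> y; exact: normc_ge0].
have : {ae mu, forall y : X, forall n : nat, if @unpickle int n is Some k then gap k y = 0 else True}.
  apply: ae_foralln => n; case: unpickle => [k|]; [exact: ae1|exact: aeW].
apply: filterS => y hy; apply/funext => k; apply/val_inj => /=.
have := hy (pickle k); rewrite pickleK => /eq0_normc/eqP.
by rewrite subr_eq0 => /eqP.
Qed.

End averages_along.

(** An eigenfunction satisfies g = e(alpha) g almost everywhere, so it vanishes
  unless alpha = 0; for alpha = 0 the constant 1 is an eigenfunction. *)
Lemma identity_trivial_rational_spectrum (mu : probability X R) :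
  identity_system T mu -> trivial_rational_spectrum T mu.
Proof.
move=> hid; rewrite /trivial_rational_spectrum eqEsubset; split=> alpha.
  move=> [[/andP[a0 a1] [g [_ gn0 hg]]] _] /=.
  apply/eqP/negPn/negP => an0; apply: gn0.
  apply: filterS2 hid hg => y hy; rewrite hy => /eqP; rewrite -subr_eq0 -[X in X - _]mul1r -mulrBl.
  rewrite mulf_eq0 subr_eq0 => /orP[|/eqP //]; rewrite eq_sym => /negPn/negP[].
  have pi0 := pi_gt0 R.
  have a00 : 0 < alpha by rewrite lt_def an0.
  by apply: cis_neq1; apply/andP; split; nra.
move=> /= ->; split; last by exists 0; rewrite // rmorph0.
split; first by rewrite lexx ltr01.
exists (fun=> 1); split.
- split; try exact: measurable_cst.
  rewrite (eq_integral (cst 1%E)) => [|y _]; last by rewrite normc1 expr1n.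
  by rewrite integral_cst //= mul1e [mu _]probability_setT ltry.
- move=> [A [mA A0 hA]].
  have : (mu setT <= mu A)%E by apply: le_measure; rewrite ?inE // => y _; apply: hA => /= /eqP; rewrite oner_eq0.
  by rewrite A0 probability_setT lee_fin ler10.
by apply: aeW => y; rewrite /e2pi mulr0 cis0 mulr1.
Qed.

End shift_systems.

(** * The mean ergodic theorem at a frequency that is not an eigenvalue *)

Section limits.
Context {R : realType}.

(** Clipping makes the candidate eigenfunction bounded at every point, although
  convergence holds only almost everywhere. *)
Definition clip (r : R) := Num.max (-1) (Num.min 1 r).

Lemma normr_clip r : `|clip r| <= 1.
Proof.
rewrite /clip ler_norml le_max lexx /= ge_max ge_min lexx /= andbT; lra.
Qed.

Lemma clip_id r : `|r| <= 1 -> clip r = r.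
Proof.
by rewrite ler_norml /clip => /andP[r0 r1]; rewrite (min_idPr r1) (max_idPr r0).
Qed.

Lemma clip_limn_sup (u : nat -> R) (l : R) :
  (forall n, `|u n| <= 1) -> u @ \oo --> l -> clip (limn_sup u) = l.
Proof.
move=> u1 ul.
have -> : limn_sup u = l.
  rewrite (@cvg_limn_supE R u); last by apply/cvg_ex; exists l.
  exact: (cvg_lim (@Rhausdorff R) ul).
have al : (fun n => `|u n|) @ \oo --> `|l| by exact: (cvg_norm ul).
apply: clip_id; apply: (closed_cvg (fun x : R => x <= 1) _ _ _ al).
- exact: closed_le.
- exact: nearW.
Qed.

Lemma cvg0_bounded_series (u : nat -> R) (B : R) : (forall j, 0 <= u j) ->
  (forall n, \sum_(0 <= j < n) u j <= B) -> u @ \oo --> (0 : R).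
Proof.
move=> u0 h; apply: cvg_series_cvg_0; apply: nondecreasing_is_cvgn.
  by apply: nondecreasing_series => n _ _.
by exists B => _ [n _ <-]; exact: h.
Qed.

End limits.

Section mean_ergodic.
Context {R : realType} d (X : measurableType d).
Local Open Scope complex_scope.
Variables (T : X -> X) (mu : probability X R) (alpha : R).

(** The operator whose fixed functions are the eigenfunctions for e(alpha). *)
Definition rotate (C : X -> R[i]) : X -> R[i] := fun y => (e2pi alpha)^*%C * C (T y).

Definition sqnorm (C : X -> R[i]) : R := Rintegral mu setT (fun y => normc (C y) ^+ 2).

Variable CC : set (X -> R[i]).
Implicit Types C D : X -> R[i].
Hypothesis CC_Re : forall C, CC C -> measurable_fun setT (fun y => complex.Re (C y)).
Hypothesis CC_Im : forall C, CC C -> measurable_fun setT (fun y => complex.Im (C y)).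
Hypothesis CC_le1 : forall C, CC C -> forall y, normc (C y) <= 1.
Hypothesis CC_mid : forall C D, CC C -> CC D -> CC (fun y => 2^-1 * (C y + D y)).
Hypothesis CC_rotate : forall C, CC C -> CC (rotate C).
Hypothesis CC_invariant : forall C, CC C -> sqnorm (fun y => C (T y)) = sqnorm C.
Hypothesis CC_nonempty : CC !=set0.
Hypothesis alpha01 : 0 <= alpha < 1.

Let bRe C : CC C -> bounded_measurable (fun y => complex.Re (C y)).
Proof.
move=> hC; split; first exact: CC_Re.
by exists 1 => y; exact: le_trans (normr_Re_le _) (CC_le1 hC y).
Qed.

Let bIm C : CC C -> bounded_measurable (fun y => complex.Im (C y)).
Proof.
move=> hC; split; first exact: CC_Im.
by exists 1 => y; exact: le_trans (normr_Im_le _) (CC_le1 hC y).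
Qed.

Let bsq C : bounded_measurable (fun y => complex.Re (C y)) ->
  bounded_measurable (fun y => complex.Im (C y)) ->
  bounded_measurable (fun y => normc (C y) ^+ 2).
Proof.
move=> h1 h2; under eq_fun do rewrite sqr_normcE !expr2.
by apply: bounded_measurableD; apply: bounded_measurableM.
Qed.

Lemma normc_parallelogram (z w : R[i]) :
  normc (z - w) ^+ 2 = 2 * normc z ^+ 2 + 2 * normc w ^+ 2 - 4 * normc (2^-1 * (z + w)) ^+ 2.
Proof.
have e : (2^-1 : R[i]) = (2^-1)%:C by rewrite fmorphV rmorph_nat.
rewrite normcM exprMn e normc_real -normrX ger0_norm ?sqr_ge0 // !sqr_normcE; case: z => a b; case: w => a' b' /=.
by field.
Qed.

(** Two near minimizers are close to each other, because their midpoint cannot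
  have smaller norm. *)
Lemma sqnormB_le (delta e e' : R) C D : (forall C, CC C -> delta <= sqnorm C) -> CC C -> CC D ->
  sqnorm C <= delta + e -> sqnorm D <= delta + e' ->
  sqnorm (fun y => C y - D y) <= 2 * e + 2 * e'.
Proof.
move=> hd hC hD hCe hDe.
have hm := CC_mid hC hD.
have b1 : bounded_measurable (fun y => 2 * normc (C y) ^+ 2).
  by apply: bounded_measurableM; [exact: bounded_measurable_cst|apply: bsq; [exact: bRe|exact: bIm]].
have b2 : bounded_measurable (fun y => 2 * normc (D y) ^+ 2).
  by apply: bounded_measurableM; [exact: bounded_measurable_cst|apply: bsq; [exact: bRe|exact: bIm]].
have b3 : bounded_measurable (fun y => 4 * normc (2^-1 * (C y + D y)) ^+ 2).
  by apply: bounded_measurableM; [exact: bounded_measurable_cst|apply: (bsq (bRe hm) (bIm hm))].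
rewrite /sqnorm; under eq_Rintegral do rewrite normc_parallelogram.
rewrite expectB ?expectD ?expectZ //; try by apply: bsq; first [exact: bRe|exact: bIm].
  by have := hd _ hm; rewrite /sqnorm in hCe hDe *; lra.
exact: bounded_measurableD.
Qed.

Lemma sqnorm_rotate C : CC C -> sqnorm (rotate C) = sqnorm C.
Proof.
move=> hC; rewrite -(CC_invariant hC); apply: eq_Rintegral => y _.
by rewrite /rotate normcM /e2pi -cisN normc_cis mul1r.
Qed.

Lemma sum4_norm_le (t a b c e : R) : 0 < t ->
  `|a| + `|b| + `|c| + `|e| <= 2 * t + (2 * t)^-1 * ((a ^+ 2 + b ^+ 2) + (c ^+ 2 + e ^+ 2)).
Proof.
move=> t0.
have h (x : R) := normr_le_amgm x t0.
have := h a; have := h b; have := h c; have := h e; lra.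
Qed.

(** Near minimality of order 4 ^ (- j) makes consecutive terms, and each term and
  its rotate, 2 ^ (- j) close in L2, hence summably close in L1 and almost
  everywhere. *)
Lemma minimizing_sequence_cvg (Cs : nat -> X -> R[i]) (delta : R) :
  (forall C, CC C -> delta <= sqnorm C) -> (forall j, CC (Cs j)) ->
  (forall j, sqnorm (Cs j) <= delta + (2^-1 ^+ j) ^+ 2) ->
  {ae mu, forall y,
    [/\ cvgn (fun j => complex.Re (Cs j y)), cvgn (fun j => complex.Im (Cs j y)),
       (fun j => complex.Re (rotate (Cs j) y - Cs j y)) @ \oo --> (0 : R)
     & (fun j => complex.Im (rotate (Cs j) y - Cs j y)) @ \oo --> (0 : R)]}.
Proof.
move=> hd hCs hq.
pose A j y := Cs j.+1 y - Cs j y.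
pose B j y := rotate (Cs j) y - Cs j y.
pose U j y := `|complex.Re (A j y)| + `|complex.Im (A j y)| + `|complex.Re (B j y)| + `|complex.Im (B j y)|.
have bA j : bounded_measurable (fun y => complex.Re (A j y)) /\ bounded_measurable (fun y => complex.Im (A j y)).
  by split; rewrite /A; under eq_fun do rewrite raddfB /=; apply: bounded_measurableB;
    first [exact: bRe|exact: bIm].
have bB j : bounded_measurable (fun y => complex.Re (B j y)) /\ bounded_measurable (fun y => complex.Im (B j y)).
  have hr := CC_rotate (hCs j).
  by split; rewrite /B; under eq_fun do rewrite raddfB /=; apply: bounded_measurableB;
    first [exact: bRe|exact: bIm].
have bU j : bounded_measurable (U j).
  have [? ?] := bA j; have [? ?] := bB j.
  by rewrite /U; repeat apply: bounded_measurableD; exact: bounded_measurable_norm.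
have U0 j y : 0 <= U j y by rewrite /U !addr_ge0.
have iU j : Rintegral mu setT (U j) <= 6 * 2^-1 ^+ j.
  set t := 2^-1 ^+ j; have t0 : 0 < t :> R by rewrite exprn_gt0 // invr_gt0.
  have tS : 2^-1 ^+ j.+1 = t / 2 :> R by rewrite exprS mulrC.
  have qA : sqnorm (A j) <= 4 * t ^+ 2.
    have := sqnormB_le hd (hCs j.+1) (hCs j) (hq j.+1) (hq j); rewrite tS.
    by have := sqr_ge0 t; rewrite -/t; lra.
  have qB : sqnorm (B j) <= 4 * t ^+ 2.
    have hr : sqnorm (rotate (Cs j)) <= delta + t ^+ 2 by rewrite sqnorm_rotate ?hq.
    by have := sqnormB_le hd (CC_rotate (hCs j)) (hCs j) hr (hq j); rewrite -/t; lra.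
  have bAB : bounded_measurable (fun y => normc (A j y) ^+ 2 + normc (B j y) ^+ 2).
    by have [? ?] := bA j; have [? ?] := bB j; apply: bounded_measurableD; exact: bsq.
  apply: (@le_trans _ _ (Rintegral mu setT (fun y => 2 * t + (2 * t)^-1 * (normc (A j y) ^+ 2 + normc (B j y) ^+ 2)))).
    apply: expect_le => //.
      apply: bounded_measurableD; first exact: bounded_measurable_cst.
      by apply: bounded_measurableM => //; exact: bounded_measurable_cst.
    by move=> y; rewrite !sqr_normcE; exact: sum4_norm_le.
  rewrite expectD ?expect_cst ?expectZ ?expectD //; first last.
  - by apply: bounded_measurableM => //; exact: bounded_measurable_cst.
  - exact: bounded_measurable_cst.
  - by have [? ?] := bB j; exact: bsq.
  - by have [? ?] := bA j; exact: bsq.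
  rewrite -/(sqnorm (A j)) -/(sqnorm (B j)).
  have : (2 * t)^-1 * (sqnorm (A j) + sqnorm (B j)) <= (2 * t)^-1 * (8 * t ^+ 2).
    by rewrite ler_wpM2l ?invr_ge0 ?mulr_ge0 ?(ltW t0) //; lra.
  rewrite (_ : _ * (8 * _) = 4 * t); first lra.
  by field; rewrite gt_eqF.
have := ae_summable bU U0 iU; apply: filterS => y [M hM].
have part (F : nat -> R) : (forall j, 0 <= F j <= U j y) -> forall n, \sum_(0 <= j < n) F j <= M.
  by move=> hF n; apply: (le_trans _ (hM n)); apply: ler_sum => j _; have /andP[] := hF j.
split.
- apply: (@cvg_bounded_variation _ _ M); apply: part => j; rewrite normr_ge0 /= -raddfB /U -!addrA lerDl.
  by rewrite !addr_ge0.
- apply: (@cvg_bounded_variation _ _ M); apply: part => j; rewrite normr_ge0 /= -raddfB /U.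
  by rewrite -2!addrA addrCA lerDl !addr_ge0.
- apply: norm_cvg0; apply: (@cvg0_bounded_series _ _ M) => [j|]; first exact: normr_ge0.
  apply: part => j; rewrite normr_ge0 /= /U -/(B j y).
  by rewrite -addrA addrCA lerDl !addr_ge0.
- apply: norm_cvg0; apply: (@cvg0_bounded_series _ _ M) => [j|]; first exact: normr_ge0.
  apply: part => j; rewrite normr_ge0 /= /U -/(B j y).
  by rewrite lerDr !addr_ge0.
Qed.

Lemma cvg_normc2 (z : nat -> R[i]) (a b : R) :
  (fun j => complex.Re (z j)) @ \oo --> a -> (fun j => complex.Im (z j)) @ \oo --> b ->
  (fun j => normc (z j) ^+ 2) @ \oo --> a ^+ 2 + b ^+ 2.
Proof.
move=> ha hb; under eq_fun do rewrite sqr_normcE !expr2.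
by rewrite !expr2; exact: (cvgD (cvgM ha ha) (cvgM hb hb)).
Qed.

(** If the infimum of the norms were positive, the almost everywhere limit of a
  minimizing sequence would be fixed by the rotation, and nonzero by dominated
  convergence: an eigenfunction. *)
Theorem small_element_of_missing_eigenvalue (eta : R) :
  ~ system_spectrum T mu alpha -> 0 < eta -> exists2 C, CC C & sqnorm C < eta.
Proof.
move=> nspec eta0; apply: contrapT => hno; apply: nspec; split=> //.
have q_ge C : CC C -> eta <= sqnorm C.
  by move=> hC; rewrite leNgt; apply/negP => h; apply: hno; exists C.
pose E := [set sqnorm C | C in CC].
have hE : has_inf E.
  split; first by have [C hC] := CC_nonempty; exists (sqnorm C), C.
  by exists eta => _ [C hC <-]; exact: q_ge.
have hd C : CC C -> inf E <= sqnorm C by move=> hC; apply: ge_inf; [exact: hE.2|exists C].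
have /choice[Cs hCs] j : exists C, CC C /\ sqnorm C <= inf E + (2^-1 ^+ j) ^+ 2.
  have e0 : 0 < (2^-1 ^+ j) ^+ 2 :> R by rewrite !exprn_gt0 // invr_gt0.
  by have [_ [C hC <-] h] := inf_adherent e0 hE; exists C; split=> //; exact: ltW.
have hC j : CC (Cs j) by have [] := hCs j.
have hq j : sqnorm (Cs j) <= inf E + (2^-1 ^+ j) ^+ 2 by have [] := hCs j.
have ReC1 j y : `|complex.Re (Cs j y)| <= 1 := le_trans (normr_Re_le _) (CC_le1 (hC j) y).
have ImC1 j y : `|complex.Im (Cs j y)| <= 1 := le_trans (normr_Im_le _) (CC_le1 (hC j) y).
pose gr y := clip (limn_sup (fun j => complex.Re (Cs j y))).
pose gi y := clip (limn_sup (fun j => complex.Im (Cs j y))).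
have conv := minimizing_sequence_cvg hd hC hq.
have mclip (F : nat -> X -> R) : (forall j y, `|F j y| <= 1) -> (forall j, measurable_fun setT (F j)) ->
    measurable_fun setT (fun y => clip (limn_sup (fun j => F j y))).
  move=> F1 mF; rewrite /clip; apply: measurable_maxr; first exact: measurable_cst.
  apply: measurable_minr; first exact: measurable_cst.
  apply: measurable_fun_limn_sup => // y _.
    by exists 1 => _ [j _ <-]; have := F1 j y; rewrite ler_norml => /andP[].
  by exists (-1) => _ [j _ <-]; have := F1 j y; rewrite ler_norml => /andP[].
have mgr : measurable_fun setT gr by apply: mclip => // j; exact: CC_Re.
have mgi : measurable_fun setT gi by apply: mclip => // j; exact: CC_Im.
have gE : {ae mu, forall y, (fun j => complex.Re (Cs j y)) @ \oo --> gr y /\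
    (fun j => complex.Im (Cs j y)) @ \oo --> gi y}.
  apply: filterS conv => y [/cvg_ex[a ha] /cvg_ex[b hb] _ _].
  by split; rewrite /gr /gi; [rewrite (clip_limn_sup _ ha)|rewrite (clip_limn_sup _ hb)].
exists (fun y => gr y +i* gi y); split.
- split; [exact: mgr|exact: mgi|].
  apply: (@le_lt_trans _ _ (\int[mu]_y (cst 2%:E y))%E); last first.
    by rewrite integral_cst //= [mu _]probability_setT mule1 ltry.
  apply: ge0_le_integral => //.
  - by move=> y _; rewrite lee_fin sqr_ge0.
  - apply/measurable_EFinP; under eq_fun do rewrite sqr_normcE /=.
    by apply: measurable_funD; apply: measurable_funX.
  - move=> y _; rewrite lee_fin sqr_normcE /=.
    have := normr_clip (limn_sup (fun j => complex.Re (Cs j y))).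
    have := normr_clip (limn_sup (fun j => complex.Im (Cs j y))).
    rewrite -/(gr y) -/(gi y) !ler_norml => /andP[? ?] /andP[? ?]; nra.
- move=> g0.
  have lim0 : {ae mu, forall y, setT y -> (fun j => (normc (Cs j y) ^+ 2)%:E) @ \oo --> (0%:E : \bar R)}.
    apply: filterS2 gE g0 => y [ha hb] [ga gb] _; apply: cvg_EFin; first exact: nearW.
    have := cvg_normc2 ha hb; rewrite ga gb expr0n addr0; exact.
  have bq j := bsq (bRe (hC j)) (bIm (hC j)).
  have m1 j : measurable_fun setT (fun y => (normc (Cs j y) ^+ 2)%:E) by apply/measurable_EFinP; case: (bq j).
  have i1 : mu.-integrable setT (cst 1%:E : X -> \bar R).
    have := bounded_measurable_integrable mu (@bounded_measurable_cst R d X 1); exact.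
  have le1 : {ae mu, forall y, forall j, setT y -> (`|(normc (Cs j y) ^+ 2)%:E| <= cst 1%:E y)%E}.
    apply: aeW => y j _; rewrite lee_fin ger0_norm ?sqr_ge0 //.
    by rewrite expr_le1 ?normc_ge0 // CC_le1.
  have [_ _] := dominated_convergence measurableT m1 (measurable_cst _) lim0 i1 le1.
  rewrite integral0 => h.
  have h' : (fun j => sqnorm (Cs j)) @ \oo --> (0 : R) by exact: (fine_cvg h).
  have : eta <= 0 by apply: (cvgr_to_ge h'); apply: nearW => j; exact: q_ge.
  by rewrite leNgt eta0.
- apply: filterS2 gE conv => y [ha hb] [_ _ hr hi].
  have CT j : Cs j (T y) = e2pi alpha * rotate (Cs j) y.
    by rewrite /rotate mulrA /e2pi -cisN cisMN mul1r.
  have rRe : (fun j => complex.Re (rotate (Cs j) y)) @ \oo --> gr y.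
    rewrite -[gr y]addr0 (_ : (fun j => complex.Re _) = (fun j => complex.Re (Cs j y) + complex.Re (rotate (Cs j) y - Cs j y))).
      exact: (cvgD ha hr).
    by apply/funext => j; rewrite -raddfD /= subrKC.
  have rIm : (fun j => complex.Im (rotate (Cs j) y)) @ \oo --> gi y.
    rewrite -[gi y]addr0 (_ : (fun j => complex.Im _) = (fun j => complex.Im (Cs j y) + complex.Im (rotate (Cs j) y - Cs j y))).
      exact: (cvgD hb hi).
    by apply/funext => j; rewrite -raddfD /= subrKC.
  set co := complex.Re (e2pi alpha); set si := complex.Im (e2pi alpha).
  have ReM z : complex.Re (e2pi alpha * z) = co * complex.Re z - si * complex.Im z by case: z.
  have ImM z : complex.Im (e2pi alpha * z) = co * complex.Im z + si * complex.Re z by case: z.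
  have TRe : (fun j => complex.Re (Cs j (T y))) @ \oo --> co * gr y - si * gi y.
    under eq_fun do rewrite CT ReM.
    exact: (cvgB (cvgM (cvg_cst co) rRe) (cvgM (cvg_cst si) rIm)).
  have TIm : (fun j => complex.Im (Cs j (T y))) @ \oo --> co * gi y + si * gr y.
    under eq_fun do rewrite CT ImM.
    exact: (cvgD (cvgM (cvg_cst co) rIm) (cvgM (cvg_cst si) rRe)).
  have -> : gr (T y) = co * gr y - si * gi y by exact: clip_limn_sup TRe.
  have -> : gi (T y) = co * gi y + si * gr y by exact: clip_limn_sup TIm.
  by apply/eqP; rewrite eq_complex ReM ImM /= !eqxx.
Qed.

End mean_ergodic.

(** * From the spectrum to correlations of the sequence *)

Section spectral_to_arithmetic.
Context {R : realType}.
Local Open Scope complex_scope.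
Local Notation X := (borel_sequence_space R).
Local Notation T := (@shift_map R).
Local Notation wt c n := ((weight R c n)%:num).
Variables (c : averaging) (mu : probability X R) (N_ : nat -> nat) (x : X) (f : nat -> unit_disc R).
Hypothesis hN : {homo N_ : j k / (j < k)%N}.
Hypothesis hx : forall F : sequence_space R -> R, continuous F ->
  (fun k => weighted_average c (fun n => F (iter n T x)) (N_ k)) @ \oo --> Rintegral mu setT F.
Hypothesis xf : extends_sequence x f.

(** Functions whose values along the orbit cannot be told apart from f by
  correlation with the frequency alpha.  They contain the coordinate 0 and are
  stable under midpoints and rotation, so that the ergodic theorem finds
  functions of small norm among them. *)
Definition observes_twist (alpha : R) : set (X -> R[i]) := [set C |
  [/\ continuous (fun y : sequence_space R => complex.Re (C y)),
      continuous (fun y : sequence_space R => complex.Im (C y)),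
      forall y, normc (C y) <= 1
    & forall omega, slowly_varying omega -> wnull c N_ (fun n =>
        omega n * cis (- (2 * pi * alpha * n%:R)) * (C (iter n T x) - disc_val (f n)))]].

Lemma observes_twist_coordinate alpha : observes_twist alpha (fun y => disc_val (y 0)).
Proof.
split=> [||y|omega _]; first exact: continuous_Re_coordinate.
- exact: continuous_Im_coordinate.
- exact: disc_valP.
apply: eq_wnull (wnull0 c N_) => n n0.
by rewrite iter_shift add0r xf // subrr mulr0.
Qed.

Lemma observes_twist_mid alpha C D : observes_twist alpha C -> observes_twist alpha D ->
  observes_twist alpha (fun y => 2^-1 * (C y + D y)).
Proof.
move=> [C1 C2 C3 C4] [D1 D2 D3 D4].
have e : (2^-1 : R[i]) = (2^-1)%:C by rewrite fmorphV rmorph_nat.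
have eRe (z : R[i]) : complex.Re (2^-1 * z) = 2^-1 * complex.Re z.
  by rewrite e; case: z => a b /=; rewrite mul0r subr0.
have eIm (z : R[i]) : complex.Im (2^-1 * z) = 2^-1 * complex.Im z.
  by rewrite e; case: z => a b /=; rewrite mul0r addr0.
split=> [||y|omega ho].
- under eq_fun do rewrite eRe raddfD /=.
  by apply: continuous_mulr; [exact: cst_continuous|exact: continuous_addr].
- under eq_fun do rewrite eIm raddfD /=.
  by apply: continuous_mulr; [exact: cst_continuous|exact: continuous_addr].
- rewrite normcM e normc_real ger0_norm ?invr_ge0 //.
  have := C3 y; have := D3 y; have := le_normcD (C y) (D y); lra.
apply: eq_wnull (wnullZ (2^-1) (wnullD (C4 _ ho) (D4 _ ho))) => n _; field; exact: isT.
Qed.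

(** The rotation by - alpha compensates the translation of n by 1 in the twist;
  averages are asymptotically translation invariant ([wnull_shift]), and omega
  varies slowly. *)
Lemma observes_twist_rotate alpha C : observes_twist alpha C ->
  observes_twist alpha (rotate T alpha C).
Proof.
move=> [C1 C2 C3 C4].
have CT1 := continuous_comp_shift C1; have CT2 := continuous_comp_shift C2.
set co := complex.Re (e2pi alpha)^*%C; set si := complex.Im (e2pi alpha)^*%C.
have ReM z : complex.Re ((e2pi alpha)^*%C * z) = co * complex.Re z - si * complex.Im z by case: z.
have ImM z : complex.Im ((e2pi alpha)^*%C * z) = co * complex.Im z + si * complex.Re z by case: z.
split=> [||y|omega ho].
- under eq_fun do rewrite /rotate ReM.
  by apply: continuous_subr; apply: continuous_mulr => //; exact: cst_continuous.
- under eq_fun do rewrite /rotate ImM.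
  by apply: continuous_addr; apply: continuous_mulr => //; exact: cst_continuous.
- by rewrite /rotate normcM /e2pi -cisN normc_cis mul1r.
have [om1 omslow] := ho.
pose tw n : R[i] := cis (- (2 * pi * alpha * n%:R)).
pose h n := omega n * tw n * C (iter n T x).
have h1 n : normc (h n) <= 1.
  by rewrite /h !normcM normc_cis mulr1 mulr_ile1 ?normc_ge0.
have n1 := wnull_shift c hN h1.
have n2 : wnull c N_ (fun n => (omega n - omega n.+1) * (tw n.+1 * C (iter n.+1 T x))).
  apply: wnull_cvg0 => // e e0; apply: filterS (omslow e e0) => n; apply: le_trans.
  by rewrite !normcM normc_cis mul1r normcBC ler_piMr ?normc_ge0.
apply: eq_wnull (wnullD (wnullD n1 n2) (C4 _ ho)) => n _.
have twS : tw n.+1 = (e2pi alpha)^*%C * tw n.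
  by rewrite /tw /e2pi -cisN -cisD -natr1; congr cis; ring.
by rewrite /h /rotate -iterS twS -/(tw n); ring.
Qed.

(** Replace f by the values along the orbit of a function C of small L2 norm: the
  average of |C| along the orbit is controlled by that of |C| ^ 2, which tends
  to the squared norm. *)
Lemma trivial_spectrum_no_correlation : trivial_rational_spectrum T mu ->
  no_rational_correlation c N_ (fun n => disc_val (f n)).
Proof.
move=> triv omega ho Q a /andP[a0 aQ] e e0.
set alpha := a%:R / Q%:R; set tw : nat -> R[i] := fun n => cis (- (2 * pi * alpha * n%:R)).
have Q0 : (0 < Q)%N by exact: leq_trans aQ.
have Q0' : 0 < Q%:R :> R by rewrite ltr0n.
have alpha0 : alpha != 0 by rewrite mulf_neq0 // ?invr_eq0 gt_eqF // ltr0n.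
have alpha01 : 0 <= alpha < 1.
  by rewrite /alpha divr_ge0 //= ltr_pdivrMr // mul1r ltr_nat.
have nspec : ~ system_spectrum T mu alpha.
  move=> hs; move/negP: alpha0; apply; apply/eqP.
  suff : [set 0] alpha by [].
  rewrite -triv; split=> //; exists (a%:R / Q%:R) => //.
  by rewrite rmorphM fmorphV !rmorph_nat.
pose t := e / 2; have t0 : 0 < t by rewrite divr_gt0.
have [C [C1 C2 C3 C4] qC] : exists2 C, observes_twist alpha C & sqnorm mu C < t ^+ 2.
  apply: (@small_element_of_missing_eigenvalue _ _ _ T mu alpha (observes_twist alpha)) => //.
  - by move=> C [C1 _ _ _]; exact: continuous_measurable.
  - by move=> C [_ C2 _ _]; exact: continuous_measurable.
  - by move=> C [].
  - exact: observes_twist_mid.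
  - exact: observes_twist_rotate.
  - move=> C [C1 C2 _ _]; rewrite /sqnorm.
    under eq_Rintegral do rewrite sqr_normcE; under [RHS]eq_Rintegral do rewrite sqr_normcE.
    exact: (shift_invariant hN hx (continuous_sqnorm C1 C2)).
  - by exists (fun y => disc_val (y 0)); exact: observes_twist_coordinate.
  - exact: exprn_gt0.
have hC := hx (continuous_sqnorm C1 C2).
have qC' : Rintegral mu setT (fun y => complex.Re (C y) ^+ 2 + complex.Im (C y) ^+ 2) < t ^+ 2.
  by move: qC; rewrite /sqnorm; under eq_Rintegral do rewrite sqr_normcE.
near=> k.
have k0 : (0 < N_ k)%N by near: k; exact: near_subseq hN (nbhs_infty_gt 0).
have W0 : 0 < total_weight R c (N_ k) by exact: lt_le_trans ltr01 (total_weight_ge1 c k0).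
have hB : normc (wsum c (fun n => omega n * tw n * (C (iter n T x) - disc_val (f n))) (N_ k)) <= e / 2 * total_weight R c (N_ k).
  by near: k; apply: C4 => //; rewrite divr_gt0.
have avg : weighted_average c (fun n => complex.Re (C (iter n T x)) ^+ 2 + complex.Im (C (iter n T x)) ^+ 2) (N_ k) <= t ^+ 2.
  by near: k; exact: (cvgr_le _ hC).
have hA : normc (wsum c (fun n => omega n * tw n * C (iter n T x)) (N_ k)) <= t * total_weight R c (N_ k).
  apply: (le_trans (normc_wsum_le _ _ _)).
  apply: (@le_trans _ _ (\sum_(1 <= n < (N_ k).+1) (t / 2 * wt c n +
      (2 * t)^-1 * (wt c n * (complex.Re (C (iter n T x)) ^+ 2 + complex.Im (C (iter n T x)) ^+ 2))))).
    apply: ler_sum => n _; rewrite -sqr_normcE.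
    rewrite (_ : t / 2 * _ + _ = wt c n * (t / 2 + (2 * t)^-1 * normc (C (iter n T x)) ^+ 2)); last by ring.
    apply: ler_wpM2l => //.
    rewrite !normcM normc_cis mulr1; set z := normc (C _).
    have z0 : 0 <= z by exact: normc_ge0.
    apply: (@le_trans _ _ z); first by rewrite ler_piMl //; exact: ho.1.
    by have := normr_le_amgm z t0; rewrite ger0_norm // [X in _ + X]mulrC.
  rewrite big_split /= -!mulr_sumr -/(total_weight R c (N_ k)).
  move: avg; rewrite /weighted_average mulrC ler_pdivrMr // => avg.
  have := ler_wpM2l (ltW (_ : 0 < (2 * t)^-1)) avg; rewrite invr_gt0 mulr_gt0 // => /(_ isT).
  have -> : (2 * t)^-1 * (t ^+ 2 * total_weight R c (N_ k)) = t / 2 * total_weight R c (N_ k).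
    by field; rewrite gt_eqF.
  lra.
have -> : wsum c (fun n => omega n * tw n * disc_val (f n)) (N_ k) =
    wsum c (fun n => omega n * tw n * C (iter n T x)) (N_ k) -
    wsum c (fun n => omega n * tw n * (C (iter n T x) - disc_val (f n))) (N_ k).
  rewrite -[X in _ - X]mul1r -mulNr -wsumZ -wsumD; apply: eq_bigr => n _; congr (_ * _); ring.
by apply: (le_trans (le_normcB _ _)); rewrite /t in hA; lra.
Unshelve. all: by end_near.
Qed.

End spectral_to_arithmetic.

(** * Pretentious multiplicative functions *)

Section conclusion.
Context {R : realType}.
Local Open Scope complex_scope.
Local Notation X := (borel_sequence_space R).
Local Notation T := (@shift_map R).

Lemma bounded_series_tail (u : nat -> R) (B e : R) : (forall p, 0 <= u p) ->
  (forall n, \sum_(0 <= p < n) u p <= B) -> 0 < e ->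
  exists K, forall K' N, (K <= K')%N -> \sum_(K' <= p < N) u p <= e.
Proof.
move=> u0 h e0.
have nd : nondecreasing_seq (series u) by apply: nondecreasing_series => n _ _.
have cu : cvgn (series u) by apply: nondecreasing_is_cvgn => //; exists B => _ [n _ <-]; exact: h.
have le_lim n : series u n <= limn (series u) by exact: nondecreasing_cvgn_le.
have le : limn (series u) - e < limn (series u) by rewrite ltrBlDr ltrDl.
have [K _ hK] := cvgr_gt _ cu _ le.
exists K => K' N KK'; have /= := hK K' KK'; rewrite /series /= => h1.
have [NK|KN] := leqP N K'; first by rewrite big_geq ?(ltW e0).
have := le_lim N; rewrite /series /= (big_cat_nat (n := K')) ?(ltnW KN) //=; lra.
Qed.

(** The finite distance is a convergent series with nonnegative terms. *)
Lemma pretentious_tail (f : nat -> R[i]) (g : nat -> R[i]) :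
  (forall n, normc (f n) <= 1) -> (forall n, normc (g n) <= 1) -> pretentious_equiv f g ->
  forall e : R, 0 < e -> exists K, forall K' N, (K <= K')%N ->
  \sum_(K'.+1 <= p < N.+1 | prime p) defect (fun n => f n * (g n)^*%C) p / p%:R <= e.
Proof.
move=> f1 g1 hfg e e0.
pose v p : R := p%:R^-1 * (1 - complex.Re (f p * (g p)^*%C)).
have v0 p : 0 <= v p.
  rewrite mulr_ge0 ?invr_ge0 // subr_ge0; apply: le_trans (_ : normc (f p * (g p)^*%C) <= 1).
    exact: le_trans (ler_norm _) (normr_Re_le _).
  by rewrite normcM mulr_ile1 ?normc_ge0 // (_ : normc _ = normc (g p)) //; case: (g p) => a b; rewrite /= sqrrN.
have D_fin : (pretentious_dist2 f g < +oo)%E.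
  by move: hfg; rewrite /pretentious_equiv /pretentious_dist; case: (pretentious_dist2 f g) => // r _; exact: ltry.
pose B := fine (pretentious_dist2 f g).
have D0 : (0 <= pretentious_dist2 f g)%E by apply: nneseries_ge0 => p _ _; rewrite lee_fin v0.
have hB n : \sum_(0 <= p < n) (if prime p then v p else 0) <= B.
  rewrite -big_mkcond -lee_fin fineK ?ge0_fin_numE // -sumEFin.
  by apply: nneseries_lim_ge => p _ _; rewrite lee_fin v0.
have u0 p : 0 <= (if prime p then v p else 0) by case: ifP.
have [K hK] := bounded_series_tail u0 hB e0.
exists K => K' N KK'.
have := hK K'.+1 N.+1 (leqW KK'); rewrite -big_mkcond; apply: le_trans.
by rewrite le_eqVlt; apply/orP; left; apply/eqP/eq_bigr => p _; rewrite /defect mulrC.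
Qed.

Section arguments.
Variable f : nat -> unit_disc R.
Hypothesis fM : multiplicative_function f.
Hypothesis fP : pretentious_function f.

Lemma nat_ipow_of_trivial_spectrum c (mu : probability X R) :
  furstenberg_system c f mu -> trivial_rational_spectrum T mu ->
  exists t : R, forall n : nat, (0 < n)%N -> disc_val (f n) = nat_ipow t n.
Proof.
move=> /furstenberg_averages [N_ [x [hN xf hx]]] triv.
have [t [q [chi [[hchi _] hdist]]]] := fP; exists t => n n0.
have g1 n' : normc (nat_ipow t n' * chi n') <= 1.
  by rewrite normcM normc_cis mul1r; exact: normc_dirichlet_character hchi.
have f1 n' : normc (disc_val (f n')) <= 1 by exact: disc_valP.
have hcor := trivial_spectrum_no_correlation hN hx xf triv.
exact: (pretentious_rigidity f1 fM hchi (pretentious_tail f1 g1 hdist) hN hcor n0).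
Qed.

End arguments.

Lemma nat_ipow_gap (f : nat -> unit_disc R) (t : R) :
  (forall n : nat, (0 < n)%N -> disc_val (f n) = nat_ipow t n) ->
  forall e : R, 0 < e -> \forall n \near \oo, normc (disc_val (f n.+1) - disc_val (f n)) <= e.
Proof.
move=> ft e e0; have [_ slow] := @ln_slow R (- t).
have ipowE k : nat_ipow t k = cis (- (- t * ln k%:R)) by rewrite mulNr opprK.
near=> n; have n0 : (0 < n)%N by near: n; exact: nbhs_infty_gt.
rewrite !ft // !ipowE.
by near: n; exact: slow.
Unshelve. all: by end_near.
Qed.

Lemma nat_ipow_average_gap (f : nat -> unit_disc R) (t : R) c N_ : {homo N_ : j k / (j < k)%N} ->
  (forall n : nat, (0 < n)%N -> disc_val (f n) = nat_ipow t n) ->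
  (fun k => weighted_average c (fun n => normc (disc_val (f n.+1) - disc_val (f n))) (N_ k)) @ \oo --> (0 : R).
Proof.
move=> hN ft; apply/(wnull_real c hN); apply: wnull_cvg0 => // e e0.
by apply: filterS (nat_ipow_gap ft e0) => n; rewrite normc_real ger0_norm // normc_ge0.
Qed.

Lemma identity_of_gaps (f : nat -> unit_disc R) c (mu : probability X R) :
  (forall N_, {homo N_ : j k / (j < k)%N} ->
   (fun k => weighted_average c (fun n => normc (disc_val (f n.+1) - disc_val (f n))) (N_ k)) @ \oo --> (0 : R)) ->
  furstenberg_system c f mu -> identity_system T mu.
Proof.
move=> h /furstenberg_averages [N_ [x [hN xf hx]]].
apply: (identity_of_small_gaps hN hx).
rewrite (_ : (fun k => _) = (fun k => weighted_average c (fun n => normc (disc_val (f n.+1) - disc_val (f n))) (N_ k))).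
  exact: h.
apply/funext => k; rewrite /weighted_average; congr (_ * _).
by apply: eq_big_nat => n /andP[n0 _]; rewrite !xf.
Qed.

End conclusion.

Theorem corollary2p10 (R : realType) (f : nat -> unit_disc R)
    (f_multiplicative : multiplicative_function f)
    (f_pretentious : pretentious_function f) :
  [<-> exists t : R, forall n : nat, (0 < n)%N -> disc_val (f n) = nat_ipow t n;
       exists (c : averaging) (mu : probability (borel_sequence_space R) R),
         furstenberg_system c f mu /\
         trivial_rational_spectrum (@shift_map R) mu;
       forall (c : averaging) (mu : probability (borel_sequence_space R) R),
         furstenberg_system c f mu ->
         trivial_rational_spectrum (@shift_map R) mu;
       forall (c : averaging) (mu : probability (borel_sequence_space R) R),
         furstenberg_system c f mu -> identity_system (@shift_map R) mu;
       weighted_average Cesaro (fun n =>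
         Normc.normc (disc_val (f n.+1) - disc_val (f n))) @ \oo
         --> (0 : R)].
Proof.
have identity_of_ipow : (exists t : R, forall n : nat, (0 < n)%N -> disc_val (f n) = nat_ipow t n) ->
    forall c mu, furstenberg_system c f mu -> identity_system (@shift_map R) mu.
  move=> [t ft] c mu; apply: identity_of_gaps => N_ hN; exact: nat_ipow_average_gap hN ft.
have ipow_of_trivial := nat_ipow_of_trivial_spectrum f_multiplicative f_pretentious.
have [mu0 hmu0] := furstenberg_system_exists f.
tfae.
- move=> hi; exists Cesaro, mu0; split=> //.
  exact: identity_trivial_rational_spectrum (identity_of_ipow hi _ _ hmu0).
- move=> [c [mu [hmu triv]]] c' mu' hmu'.
  exact: identity_trivial_rational_spectrum (identity_of_ipow (ipow_of_trivial _ _ hmu triv) _ _ hmu').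
- move=> h c mu hmu; exact: identity_of_ipow (ipow_of_trivial _ _ hmu (h c mu hmu)) _ _ hmu.
- move=> h.
  have [t ft] := ipow_of_trivial _ _ hmu0 (identity_trivial_rational_spectrum (h _ _ hmu0)).
  apply: (nat_ipow_average_gap Cesaro (N_ := id) _ ft) => j k; exact.
- move=> h; apply: (ipow_of_trivial _ _ hmu0); apply: identity_trivial_rational_spectrum.
  apply: identity_of_gaps hmu0 => N_ hN A hA; exact: (near_subseq hN (h A hA)).
Qed.
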